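(* Let $\mathcal{T}$ be a planar rhombus tiling of codimension two. If the subperiods of $\mathcal{T}$ characterize finitely many slopes, then $\mathcal{T}$ (that is, its slope) admits local rules.
   Context: **Rhombus tilings.** Fix $n\ge 3$ pairwise non-collinear unit vectors $\vec v_1,\dots,\vec v_n$ of the Euclidean plane (all tilings considered use the same $\vec v_i$'s). They define the prototiles $T_{ij}=\{\lambda\vec v_i+\mu\vec v_j : 0\le\lambda,\mu\le1\}$, $i<j$. A tile is a translated prototile. A rhombus tiling is a covering of $\mathbb{R}^2$ by interior-disjoint tiles which is edge-to-edge: a non-empty intersection of two distinct tiles is either a vertex or an entire edge. **Lift.** Let $\vec e_1,\dots,\vec e_n$ be the canonical basis of $\mathbb{R}^n$. A rhombus tiling is lifted in $\mathbb{R}^n$ by mapping an arbitrary vertex to the origin and each tile $T_{ij}$ to a two-dimensional face of a unit hypercube of $\mathbb{Z}^n$ generated by $\vec e_i,\vec e_j$, tiles adjacent along an edge $\vec v_i$ being mapped to faces adjacent along an edge $\vec e_i$. The lift is a stepped surface in $\mathbb{R}^n$, unique up to the choice of the initial vertex. The tiling has codimension $n-2$; codimension two means $n=4$. **Planarity.** A rhombus tiling is planar if there are $t\ge1$ and an affine ($2$-dimensional) plane $E\subset\mathbb{R}^n$ such that the tiling can be lifted into $E+[0,t]^n$; the smallest such $t$ is the thickness and the corresponding $E$ is the slope. It is strongly planar if the thickness is $1$. **Subperiods.** For $i<j<k$, the $ijk$-shadow of a rhombus tiling is the orthogonal projection of its lift onto the space generated by $\vec e_i,\vec e_j,\vec e_k$.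 An $ijk$-subperiod is a prime period of the $ijk$-shadow, i.e. a translation vector leaving the shadow invariant that is not a proper multiple of another such vector (hence an integer vector). **Characterizing slopes.** The Grassmann coordinates of a plane generated by $(u_1,\dots,u_n)$ and $(v_1,\dots,v_n)$ are $G_{ij}=u_iv_j-u_jv_i$, $i<j$, defined up to a common factor. A non-zero real tuple $(G_{ij})_{i<j}$ is the tuple of Grassmann coordinates of some plane if and only if it satisfies the Plücker relations $G_{ij}G_{kl}=G_{ik}G_{jl}-G_{il}G_{jk}$ for $i<j<k<l$. To an $ijk$-subperiod $(p,q,r)$ is associated the linear relation $pG_{jk}-qG_{ik}+rG_{ij}=0$. A set of subperiods characterizes finitely many slopes if the system made of the Plücker relations and the linear relations associated with these subperiods has only finitely many solutions, up to a common factor. **Local rules.** An $r$-map of a tiling is the pattern formed by all the tiles which intersect some disk of diameter $r$ drawn on the tiling (patterns are considered up to translation); the $r$-atlas of a tiling is the set of all its $r$-maps. A strongly planar rhombus tiling of slope $E$ admits local rules of diameter $r$ and thickness $t$ if, whenever its $r$-atlas contains the $r$-atlas of another rhombus tiling, this latter is planar with slope $E$ and thickness at most $t$. It admits local rules if this holds for some $r$ and $t$. By extension, the slope $E$ itself is then said to admit local rules. *)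

(* Defs.v *)
From mathcomp Require Import all_boot all_order all_algebra.
From mathcomp Require Import all_classical all_reals all_analysis.

Set Implicit Arguments.
Unset Strict Implicit.
Unset Printing Implicit Defensive.

Import Order.TTheory GRing.Theory Num.Theory.
Import numFieldNormedType.Exports.

Local Open Scope classical_set_scope.
Local Open Scope ring_scope.

(* The library norm on 'rV[R]_2 is the sup norm, hence this definition.       *)
Definition enorm (R : realType) (x : 'rV[R]_2) : R :=
  Num.sqrt (\sum_k x 0 k ^+ 2).

Definition edisk (R : realType) (c : 'rV[R]_2) (r : R) : set 'rV[R]_2 :=
  [set x | enorm (x - c) <= r / 2].

(* A tile is recorded by its indices (i, j) and its translation vector x: it   *)
(* stands for x + T_ij. As i < j is imposed in rhombus_tiling and the v_i are  *)
(* pairwise non-collinear unit vectors, distinct records have distinct         *)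
(* supports.                                                                   *)
Record tile (R : realType) (n : nat) := Tile {
  tile_i : 'I_n;
  tile_j : 'I_n;
  tile_pos : 'rV[R]_2 }.

Definition tile_supp (R : realType) (n : nat) (v : 'I_n -> 'rV[R]_2)
    (a : tile R n) : set 'rV[R]_2 :=
  [set z | exists l m : R, [/\ 0 <= l <= 1, 0 <= m <= 1 &
     z = tile_pos a + (l *: v (tile_i a) + m *: v (tile_j a))]].

Definition tile_vertex (R : realType) (n : nat) (v : 'I_n -> 'rV[R]_2)
    (a : tile R n) : set 'rV[R]_2 :=
  [set z | exists b c : bool,
     z = tile_pos a + (b%:R *: v (tile_i a) + c%:R *: v (tile_j a))].

Definition segment (R : realType) (n : nat) (v : 'I_n -> 'rV[R]_2)
    (y : 'rV[R]_2) (k : 'I_n) : set 'rV[R]_2 :=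
  [set z | exists l : R, 0 <= l <= 1 /\ z = y + l *: v k].

(* [tile_edge v a y k]: the segment from y to y + v_k is an edge of a.         *)
Definition tile_edge (R : realType) (n : nat) (v : 'I_n -> 'rV[R]_2)
    (a : tile R n) (y : 'rV[R]_2) (k : 'I_n) : Prop :=
  let: Tile i j x := a in
  (k = i /\ (y = x \/ y = x + v j)) \/ (k = j /\ (y = x \/ y = x + v i)).

Record rhombus_tiling (R : realType) (n : nat) (v : 'I_n -> 'rV[R]_2)
    (T : set (tile R n)) : Prop := RhombusTiling {
  tiling_index : forall a, T a -> (tile_i a < tile_j a)%N;
  tiling_cover : \bigcup_(a in T) tile_supp v a = setT;
  tiling_disjoint : forall a b, T a -> T b -> a <> b ->
    interior (tile_supp v a) `&` interior (tile_supp v b) = set0;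
  tiling_edge_to_edge : forall a b, T a -> T b -> a <> b ->
    tile_supp v a `&` tile_supp v b !=set0 ->
    (exists p, [/\ tile_vertex v a p, tile_vertex v b p &
       tile_supp v a `&` tile_supp v b = [set p]]) \/
    (exists y k, [/\ tile_edge v a y k, tile_edge v b y k &
       tile_supp v a `&` tile_supp v b = segment v y k]) }.

Definition basis_vec (R : realType) (n : nat) (k : 'I_n) : 'rV[R]_n :=
  delta_mx 0 k.

(* A lift is given by its values on the vertices of T; the values of f at the  *)
(* other points of the plane are irrelevant. Some vertex goes to the origin    *)
(* and an edge directed by v_k goes to an edge directed by e_k, so that        *)
(* vertices go to Z^n and each tile goes to a face of a unit hypercube.        *)
Definition is_lift (R : realType) (n : nat) (v : 'I_n -> 'rV[R]_2)
    (T : set (tile R n)) (f : 'rV[R]_2 -> 'rV[R]_n) : Prop :=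
  (exists a y, [/\ T a, tile_vertex v a y & f y = 0]) /\
  (forall a y k, T a -> tile_edge v a y k ->
     f (y + v k) = f y + basis_vec R k).

Definition stepped_surface (R : realType) (n : nat) (T : set (tile R n))
    (f : 'rV[R]_2 -> 'rV[R]_n) : set 'rV[R]_n :=
  [set z | exists a, T a /\ exists l m : R, [/\ 0 <= l <= 1, 0 <= m <= 1 &
     z = f (tile_pos a) + (l *: basis_vec R (tile_i a) +
                           m *: basis_vec R (tile_j a))]].

(* The affine plane through c with direction D.                                *)
Definition affine_plane (R : realType) (n : nat) (c : 'rV[R]_n)
    (D : {vspace 'rV[R]_n}) : set 'rV[R]_n :=
  [set z | exists2 u, u \in D & z = c + u].

Definition cube (R : realType) (n : nat) (t : R) : set 'rV[R]_n :=
  [set b | forall k, 0 <= b 0 k <= t].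

(* T can be lifted into E + [0,t]^n for some affine plane E of direction D.    *)
Definition lifts_into (R : realType) (n : nat) (v : 'I_n -> 'rV[R]_2)
    (T : set (tile R n)) (D : {vspace 'rV[R]_n}) (t : R) : Prop :=
  \dim D = 2%N /\
  exists f c, is_lift v T f /\
    stepped_surface T f `<=`
      [set z | exists x b, [/\ affine_plane c D x, cube t b & z = x + b]].

Definition planar (R : realType) (n : nat) (v : 'I_n -> 'rV[R]_2)
    (T : set (tile R n)) : Prop :=
  exists t D, 1 <= t /\ lifts_into v T D t.

Definition is_thickness (R : realType) (n : nat) (v : 'I_n -> 'rV[R]_2)
    (T : set (tile R n)) (t : R) : Prop :=
  [/\ 1 <= t, exists D, lifts_into v T D t &
      forall t' D, 1 <= t' -> lifts_into v T D t' -> t <= t'].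

(* Slopes are compared up to translation (a lift is defined up to the choice   *)
(* of the initial vertex, and Grassmann coordinates only see the direction),   *)
(* so a slope is represented by its direction.                                 *)
Definition is_slope (R : realType) (n : nat) (v : 'I_n -> 'rV[R]_2)
    (T : set (tile R n)) (D : {vspace 'rV[R]_n}) : Prop :=
  exists t, is_thickness v T t /\ lifts_into v T D t.

Definition strongly_planar (R : realType) (n : nat) (v : 'I_n -> 'rV[R]_2)
    (T : set (tile R n)) : Prop :=
  is_thickness v T 1.

(* Orthogonal projection onto <e_i, e_j, e_k>, in the coordinates given by     *)
(* this basis.                                                                 *)
Definition proj3 (R : realType) (n : nat) (i j k : 'I_n) (x : 'rV[R]_n) :
    'rV[R]_3 :=
  colsub (tnth [tuple i; j; k]) x.

Definition is_shadow (R : realType) (n : nat) (v : 'I_n -> 'rV[R]_2)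
    (T : set (tile R n)) (i j k : 'I_n) (S : set 'rV[R]_3) : Prop :=
  exists f, is_lift v T f /\ S = proj3 i j k @` stepped_surface T f.

(* Periods are those of the shadow as a stepped surface, so they are integer   *)
(* vectors. Integrality matters only when the shadow is flat in some direction *)
(* (e.g. if T consists of copies of a single prototile): as a mere set of      *)
(* points it would then be invariant under arbitrarily small translations.     *)
Definition is_period (R : realType) (S : set 'rV[R]_3) (d : 'rV[int]_3) :
    Prop :=
  d != 0 /\ [set x + map_mx intr d | x in S] = S.

Definition prime_period (R : realType) (S : set 'rV[R]_3) (d : 'rV[int]_3) :
    Prop :=
  is_period S d /\
  ~ exists (m : int) (d' : 'rV[int]_3),
      [/\ 1 < `|m|, is_period S d' & d = m *: d'].

Definition subperiods (R : realType) (n : nat) (v : 'I_n -> 'rV[R]_2)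
    (T : set (tile R n)) (i j k : 'I_n) : set 'rV[int]_3 :=
  [set d | exists S, is_shadow v T i j k S /\ prime_period S d].

(* Only the entries G i j with i < j are meaningful.                           *)
Definition plucker (R : realType) (n : nat) (G : 'M[R]_n) : Prop :=
  forall i j k l : 'I_n, (i < j)%N -> (j < k)%N -> (k < l)%N ->
    G i j * G k l = G i k * G j l - G i l * G j k.

Definition subperiod_relation (R : realType) (n : nat) (G : 'M[R]_n)
    (i j k : 'I_n) (d : 'rV[int]_3) : Prop :=
  (d 0 0)%:~R * G j k - (d 0 1)%:~R * G i k + (d 0 2)%:~R * G i j = 0.

Definition slope_system (R : realType) (n : nat)
    (P : 'I_n -> 'I_n -> 'I_n -> set 'rV[int]_3) (G : 'M[R]_n) : Prop :=
  [/\ exists i j : 'I_n, (i < j)%N /\ G i j != 0,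
      plucker G &
      forall (i j k : 'I_n) d, (i < j)%N -> (j < k)%N -> P i j k d ->
        subperiod_relation G i j k d].

(* The solutions lie on finitely many lines, spanned by the elements of s.     *)
Definition characterize_finitely_many_slopes (R : realType) (n : nat)
    (P : 'I_n -> 'I_n -> 'I_n -> set 'rV[int]_3) : Prop :=
  exists s : seq 'M[R]_n, forall G : 'M[R]_n, slope_system P G ->
    exists G' (c : R), [/\ G' \in s, c != 0 &
      forall i j : 'I_n, (i < j)%N -> G i j = c * G' i j].

Definition translate (R : realType) (n : nat) (d : 'rV[R]_2) (a : tile R n) :
    tile R n :=
  Tile (tile_i a) (tile_j a) (tile_pos a + d).

Definition disk_pattern (R : realType) (n : nat) (v : 'I_n -> 'rV[R]_2)
    (T : set (tile R n)) (c : 'rV[R]_2) (r : R) : set (tile R n) :=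
  [set a | T a /\ tile_supp v a `&` edisk c r !=set0].

(* Patterns being considered up to translation, the atlas consists of all the  *)
(* translates of the patterns that occur in T.                                 *)
Definition atlas (R : realType) (n : nat) (v : 'I_n -> 'rV[R]_2)
    (T : set (tile R n)) (r : R) : set (set (tile R n)) :=
  [set P | exists c d, P = translate d @` disk_pattern v T c r].

Definition local_rules (R : realType) (n : nat) (v : 'I_n -> 'rV[R]_2)
    (T : set (tile R n)) (D : {vspace 'rV[R]_n}) (r t : R) : Prop :=
  forall U : set (tile R n), rhombus_tiling v U ->
    atlas v U r `<=` atlas v T r ->
    is_slope v U D /\ exists2 t', is_thickness v U t' & t' <= t.

Definition slope_admits_local_rules (R : realType) (n : nat)
    (v : 'I_n -> 'rV[R]_2) (D : {vspace 'rV[R]_n}) : Prop :=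
  exists T : set (tile R n),
    [/\ rhombus_tiling v T, strongly_planar v T, is_slope v T D &
        exists r t : R, 0 < r /\ local_rules v T D r t].

(* Main.v *)
Require Import Defs.
From HB Require Import structures.
From mathcomp Require Import all_boot all_order all_algebra.
From mathcomp Require Import all_classical all_reals all_analysis.
From mathcomp Require Import ring lra zify.

Set Implicit Arguments.
Unset Strict Implicit.
Unset Printing Implicit Defensive.

Import Order.TTheory GRing.Theory Num.Theory.
Import numFieldNormedType.Exports.

Local Open Scope classical_set_scope.
Local Open Scope ring_scope.

(** A planar tiling T of slope E has its lift at bounded distance from a linear map
    x |-> x L whose image is E ([planar_linear]). The local rules are those of a
    strongly planar tiling of slope E, obtained by the cut and project method
    ([cut_tiling]): the grid lines, on which one of the coordinates of x L + c is an
    integer, cross pairwise at the points dual to the tiles. This is a rhombus tiling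
    as soon as c is generic ([exists_generic]) and the Grassmann coordinates G_ij of E
    have the signs of the determinants of (v_i, v_j). The latter holds because E is
    already the slope of a tiling: following a strip of tiles that share the edge v_i
    makes each coordinate j of the lift move in the direction prescribed by the sign of
    det (v_i, v_j) ([grass_ge0]).

    Let U be a tiling all of whose large patterns occur in the cut tiling. The local
    lifts of U agree where they overlap, so they glue into a lift f of U, which moves
    almost linearly at the scale of the patterns; moreover every short displacement
    that is available at all vertices of the cut tiling is available at all vertices of
    U ([transfer]). It remains to bound the deviation f - y L on U uniformly, since this
    makes U planar of slope E with bounded thickness ([thickness_attained]).

    A subperiod d_l that omits the coordinate l gives a relation satisfied by E
    ([subperiod_grass]), which says that some vector d_l + a_l e_l lies in E, unless e_l
    does. If the
    system of all relations of E with the Pluecker relations has finitely many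
    solutions, then there are two cases ([slope_dichotomy]).

    Either E contains two independent integer vectors. They are displacements of the
    cut tiling, hence of U, so f - y L is periodic, and thus bounded
    ([bounded_rational]).

    Or E is irrational. The solutions of the linear relations then form a plane of
    alternating forms, spanned by the forms G and G' of exactly two planes E and E'
    ([second_solution], [solution_span]), which satisfy the same rational equations
    ([ev_conjugate]). As a consequence each l has exactly one relation d_l up to a factor, and no
    Grassmann coordinate vanishes. Let X_l and Y_l be the linear forms on R^4 that vanish
    on e_l, d_l and respectively on E and on E'. The cut tiling has displacements
    N (d_l + a_l e_l) + tau e_l with |tau| <= 1: their length is known only up to an error
    along e_l, but neither X_l nor Y_l sees it. By walking along these displacements in U
    one finds that X_l o f is, up to bounded errors, a function of Y_l o f
    ([form_coarse]). The linear relations between X_0, ..., X_3 and between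
    Y_0, ..., Y_3 turn this into a system of approximate Pexider equations, whose
    solutions are quasi-additive functions F with F(s) = k' F(k s) up to a bounded error.
    These are bounded unless k k' = 1 ([quasi_scaling_bounded]), and k k' = 1 is excluded
    because it would yield a third independent solution of the relations
    ([ratio_neq1]). So the X_l o f are bounded, and they control f - y L
    ([bounded_irrational]). *)

(** * Plane geometry *)

Section Plane.
Variable R : realType.
Implicit Types x y z a b : 'rV[R]_2.

Lemma ord2P (k : 'I_2) : k = 0 \/ k = 1.
Proof. by case: k => -[|[|//]] hk; [left|right]; apply/val_inj. Qed.

Lemma row2P x y : x 0 0 = y 0 0 -> x 0 1 = y 0 1 -> x = y.
Proof. by move=> h0 h1; apply/rowP => k; case: (ord2P k) => ->. Qed.

Lemma mxnormP m n (x : 'M[R]_(m.+1, n.+1)) e :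
  (forall i j, `|x i j| <= e) -> `|x| <= e.
Proof.
move=> h; have e0 : 0 <= e by exact: le_trans (h ord0 ord0).
rewrite [`|x|]mx_normrE; apply: bigmax_le => // -[i j] _; exact: h.
Qed.

Lemma mxnormP_lt m n (x : 'M[R]_(m.+1, n.+1)) e :
  (forall i j, `|x i j| < e) -> `|x| < e.
Proof.
move=> h; have e0 : 0 < e by exact: le_lt_trans (h ord0 ord0).
rewrite [`|x|]mx_normrE; apply: bigmax_lt => // -[i j] _; exact: h.
Qed.

Lemma mxnorm_coord m n (x : 'M[R]_(m.+1, n.+1)) i j : `|x i j| <= `|x|.
Proof.
by rewrite [`|x|]mx_normrE; apply: (le_bigmax _ (fun ij => `|x ij.1 ij.2|) (i, j)).
Qed.

Lemma mulmx_norm m n p : forall (M : 'M[R]_(m.+1, n.+1)),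
  exists2 C, 0 <= C & forall x : 'M[R]_(p.+1, m.+1), `|x *m M| <= C * `|x|.
Proof.
move=> M; exists (\sum_j \sum_k `|M k j|).
  by apply: sumr_ge0 => j _; apply: sumr_ge0 => k _.
move=> x; apply: mxnormP => i j; rewrite !mxE.
apply: (le_trans (ler_norm_sum _ _ _)).
rewrite [X in _ <= X * _](bigD1 j) //= mulrDl -[X in X <= _]addr0.
apply: lerD.
  rewrite mulr_suml; apply: ler_sum => k _.
  by rewrite normrM mulrC ler_wpM2l // mxnorm_coord.
rewrite mulr_ge0 //; apply: sumr_ge0 => j' _; exact: sumr_ge0.
Qed.

Definition cross x y : R := x 0 0 * y 0 1 - x 0 1 * y 0 0.

Lemma crossDl x y z : cross (x + y) z = cross x z + cross y z.
Proof. rewrite /cross !mxE; ring. Qed.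
Lemma crossDr x y z : cross z (x + y) = cross z x + cross z y.
Proof. rewrite /cross !mxE; ring. Qed.
Lemma crossZl k x z : cross (k *: x) z = k * cross x z.
Proof. rewrite /cross !mxE; ring. Qed.
Lemma crossZr k x z : cross z (k *: x) = k * cross z x.
Proof. rewrite /cross !mxE; ring. Qed.
Lemma crossNl x z : cross (- x) z = - cross x z.
Proof. rewrite /cross !mxE; ring. Qed.
Lemma crossNr x z : cross z (- x) = - cross z x.
Proof. rewrite /cross !mxE; ring. Qed.
Lemma crossxx x : cross x x = 0.
Proof. rewrite /cross; ring. Qed.
Lemma crossC x y : cross y x = - cross x y.
Proof. rewrite /cross; ring. Qed.
Lemma cross_sumr (I : finType) (F : I -> 'rV[R]_2) x :
  cross x (\sum_i F i) = \sum_i cross x (F i).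
Proof.
elim/big_rec2: _ => [|i u w _ <-]; last by rewrite crossDr.
by rewrite /cross !mxE; ring.
Qed.
Definition crossE := (crossDl, crossDr, crossZl, crossZr, crossNl, crossNr, crossxx).

Lemma cross_decomp a b z : cross a b != 0 ->
  z = (cross z b / cross a b) *: a + (cross a z / cross a b) *: b.
Proof.
move=> h; apply: row2P; rewrite !mxE; move: h; rewrite /cross => h; by field.
Qed.

Lemma free_cross a b : free [:: a; b] -> cross a b != 0.
Proof.
move=> /freeP h; apply/eqP => c0.
have key (p q : R) : p *: a + q *: b = 0 -> p = 0 /\ q = 0.
  move=> e; have := h (fun k : 'I_2 => if k == 0 then p else q).
  rewrite big_ord_recl big_ord1 /= => /(_ e) hh.
  by split; [have := hh ord0| have := hh 1]; rewrite ?eqxx.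
have [h1 h2] : b 0 1 = 0 /\ - a 0 1 = 0.
  by apply: key; apply: row2P; rewrite !mxE; move: c0; rewrite /cross => c0; lra.
have [h3 h4] : b 0 0 = 0 /\ - a 0 0 = 0.
  by apply: key; apply: row2P; rewrite !mxE; move: c0; rewrite /cross => c0; lra.
have [/eqP] : (1 : R) = 0 /\ (0 : R) = 0; last by rewrite oner_eq0.
by apply: key; apply: row2P; rewrite !mxE; lra.
Qed.

End Plane.

(** Connectedness of the unit interval, in the form that is used to follow the tiles
    along a segment. *)
Lemma locally_constant01 (R : realType) (P : R -> Prop) :
  (forall t, 0 <= t <= 1 -> exists2 d, 0 < d &
     forall s, 0 <= s <= 1 -> `|s - t| < d -> P t <-> P s) -> P 0 -> P 1.
Proof.
move=> loc P0.
pose S := [set t | 0 <= t <= 1 /\ forall s, 0 <= s <= t -> P s].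
have S0 : S 0.
  split; first by rewrite lexx ler01.
  by move=> s /andP[s0 s1]; rewrite (_ : s = 0) //; apply/eqP; rewrite eq_le s0 s1.
have hS : has_sup S by split; [exists 0 | exists 1 => t [/andP[]]].
have m0 : 0 <= sup S by apply: ub_le_sup => //; case: hS.
have m1 : sup S <= 1 by apply: ge_sup => [|t [/andP[]]//]; exists 0.
have [d d0 hd] := loc (sup S) (introT andP (conj m0 m1)).
have [t [/andP[t0 t1] ht] tm] := sup_adherent d0 hS.
have tle : t <= sup S by apply: ub_le_sup; [case: hS|split => //; rewrite t0 t1].
have Pm : P (sup S).
  apply/(hd t); rewrite ?t0 ?t1 //; last by apply: ht; rewrite t0 lexx.
  by rewrite ltr_norml; apply/andP; split; lra.
have [m1' | m1'] := leP 1 (sup S).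
  by rewrite (_ : 1 = sup S) //; apply/eqP; rewrite eq_le m1 m1'.
pose u := Num.min 1 (sup S + d / 2).
have um : sup S < u by rewrite lt_min m1' ltrDl divr_gt0.
have ud : u <= sup S + d / 2 by rewrite ge_min lexx orbT.
have u1 : u <= 1 by rewrite ge_min lexx.
suff : S u by move=> /(ub_le_sup hS.2); rewrite leNgt um.
split; first by rewrite u1 andbT; apply: le_trans m0 (ltW um).
move=> s /andP[s0 su]; have [st|ts] := leP s t; first by apply: ht; rewrite s0 st.
apply/(hd s) => //; first by rewrite s0 (le_trans su).
rewrite ltr_norml; apply/andP; split; lra.
Qed.

(** * Tiles and vertices *)
Section Tiles.
Variables (R : realType) (n : nat) (v : 'I_n -> 'rV[R]_2).
Hypothesis vcross : forall i j, i != j -> cross (v i) (v j) != 0.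
Implicit Types (a b : tile R n) (p q z y : 'rV[R]_2) (T : set (tile R n)).

Definition tile_det a := cross (v (tile_i a)) (v (tile_j a)).
(** By Cramer's rule, z = tile_pos a + tile_l a z *: v (tile_i a) + tile_m a z *: v (tile_j a). *)
Definition tile_l a z := cross (z - tile_pos a) (v (tile_j a)) / tile_det a.
Definition tile_m a z := cross (v (tile_i a)) (z - tile_pos a) / tile_det a.

Lemma tile_suppP a z : tile_det a != 0 ->
  tile_supp v a z <-> (0 <= tile_l a z <= 1) /\ (0 <= tile_m a z <= 1).
Proof.
move=> h; split=> [[l [m [hl hm ->]]]|[hl hm]].
  rewrite /tile_l /tile_m [tile_pos a + _]addrC addrK !crossE !mulr0 ?addr0 ?add0r.
  by rewrite !mulfK.
exists (tile_l a z), (tile_m a z); split => //.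
by rewrite -(cross_decomp (z - tile_pos a) h) addrC subrK.
Qed.

Lemma tile_det_neq0 T a : rhombus_tiling v T -> T a -> tile_det a != 0.
Proof.
move=> hT Ta; apply: vcross; apply/negP => /eqP e.
by have := tiling_index hT Ta; rewrite e ltnn.
Qed.

Lemma tile_neq T a : rhombus_tiling v T -> T a -> tile_i a != tile_j a.
Proof.
by move=> hT Ta; apply/eqP => e; have := tiling_index hT Ta; rewrite e ltnn.
Qed.

Lemma cross_continuous (f g : 'rV[R]_2 -> 'rV[R]_2) :
  continuous f -> continuous g -> continuous (fun z => cross (f z) (g z)).
Proof.
move=> cf cg z.
have co (h : 'rV[R]_2 -> 'rV[R]_2) k : continuous h -> continuous (fun z => h z 0 k).
  move=> ch z'; apply: (@continuous_comp _ _ _ h (fun M : 'rV[R]_2 => M 0 k)); [exact: ch|exact: coord_continuous].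
have M (h k : 'rV[R]_2 -> R) : continuous h -> continuous k ->
    continuous (fun z => h z * k z) by move=> ch ck z'; apply: (@continuousM R _ h k z' (ch z') (ck z')).
apply: (@continuousB _ _ _ (fun z => f z 0 0 * g z 0 1) (fun z => f z 0 1 * g z 0 0)).
  by apply: (M (fun z => f z 0 0) (fun z => g z 0 1)); exact: co.
by apply: (M (fun z => f z 0 1) (fun z => g z 0 0)); exact: co.
Qed.

Lemma tile_l_continuous a : continuous (tile_l a).
Proof.
move=> z; apply: (@continuousM R _ (fun z => cross (z - tile_pos a) (v (tile_j a)))
  (fun _ => (tile_det a)^-1)); last exact: cst_continuous.
apply: cross_continuous => y; last exact: cst_continuous.
by apply: (@continuousB _ _ _ (fun z : 'rV[R]_2 => z) (fun _ => tile_pos a)) => //;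
  exact: cst_continuous.
Qed.

Lemma tile_m_continuous a : continuous (tile_m a).
Proof.
move=> z; apply: (@continuousM R _ (fun z => cross (v (tile_i a)) (z - tile_pos a))
  (fun _ => (tile_det a)^-1)); last exact: cst_continuous.
apply: cross_continuous => y; first exact: cst_continuous.
by apply: (@continuousB _ _ _ (fun z : 'rV[R]_2 => z) (fun _ => tile_pos a)) => //;
  exact: cst_continuous.
Qed.

Lemma tile_supp_closed a : tile_det a != 0 -> closed (tile_supp v a).
Proof.
move=> h.
have -> : tile_supp v a = tile_l a @^-1` `[0, 1]%classic `&` tile_m a @^-1` `[0, 1]%classic.
  apply/seteqP; split => z; rewrite tile_suppP //=; rewrite !in_itv /=; tauto.
apply: closedI.
  apply: (proj1 (continuous_closedP (tile_l a)) (@tile_l_continuous a)).  exact: interval_closed.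
apply: (proj1 (continuous_closedP (tile_m a)) (@tile_m_continuous a)); exact: interval_closed.
Qed.

Lemma tile_interior a z : tile_det a != 0 ->
  0 < tile_l a z < 1 -> 0 < tile_m a z < 1 -> interior (tile_supp v a) z.
Proof.
move=> h hl hm.
have o : open (tile_l a @^-1` `]0, 1[%classic `&` tile_m a @^-1` `]0, 1[%classic).
  apply: openI.
    by apply: open_comp => [y _|]; [exact: tile_l_continuous|exact: interval_open].
  by apply: open_comp => [y _|]; [exact: tile_m_continuous|exact: interval_open].
have : nbhs z (tile_l a @^-1` `]0, 1[%classic `&` tile_m a @^-1` `]0, 1[%classic).
  by apply: open_nbhs_nbhs; split => //; rewrite /= !in_itv.
apply: filterS => y [] /=; rewrite !in_itv /= => /andP[? ?] /andP[? ?].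
by apply/tile_suppP => //; split; apply/andP; split; apply: ltW.
Qed.

Definition vsum : R := \sum_i `|v i|.

Lemma le_vsum i : `|v i| <= vsum.
Proof.
by rewrite /vsum (bigD1 i) //= lerDl sumr_ge0.
Qed.

Lemma vsum_ge0 : 0 <= vsum. Proof. exact: sumr_ge0. Qed.

Lemma cross_norm (x y : 'rV[R]_2) : `|cross x y| <= 2 * `|x| * `|y|.
Proof.
rewrite /cross; apply: (le_trans (ler_normB _ _)); rewrite !normrM.
have -> : 2 * `|x| * `|y| = `|x| * `|y| + `|x| * `|y| by ring.
by apply: lerD; apply: ler_pM => //; exact: mxnorm_coord.
Qed.

(** Below this scale two tiles of the same type overlap, whence the local finiteness
    of tilings. *)
Lemma tile_scale : exists2 e : R, 0 < e & forall i j (x : 'rV[R]_2),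
  i != j -> `|x| < e ->
  `|cross x (v j) / cross (v i) (v j)| < 2^-1 /\ `|cross (v i) x / cross (v i) (v j)| < 2^-1.
Proof.
pose K := 1 + \sum_i \sum_j (4 * vsum / `|cross (v i) (v j)|).
have K0 : 0 < K.
  rewrite /K ltr_wpDr // sumr_ge0 // => i _; rewrite sumr_ge0 // => j _.
  by rewrite mulr_ge0 // ?invr_ge0 // mulr_ge0 // vsum_ge0.
have KE i j : 4 * vsum / `|cross (v i) (v j)| < K.
  rewrite /K (bigD1 i) //= (bigD1 j) //=.
  set s1 := \sum_(_ | _) _; set s2 := \sum_(_ | _) _.
  have : 0 <= s1.
    rewrite sumr_ge0 // => k _.
    by rewrite mulr_ge0 // ?invr_ge0 // mulr_ge0 // vsum_ge0.
  have : 0 <= s2.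
    rewrite sumr_ge0 // => k _; rewrite sumr_ge0 // => l _.
    by rewrite mulr_ge0 // ?invr_ge0 // mulr_ge0 // vsum_ge0.
  lra.
exists K^-1; first by rewrite invr_gt0.
move=> i j x ij hx.
have c0 : 0 < `|cross (v i) (v j)| by rewrite normr_gt0 vcross.
have main (k : 'I_n) (w : R) : `|w| <= 2 * `|x| * `|v k| ->
    `|w / cross (v i) (v j)| < 2^-1.
  move=> hw; rewrite normrM normfV ltr_pdivrMr //.
  apply: (le_lt_trans hw).
  have h1 : `|x| * K < 1 by rewrite -ltr_pdivlMr // mul1r.
  have := KE i j; rewrite ltr_pdivrMr // => h2.
  have := le_vsum k; have := normr_ge0 (v k); have := normr_ge0 x; have := vsum_ge0.
  nra.
split; first exact: main (cross_norm _ _).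
apply: (main i); rewrite (le_trans (cross_norm _ _)) //.
by rewrite -!mulrA [X in 2 * X]mulrC.
Qed.

Lemma tile_close_eq T e : rhombus_tiling v T ->
  (forall i j (x : 'rV[R]_2), i != j -> `|x| < e ->
   `|cross x (v j) / cross (v i) (v j)| < 2^-1 /\
   `|cross (v i) x / cross (v i) (v j)| < 2^-1) ->
  forall a b, T a -> T b -> tile_i a = tile_i b -> tile_j a = tile_j b ->
    `|tile_pos a - tile_pos b| < e -> a = b.
Proof.
move=> hT he a b Ta Tb ei ej hab; apply/not_notP => nab.
have da := tile_det_neq0 hT Ta; have db := tile_det_neq0 hT Tb.
have := tiling_disjoint hT Ta Tb nab => /seteqP[] + _.
pose z := tile_pos b + (2^-1 *: v (tile_i b) + 2^-1 *: v (tile_j b)).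
move=> /(_ z); apply; split.
  have [] := he _ _ _ (tile_neq hT Ta) hab.
  rewrite !ltr_norml => /andP[h1 h2] /andP[h3 h4].
  apply: tile_interior => //; rewrite /tile_l /tile_m /tile_det.
    have -> : cross (z - tile_pos a) (v (tile_j a)) =
      2^-1 * cross (v (tile_i a)) (v (tile_j a)) -
      cross (tile_pos a - tile_pos b) (v (tile_j a)).
      by rewrite /z -ei -ej !crossE; ring.
    by rewrite mulrBl mulfK //; apply/andP; split; lra.
  have -> : cross (v (tile_i a)) (z - tile_pos a) =
      2^-1 * cross (v (tile_i a)) (v (tile_j a)) -
      cross (v (tile_i a)) (tile_pos a - tile_pos b).
    by rewrite /z -ei -ej !crossE; ring.
  by rewrite mulrBl mulfK //; apply/andP; split; lra.
apply: tile_interior => //; rewrite /tile_l /tile_m /z [tile_pos b + _]addrC addrK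
  !crossE !mulr0 ?addr0 ?add0r mulfK //; lra.
Qed.

Lemma tile_pos_near T a z : rhombus_tiling v T -> T a -> tile_supp v a z ->
  `|z - tile_pos a| <= 2 * vsum.
Proof.
move=> hT Ta [l [m [/andP[l0 l1] /andP[m0 m1] ->]]].
rewrite [tile_pos a + _]addrC addrK (le_trans (ler_normD _ _)) // !normrZ.
rewrite !ger0_norm // mulrDl mul1r.
by apply: lerD; rewrite -[vsum]mul1r ler_pM // le_vsum.
Qed.

Lemma truncn_close (x y e : R) : 0 < e -> 0 <= x -> 0 <= y ->
  Num.truncn (x / e) = Num.truncn (y / e) -> `|x - y| < e.
Proof.
move=> e0 x0 y0 h.
have /truncn_itv : 0 <= x / e by rewrite divr_ge0 // ltW.
have /truncn_itv : 0 <= y / e by rewrite divr_ge0 // ltW.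
rewrite h !ler_pdivlMr // !ltr_pdivrMr // -addn1 natrD => /andP[? ?] /andP[? ?].
by rewrite ltr_norml; apply/andP; split; lra.
Qed.

(** The tiles near p have finitely many types, and two close tiles of the same type
    coincide; as tiles are closed, those that avoid p stay away from it. *)
Lemma tile_local_finite T p : rhombus_tiling v T ->
  exists2 d, 0 < d & forall a z, T a -> tile_supp v a z -> `|z - p| < d ->
    tile_supp v a p.
Proof.
move=> hT; have [e e0 he] := tile_scale.
pose M := 1 + 2 * vsum.
pose x a k := (tile_pos a - p) 0 k + M.
pose near a := exists2 z, tile_supp v a z & `|z - p| < 1.
have xM a k : T a -> near a -> 0 <= x a k <= 2 * M.
  move=> Ta [z az zp]; have h : `|(tile_pos a - p) 0 k| <= M.
    rewrite (le_trans (mxnorm_coord _ _ _)) //.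
    have -> : tile_pos a - p = (z - p) - (z - tile_pos a).
      by apply/rowP => ?; rewrite !mxE; ring.
    rewrite (le_trans (ler_normB _ _)) // lerD ?(ltW zp) //.
    exact: tile_pos_near hT Ta az.
  by move: h; rewrite ler_norml /x => /andP[? ?]; apply/andP; split; lra.
pose code a := (tile_i a, tile_j a, Num.truncn (x a 0 / e), Num.truncn (x a 1 / e)).
have code_inj a b : T a -> T b -> near a -> near b -> code a = code b -> a = b.
  move=> Ta Tb na nb [ei ej h0 h1].
  apply: (tile_close_eq hT he Ta Tb ei ej).
  have hk k : `|(tile_pos a - tile_pos b) 0 k| < e.
    have -> : (tile_pos a - tile_pos b) 0 k = x a k - x b k by rewrite /x !mxE; ring.
    have /andP[xa _] := xM a k Ta na; have /andP[xb _] := xM b k Tb nb.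
    by apply: truncn_close => //; case: (ord2P k) => ->.
  by apply: mxnormP_lt => i k; rewrite ord1.
pose N := (Num.truncn (2 * M / e)).+1.
pose C : set ('I_n * 'I_n * nat * nat) := ([set: 'I_n] `*` [set: 'I_n] `*` `I_N `*` `I_N).
have Cfin : finite_set C.
  by do !apply: finite_setX; rewrite ?finite_finset //; exact: finite_II.
pose S c : set 'rV[R]_2 := [set z | exists a, [/\ T a, near a, code a = c,
   ~ tile_supp v a p & tile_supp v a z]].
have Scl c : C c -> closed (S c).
  move=> _; have [[a [Ta na ca pa]]|h] :=
    EM (exists a, [/\ T a, near a, code a = c & ~ tile_supp v a p]).
    rewrite (_ : S c = tile_supp v a).
      by apply: tile_supp_closed; exact: tile_det_neq0 Ta.
    apply/seteqP; split => z; last by move=> za; exists a.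
    move=> [b [Tb nb cb pb bz]]; rewrite (code_inj a b) //; by rewrite ca cb.
  rewrite (_ : S c = set0); first exact: closed0.
  apply/seteqP; split => z // [a [Ta na ca pa za]]; apply: h; by exists a.
have oU : open (~` (\bigcup_(c in C) S c)).
  by apply: closed_openC; exact: closed_bigcup.
have : nbhs p (~` (\bigcup_(c in C) S c)).
  by apply: open_nbhs_nbhs; split => // -[c _ [a [_ _ _ h]]]; apply: h.
rewrite -nbhs_nbhs_norm => -[d /= d0 hd].
exists (Num.min d 1); first by rewrite lt_min d0 ltr01.
move=> a z Ta az; rewrite lt_min => /andP[zd z1]; apply/not_notP => ap.
have na : near a by exists z.
have := hd z; rewrite /ball_ /= distrC => /(_ zd); apply.
exists (code a); last by exists a.
have ok k : (Num.truncn (x a k / e) < N)%N.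
  rewrite ltnS; apply: le_truncn; rewrite ler_pM2r ?invr_gt0 //.
  by have /andP[] := xM a k Ta na.
by split; [split; [split|]|]; rewrite //=; exact: ok.
Qed.

Lemma tile_vertex_edge a y k : tile_edge v a y k ->
  tile_vertex v a y /\ tile_vertex v a (y + v k).
Proof.
case: a => i j x /= [[-> [->|->]]|[-> [->|->]]]; split.
- by exists false, false; rewrite /= !scale0r !addr0.
- by exists true, false; rewrite /= scale1r scale0r addr0.
- by exists false, true; rewrite /= scale1r scale0r add0r.
- by exists true, true; rewrite /= !scale1r -addrA [v j + _]addrC.
- by exists false, false; rewrite /= !scale0r !addr0.
- by exists false, true; rewrite /= scale1r scale0r add0r.
- by exists true, false; rewrite /= scale1r scale0r addr0.
- by exists true, true; rewrite /= !scale1r -addrA.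
Qed.

Lemma tile_vertex_supp a y : tile_vertex v a y -> tile_supp v a y.
Proof.
move=> [b [c ->]]; exists b%:R, c%:R; split => //.
  by case: b; rewrite /= ?lexx ?ler01.
by case: c; rewrite /= ?lexx ?ler01.
Qed.

Lemma tile_pos_vertex a : tile_vertex v a (tile_pos a).
Proof. by exists false, false; rewrite !scale0r !addr0. Qed.

Lemma tile_lE a l m : tile_det a != 0 ->
  tile_l a (tile_pos a + (l *: v (tile_i a) + m *: v (tile_j a))) = l.
Proof.
move=> h; rewrite /tile_l [tile_pos a + _]addrC addrK !crossE mulr0 addr0.
by rewrite mulfK.
Qed.

Lemma tile_mE a l m : tile_det a != 0 ->
  tile_m a (tile_pos a + (l *: v (tile_i a) + m *: v (tile_j a))) = m.
Proof.
move=> h; rewrite /tile_m [tile_pos a + _]addrC addrK !crossE mulr0 add0r.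
by rewrite mulfK.
Qed.

Lemma vertex_on_edge a y k q : tile_det a != 0 ->
  tile_edge v a y k -> tile_vertex v a q -> segment v y k q ->
  q = y \/ q = y + v k.
Proof.
move=> h he [b [c eq]] [l [_ el]].
have e : tile_pos a + (b%:R *: v (tile_i a) + c%:R *: v (tile_j a)) = y + l *: v k
  by rewrite -eq.
have eL := congr1 (tile_l a) e; have eM := congr1 (tile_m a) e.
rewrite tile_lE // in eL; rewrite tile_mE // in eM.
rewrite el; case: a h he eq e eL eM => i j x h /=.
have lx := @tile_lE (Tile i j x) _ _ h; have mx := @tile_mE (Tile i j x) _ _ h.
rewrite /= in lx mx.
have bl : forall (B : bool) w, B%:R = l -> y + l *: w = y \/ y + l *: w = y + w.
  by move=> [] w <-; [right; rewrite scale1r|left; rewrite scale0r addr0].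
case=> [[-> [yE|yE]]|[-> [yE|yE]]] eq e eL eM.
- apply: (bl b); rewrite eL yE.
  by rewrite (_ : x + _ = x + (l *: v i + 0 *: v j)) ?lx // scale0r addr0.
- apply: (bl b); rewrite eL yE.
  rewrite (_ : x + v j + _ = x + (l *: v i + 1 *: v j)) ?lx //.
  by rewrite scale1r -addrA [v j + _]addrC.
- apply: (bl c); rewrite eM yE.
  by rewrite (_ : x + _ = x + (0 *: v i + l *: v j)) ?mx // scale0r add0r.
- apply: (bl c); rewrite eM yE.
  rewrite (_ : x + v i + _ = x + (1 *: v i + l *: v j)) ?mx //.
  by rewrite scale1r -addrA.
Qed.

(** This is where the tiling being edge-to-edge is used: the intersection of two
    tiles is a vertex of both or an edge of both. *)
Lemma tile_vertex_shared T a b q : rhombus_tiling v T -> T a -> T b ->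
  tile_vertex v a q -> tile_supp v b q -> tile_vertex v b q.
Proof.
move=> hT Ta Tb aq bq; have [<- //|nab] := EM (a = b).
have aq' := tile_vertex_supp aq.
have ne : tile_supp v a `&` tile_supp v b !=set0 by exists q.
have [[p [ap bp E]]|[y [k [ay by_ E]]]] := tiling_edge_to_edge hT Ta Tb nab ne.
  have : [set p] q by rewrite -E; split.
  by move=> /= ->.
have sq : segment v y k q by rewrite -E.
have [h1 h2] := tile_vertex_edge by_.
by have [->|->] := vertex_on_edge (tile_det_neq0 hT Ta) ay aq sq.
Qed.

Lemma tile_share_vertex T a b z : rhombus_tiling v T -> T a -> T b ->
  tile_supp v a z -> tile_supp v b z ->
  exists q, tile_vertex v a q /\ tile_vertex v b q.
Proof.
move=> hT Ta Tb az bz; have [<-|nab] := EM (a = b).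
  by exists (tile_pos a); split; exact: tile_pos_vertex.
have ne : tile_supp v a `&` tile_supp v b !=set0 by exists z.
have [[p [ap bp E]]|[y [k [ay by_ E]]]] := tiling_edge_to_edge hT Ta Tb nab ne.
  by exists p.
by exists y; split; [case: (tile_vertex_edge ay)|case: (tile_vertex_edge by_)].
Qed.

Lemma tiling_at T z : rhombus_tiling v T -> exists2 a, T a & tile_supp v a z.
Proof.
move=> hT; have : [set: 'rV[R]_2] z by [].
by rewrite -(tiling_cover hT) => -[a Ta az]; exists a.
Qed.

Definition vtx T y := exists2 a, T a & tile_vertex v a y.

(** The tiles that meet a segment form a chain in which neighbours share a vertex, so
    a function which is constant on the vertices of each of them takes the same value
    at both ends. All the properties of lifts are proved in this way. *)
Lemma vertex_constant (V : Type) T (h : 'rV[R]_2 -> V) p q : rhombus_tiling v T ->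
  (forall a (t : R) y y', T a -> 0 <= t <= 1 -> tile_supp v a (p + t *: (q - p)) ->
     tile_vertex v a y -> tile_vertex v a y' -> h y = h y') ->
  forall a b y y', T a -> T b -> tile_supp v a p -> tile_supp v b q ->
    tile_vertex v a y -> tile_vertex v b y' -> h y = h y'.
Proof.
move=> hT hc a b y y' Ta Tb ap bq ay by'.
pose z t := p + t *: (q - p).
pose P t := forall c w, T c -> tile_supp v c (z t) -> tile_vertex v c w -> h w = h y.
have z0 : z 0 = p by rewrite /z scale0r addr0.
have z1 : z 1 = q by rewrite /z scale1r addrC subrK.
have shared (t : R) c d w w' : 0 <= t <= 1 -> T c -> T d ->
    tile_supp v c (z t) -> tile_supp v d (z t) ->
    tile_vertex v c w -> tile_vertex v d w' -> h w = h w'.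
  move=> ht Tc Td cz dz cw dw'.
  have [u [cu du]] := tile_share_vertex hT Tc Td cz dz.
  by rewrite (hc c t w u) // (hc d t u w').
suff P1 : P 1 by rewrite (P1 b y') // z1.
apply: (@locally_constant01 R P); last first.
  move=> c w Tc; rewrite z0 => cp cw; apply: (shared 0 c a) => //; rewrite ?z0 //.
  by rewrite lexx ler01.
move=> t ht; have [d d0 hd] := tile_local_finite (z t) hT.
have K0 : 0 < `|q - p| + 1 by rewrite ltr_wpDl.
exists (d / (`|q - p| + 1)); first by rewrite divr_gt0.
move=> s hs sd.
have near c : T c -> tile_supp v c (z s) -> tile_supp v c (z t).
  move=> Tc cz; apply: hd cz _ => //.
  have -> : z s - z t = (s - t) *: (q - p).
    by apply/rowP => ?; rewrite !mxE; ring.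
  rewrite normrZ; apply: (@le_lt_trans _ _ (`|s - t| * (`|q - p| + 1))).
    by rewrite ler_wpM2l // lerDl.
  by rewrite -ltr_pdivlMr.
split=> Pt c w Tc cz cw.
  by apply: (Pt c) => //; exact: near.
have [e Te ez] := tiling_at (z s) hT.
rewrite -(Pt e (tile_pos e)) //; last exact: tile_pos_vertex.
by apply: (shared t c e) => //; [exact: near|exact: tile_pos_vertex].
Qed.

Lemma vertex_constantT (V : Type) T (h : 'rV[R]_2 -> V) : rhombus_tiling v T ->
  (forall a y y', T a -> tile_vertex v a y -> tile_vertex v a y' -> h y = h y') ->
  forall y y', vtx T y -> vtx T y' -> h y = h y'.
Proof.
move=> hT hc y y' [a Ta ay] [b Tb by'].
apply: (@vertex_constant V T h y y' hT _ a b y y' Ta Tb) => //;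
  [move=> c t w w' Tc _ _; exact: hc|exact: tile_vertex_supp|exact: tile_vertex_supp].
Qed.

End Tiles.

(** Along an ultrafilter, all bounded sequences converge at once: this provides the
    limits, for all points of the surface, of positions in thinner and thinner slabs. *)
Lemma ultra_limit (R : realType) (G : set_system nat) (u : nat -> R) M :
  UltraFilter G -> (forall n, `|u n| <= M) ->
  exists l, forall e, 0 < e -> G [set n | `|u n - l| < e].
Proof.
move=> UG hu; pose S := [set r | G [set n | r <= u n]].
have GT : G setT by exact: filterT.
have S1 : S (- M).
  apply: filterS GT => n _ /=; by have := hu n; rewrite ler_norml => /andP[].
have S2 : ubound S M.
  move=> r Sr; have : (G `&` [set A | A !=set0]) [set n | r <= u n].
    by split => //; exact: filter_ex Sr.
  move=> [_ [n /= rn]]; apply: (le_trans rn).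
  by have := hu n; rewrite ler_norml => /andP[].
have hS : has_sup S by split; [exists (- M)|exists M].
exists (sup S) => e e0.
have [r Sr rl] := sup_adherent e0 hS.
have : ~ S (sup S + e / 2).
  move=> /(ub_le_sup hS.2); rewrite leNgt; apply/negP/negPn.
  by rewrite ltrDl divr_gt0.
move=> nS; have [//|h] := in_ultra_setVsetC [set n | sup S + e / 2 <= u n] UG.
apply: filterS (filterI Sr h) => n [/= h1 /negP]; rewrite -ltNge => h2.
by rewrite ltr_norml; apply/andP; split; lra.
Qed.

(** * Lifts and slopes *)
Section Lift.
Variables (R : realType) (v : 'I_4 -> 'rV[R]_2).
Hypothesis vcross : forall i j, i != j -> cross (v i) (v j) != 0.
Implicit Types (a : tile R 4) (y : 'rV[R]_2) (T U : set (tile R 4)).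
Implicit Types (f : 'rV[R]_2 -> 'rV[R]_4) (L : 'M[R]_(2, 4)).

Local Notation e_ k := (basis_vec R k : 'rV[R]_4).

(** Right multiplication by this matrix is the linear map e_k |-> v_k, which sends a
    lift back to the plane. *)
Definition dirmx : 'M[R]_(4, 2) := \matrix_(k, j) v k 0 j.
Local Notation A := dirmx.

Lemma basis_dir k : e_ k *m A = v k.
Proof. by rewrite -rowE; apply/rowP => j; rewrite !mxE. Qed.

Lemma mul_dirE (u : 'rV[R]_4) : u *m A = \sum_k u 0 k *: v k.
Proof.
rewrite mulmx_sum_row; apply: eq_bigr => k _; congr (_ *: _).
by apply/rowP => j; rewrite !mxE.
Qed.

Lemma basisE k l : e_ k 0 l = (l == k)%:R.
Proof. by rewrite mxE eqxx. Qed.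

Lemma lift_tile T f a (b c : bool) : is_lift v T f -> T a ->
  f (tile_pos a + (b%:R *: v (tile_i a) + c%:R *: v (tile_j a))) =
  f (tile_pos a) + (b%:R *: e_ (tile_i a) + c%:R *: e_ (tile_j a)).
Proof.
move=> [_ hf]; case: a => i j x Ta /=.
have h1 : f (x + v i) = f x + e_ i by apply: hf Ta _; left; split => //; left.
have h2 : f (x + v j) = f x + e_ j by apply: hf Ta _; right; split => //; left.
have h3 : f (x + v j + v i) = f (x + v j) + e_ i.
  by apply: hf Ta _; left; split => //; right.
case: b; case: c; rewrite /= ?scale1r ?scale0r ?addr0 ?add0r //.
by rewrite [v i + _]addrC addrA h3 h2 -addrA [e_ j + _]addrC.
Qed.

Lemma edge_constant (V : Type) T (h : 'rV[R]_2 -> V) a :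
  T a -> (forall a y k, T a -> tile_edge v a y k -> h (y + v k) = h y) ->
  forall y, tile_vertex v a y -> h y = h (tile_pos a).
Proof.
move=> Ta he _ [b [c ->]]; case: a Ta => i j x Ta /=.
have h1 : h (x + v i) = h x by apply: he Ta _; left; split => //; left.
have h2 : h (x + v j) = h x by apply: he Ta _; right; split => //; left.
have h3 : h (x + v j + v i) = h (x + v j).
  by apply: he Ta _; left; split => //; right.
case: b; case: c; rewrite /= ?scale1r ?scale0r ?addr0 ?add0r //.
by rewrite [v i + _]addrC addrA h3 h2.
Qed.

Lemma edge_constantT (V : Type) T (h : 'rV[R]_2 -> V) : rhombus_tiling v T ->
  (forall a y k, T a -> tile_edge v a y k -> h (y + v k) = h y) ->
  forall y y', vtx v T y -> vtx v T y' -> h y = h y'.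
Proof.
move=> hT he; apply: vertex_constantT => // a y y' Ta ay ay'.
by rewrite (edge_constant Ta he ay) (edge_constant Ta he ay').
Qed.

(** So y can be recovered from f y, up to a translation. *)
Lemma lift_dir T f : rhombus_tiling v T -> is_lift v T f ->
  forall y y', vtx v T y -> vtx v T y' -> f y *m A - y = f y' *m A - y'.
Proof.
move=> hT [_ hf]; apply: (edge_constantT (h := fun y => f y *m A - y) hT) => a y k Ta ak.
by rewrite (hf _ _ _ Ta ak) mulmxDl basis_dir opprD addrACA subrr addr0.
Qed.

Lemma lift_unique T f g : rhombus_tiling v T -> is_lift v T f -> is_lift v T g ->
  forall y y', vtx v T y -> vtx v T y' -> g y - f y = g y' - f y'.
Proof.
move=> hT [_ hf] [_ hg]; apply: (edge_constantT (h := fun y => g y - f y) hT) => a y k Ta ak.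
by rewrite (hf _ _ _ Ta ak) (hg _ _ _ Ta ak) opprD addrACA subrr addr0.
Qed.

Lemma vtx_near T z : rhombus_tiling v T ->
  exists2 y, vtx v T y & `|z - y| <= 2 * vsum v.
Proof.
move=> hT; have [a Ta az] := tiling_at z hT; exists (tile_pos a).
  by exists a => //; exact: tile_pos_vertex.
exact: tile_pos_near hT Ta az.
Qed.

Lemma vtx_pos T a : T a -> vtx v T (tile_pos a).
Proof. by move=> Ta; exists a => //; exact: tile_pos_vertex. Qed.

Lemma vtx_surface T f y : is_lift v T f -> vtx v T y -> stepped_surface T f (f y).
Proof.
move=> hf [a Ta [b [c ->]]]; exists a; split => //; exists b%:R, c%:R.
rewrite (lift_tile _ _ hf Ta); split => //.
  by case: b; rewrite /= ?lexx ?ler01.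
by case: c; rewrite /= ?lexx ?ler01.
Qed.

Lemma norm_basis k : `|e_ k| <= 1.
Proof. by apply: mxnormP => i j; rewrite ord1 basisE; case: (_ == _); rewrite /= ?normr1 ?normr0 ?ler01. Qed.

Lemma surface_vtx T f (z : 'rV[R]_4) : stepped_surface T f z ->
  exists2 y, vtx v T y & `|z - f y| <= 2.
Proof.
move=> [a [Ta [l [m [/andP[l0 l1] /andP[m0 m1] ->]]]]].
exists (tile_pos a); first exact: vtx_pos.
rewrite [f _ + _]addrC addrK (le_trans (ler_normD _ _)) // !normrZ !ger0_norm //.
rewrite (_ : 2 = 1 * 1 + 1 * 1); last by rewrite !mulr1.
by apply: lerD; apply: ler_pM => //; exact: norm_basis.
Qed.

(** The affine planes of direction E are parametrised by the linear section L of the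
    projection R^4 -> R^2 given by e_k |-> v_k, which is unique. *)
Definition near_linear T f L C := forall y, vtx v T y -> `|f y - y *m L| <= C.

Definition row_of L (D : {vspace 'rV[R]_4}) :=
  forall u, u \in D <-> exists x : 'rV[R]_2, u = x *m L.

Lemma cube_norm t (b : 'rV[R]_4) : cube t b -> `|b| <= t.
Proof.
move=> hb; apply: mxnormP => i j; rewrite ord1.
by have /andP[? ?] := hb j; rewrite ger0_norm.
Qed.

Lemma near_linear_any T f g L C : rhombus_tiling v T -> is_lift v T f ->
  is_lift v T g -> near_linear T f L C -> exists C', near_linear T g L C'.
Proof.
move=> hT hf hg hn; have [y0 vy0 _] := vtx_near 0 hT.
exists (C + `|g y0 - f y0|) => y vy.
have -> : g y - y *m L = (f y - y *m L) + (g y - f y).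
  by rewrite [RHS]addrC addrA subrK.
rewrite (le_trans (ler_normD _ _)) // lerD ?hn //.
by rewrite (lift_unique hT hf hg vy vy0).
Qed.

(** The projection e_k |-> v_k sends the slope within bounded distance of every point
    of the plane, because the lift is near the slope and its vertices are sent to those
    of T. Hence it restricts to an isomorphism, whose inverse is given by L. *)
Lemma planar_linear T D t : rhombus_tiling v T -> lifts_into v T D t ->
  exists L, [/\ L *m A = 1%:M, row_of L D &
    forall f, is_lift v T f -> exists C, near_linear T f L C].
Proof.
move=> hT [dD [f [c [hf hs]]]].
have [y0 vy0 _] := vtx_near 0 hT.
pose k0 := f y0 *m A - y0.
have key y : vtx v T y -> exists d b : 'rV[R]_4, [/\ d \in D, cube t b, f y = c + d + b &
     d *m A = y + (k0 - c *m A) - b *m A].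
  move=> vy; have [x [b [[d dD' ->] cb e]]] := hs _ (vtx_surface hf vy).
  exists d, b; split => //; have := lift_dir hT hf vy vy0; rewrite -/k0 e => <-.
  by rewrite !mulmxDl; apply/rowP => j; rewrite !mxE; ring.
have [CA CA0 hA] := mulmx_norm 0 A.
have dense u : exists2 d, d \in D & `|d *m A - u| <= 2 * vsum v + CA * t.
  have [y vy hy] := vtx_near (u - (k0 - c *m A)) hT.
  have [d [b [dD' cb _ e]]] := key y vy; exists d => //.
  have -> : d *m A - u = - (u - (k0 - c *m A) - y) - b *m A.
    by rewrite e; apply/rowP => j; rewrite !mxE; ring.
  rewrite (le_trans (ler_normB _ _)) // normrN lerD //.
  by rewrite (le_trans (hA _)) // ler_wpM2l // cube_norm.
pose B : 'M[R]_(2, 4) := \matrix_(i < 2) (vbasis D)`_i.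
have DB u : u \in D -> exists w : 'rV[R]_2, u = w *m B.
  move=> uD; rewrite (coord_vbasis uD).
  pose F (i : nat) := if insub i is Some j then coord (vbasis D) j u else 0.
  exists (\row_(i < 2) F i); rewrite mulmx_sum_row.
  have -> : \sum_(i < 2) (\row_(i0 < 2) F i0) 0 i *: row i B =
            \sum_(i < 2) F i *: (vbasis D)`_i.
    by apply: eq_bigr => i _; rewrite mxE rowK.
  rewrite (eq_bigr (fun i : 'I_(\dim D) => F i *: (vbasis D)`_i)).
    have gen (s : seq 'rV[R]_4) m : m = 2%N ->
      \sum_(i < m) F i *: s`_i = \sum_(i < 2) F i *: s`_i by move=> ->.
    exact: gen.
  by move=> i _; rewrite /F valK.
have BD (w : 'rV[R]_2) : w *m B \in D.
  rewrite mulmx_sum_row; apply: rpred_sum => i _; rewrite rpredZ // rowK.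
  by apply: vbasis_mem; rewrite mem_nth // size_tuple dD.
have uM : B *m A \in unitmx.
  apply/negPn/negP => nu.
  have : cokermx (B *m A) != 0 by rewrite cokermx_eq0 row_full_unit.
  move=> /matrix0Pn[i [j nz]]; pose xi := col j (cokermx (B *m A)).
  have Bxi : B *m A *m xi = 0.
    by rewrite /xi colE mulmxA mulmx_coker mul0mx.
  pose s := (xi^T *m xi) 0 0.
  have s0 : 0 < s.
    rewrite /s mxE (eq_bigr (fun k => xi k 0 ^+ 2)); last first.
      by move=> k _; rewrite mxE expr2.
    rewrite (bigD1 i) //= ltr_wpDr //; first by rewrite sumr_ge0 // => k _; rewrite sqr_ge0.
    by rewrite lt_def sqr_ge0 sqrf_eq0 /xi mxE nz.
  have [Cx Cx0 hx] := mulmx_norm 0 xi.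
  pose K := Cx * (2 * vsum v + CA * t) + 1.
  have [d dD' hd] := dense ((K / s) *: xi^T).
  have [w ew] := DB d dD'.
  have h1 := hx (d *m A - (K / s) *: xi^T).
  have e1 : ((d *m A - (K / s) *: xi^T) *m xi) 0 0 = - K.
    rewrite mulmxBl ew -[w *m B *m A]mulmxA -mulmxA Bxi mulmx0 sub0r.
    by rewrite -scalemxAl mxE mxE -/s mulfVK // gt_eqF.
  have := le_trans (mxnorm_coord ((d *m A - (K / s) *: xi^T) *m xi) 0 0) h1.
  rewrite e1 normrN.
  have := ler_wpM2l Cx0 hd => h2 h3.
  have := le_trans h3 h2; rewrite leNgt => /negP; apply.
  by apply: lt_le_trans (ler_norm _); rewrite /K ltrDl.
pose L := invmx (B *m A) *m B.
have LA : L *m A = 1%:M by rewrite /L -mulmxA mulVmx.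
have LD : row_of L D.
  move=> u; split=> [/DB[w ->]|[x ->]]; last by rewrite /L mulmxA BD.
  by exists (w *m (B *m A)); rewrite /L (mulmxA (w *m (B *m A))) mulmxK.
exists L; split => // g hg; apply: (near_linear_any (C := `|c| + t +
    mx_norm ((k0 - c *m A) *m L) + sval (cid2 (mulmx_norm 0 (A *m L))) * t) hT hf hg).
move=> y vy; case: cid2 => CL CL0 hL /=.
have [d [b [/LD[x dE] cb e e']]] := key y vy.
have xE : x = d *m A by rewrite dE -mulmxA LA mulmx1.
have -> : f y - y *m L = c + b + (k0 - c *m A) *m L - b *m (A *m L).
  rewrite e {1}dE xE e' !mulmxBl mulmxDl !mulmxA !mulmxBl.
  by apply/rowP => j; rewrite !mxE; ring.
rewrite (le_trans (ler_normB _ _)) // lerD //; last first.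
  by rewrite (le_trans (hL _)) // ler_wpM2l // cube_norm.
rewrite (le_trans (ler_normD _ _)) // lerD //.
by rewrite (le_trans (ler_normD _ _)) // lerD // cube_norm.
Qed.

Lemma le_scale_eq0 (x K : R) : (forall n : nat, n%:R * `|x| <= K) -> x = 0.
Proof.
move=> h; apply/eqP; rewrite -normr_eq0; apply/negPn/negP => x0.
have x1 : 0 < `|x| by rewrite lt_def x0 normr_ge0.
have K0 : 0 <= K by have := h 0%N; rewrite mul0r.
have := archi_boundP (divr_ge0 K0 (ltW x1)); rewrite ltr_pdivrMr // => h'.
by have := h (Num.bound (K / `|x|)); rewrite leNgt h'.
Qed.

Lemma near_linear_eq T f L1 L2 C1 C2 : rhombus_tiling v T ->
  near_linear T f L1 C1 -> near_linear T f L2 C2 -> L1 = L2.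
Proof.
move=> hT h1 h2.
have [CL CL0 hL] := mulmx_norm 0 (L1 - L2).
have lin (u : 'rV[R]_2) : u *m (L1 - L2) = 0.
  apply/rowP => j; rewrite [RHS]mxE.
  apply: (@le_scale_eq0 _ (C1 + C2 + CL * (2 * vsum v))) => m.
  have [y vy hy] := vtx_near (m%:R *: u) hT.
  rewrite -[m%:R]ger0_norm // -normrM.
  have -> : m%:R * (u *m (L1 - L2)) 0 j =
     ((f y - y *m L2) - (f y - y *m L1) + (m%:R *: u - y) *m (L1 - L2)) 0 j.
    rewrite mulmxBl -[_ *: u *m _]scalemxAl !mulmxBr.
    by rewrite !mxE; ring.
  apply: (le_trans (mxnorm_coord _ _ _)).
  apply: (le_trans (ler_normD _ _)); apply: lerD.
    by rewrite (le_trans (ler_normB _ _)) // addrC lerD ?h1 ?h2.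
  by rewrite (le_trans (hL _)) // ler_wpM2l.
apply/eqP; rewrite -subr_eq0; apply/eqP/row_matrixP => i.
by rewrite rowE lin row0.
Qed.

Lemma row_of_dim L D : L *m A = 1%:M -> row_of L D -> \dim D = 2%N.
Proof.
move=> LA hD.
have fr : free [:: row 0 L; row 1 L].
  apply/freeP => k; rewrite big_ord_recl big_ord1 /= => e i.
  have := congr1 (mulmxr A) e; rewrite /= mul0mx mulmxDl -!scalemxAl -!row_mul LA.
  move=> e'; have h0 := congr1 (fun w : 'rV[R]_2 => w 0 0) e'.
  have h1 := congr1 (fun w : 'rV[R]_2 => w 0 1) e'.
  move: h0 h1; rewrite !mxE /= !mulr1 !mulr0 addr0 add0r => h0 h1.
  case: i => -[|[|//]] hi; [rewrite -[RHS]h0|rewrite -[RHS]h1]; congr k; exact/val_inj.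
suff -> : D = span [:: row 0 L; row 1 L] by apply/eqP; move: fr; rewrite /free.
apply/vspaceP => u; apply/idP/idP.
  move=> /hD[x ->]; rewrite mulmx_sum_row big_ord_recl big_ord1 /=.
  apply: rpredD; rewrite rpredZ //; apply: memv_span; rewrite !inE ?eqxx //.
  by rewrite (_ : lift ord0 ord0 = 1) ?eqxx ?orbT //; exact/val_inj.
move: u; apply/subvP/span_subvP => u; rewrite !inE => /orP[]/eqP ->; apply/hD.
  by exists (delta_mx 0 0); rewrite -rowE.
by exists (delta_mx 0 1); rewrite -rowE.
Qed.

Lemma surface_pos T f a : T a -> stepped_surface T f (f (tile_pos a)).
Proof.
move=> Ta; exists a; split => //; exists 0, 0.
by rewrite !lexx ler01 !scale0r !addr0.
Qed.

(** A bounded deviation C is contained in a cube of side 2 C; a tile adds at most 2. *)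
Lemma near_linear_lifts T f L C D : is_lift v T f -> L *m A = 1%:M ->
  row_of L D -> near_linear T f L C -> 0 <= C -> lifts_into v T D (2 * C + 2).
Proof.
move=> hf LA hD hn C0; split; first exact: row_of_dim LA hD.
exists f, (const_mx (- C)); split => // z [a [Ta [l [m [/andP[l0 l1] /andP[m0 m1] ->]]]]].
pose y := tile_pos a; pose w := l *: e_ (tile_i a) + m *: e_ (tile_j a).
exists (const_mx (- C) + y *m L), (f y + w - (const_mx (- C) + y *m L)); split.
- by exists (y *m L) => //; apply/hD; exists y.
- move=> k; have := le_trans (mxnorm_coord (f y - y *m L) 0 k) (hn y (vtx_pos Ta)).
  rewrite ler_norml => /andP[].
  have -> : (f y + w - (const_mx (- C) + y *m L)) 0 k =
     (f y - y *m L) 0 k + C + w 0 k.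
    by rewrite [w]lock !mxE; ring.
  have : 0 <= w 0 k <= 2.
    rewrite /w !mxE eqxx /=; case: (_ == _); case: (_ == _);
      rewrite /= ?mulr1 ?mulr0 ?addr0; apply/andP; split; lra.
  move=> /andP[w0 w2]; move: (_ 0 k) => r; move=> ? ?; apply/andP; split; lra.
- by rewrite [RHS]addrC subrK.
Qed.

Lemma small_eq0 (x K : R) : (forall e, 0 < e -> `|x| <= K * e) -> x = 0.
Proof.
move=> h; apply: (@le_scale_eq0 _ K) => -[|n].
  by rewrite mul0r; have := h 1 ltr01; rewrite mulr1; apply: le_trans.
have n0 : (0 : R) < n.+1%:R by [].
by rewrite mulrC -ler_pdivlMr //; apply: h; rewrite invr_gt0.
Qed.

Lemma row_ofP L D u : L *m A = 1%:M -> row_of L D ->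
  u \in D <-> u *m (1%:M - A *m L) = 0.
Proof.
move=> LA hD; rewrite mulmxBr mulmx1 mulmxA; split.
  by move=> /hD[x ->]; rewrite -(mulmxA x) LA mulmx1 subrr.
by move=> /eqP; rewrite subr_eq0 => /eqP e; apply/hD; exists (u *m A).
Qed.

(** The infimum of the thicknesses is attained, because all the slabs have the same
    direction, by uniqueness of the slope, and their positions are bounded. *)
Lemma thickness_attained T f L C D : rhombus_tiling v T -> is_lift v T f ->
  L *m A = 1%:M -> row_of L D -> near_linear T f L C -> 0 <= C ->
  exists t, [/\ is_thickness v T t, lifts_into v T D t & t <= 2 * C + 2].
Proof.
move=> hT hf LA hD hn C0.
have [a0 Ta0 _] := tiling_at 0 hT.
pose Th := [set t | 1 <= t /\ lifts_into v T D t].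
have ThC : Th (2 * C + 2) by split; [lra|exact: near_linear_lifts hf LA hD hn C0].
have lbT : has_inf Th by split; [exists (2 * C + 2)|exists 1 => t []].
pose t0 := inf Th.
have t01 : 1 <= t0 by apply: lb_le_inf; [exists (2 * C + 2)|move=> t []].
pose ok (n : nat) (p : 'rV[R]_4 * R) := [/\ 0 <= p.2, p.2 < t0 + n.+1%:R^-1 &
  forall z : 'rV[R]_4, stepped_surface T f z -> exists d b : 'rV[R]_4,
    [/\ d \in D, cube p.2 b & z = p.1 + d + b]].
have /choice[ct hct] : forall n, exists p : 'rV[R]_4 * R, ok n p.
  move=> n; have n0 : (0 : R) < n.+1%:R^-1 by rewrite invr_gt0.
  have [t [t1 [_ [g [c [hg hs]]]]] tl] := inf_adherent n0 lbT.
  pose k := g (tile_pos a0) - f (tile_pos a0).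
  exists (c - k, t); split => //=; first lra.
  move=> z [a [Ta [l [m [hl hm zE]]]]].
  have : stepped_surface T g (z + k).
    exists a; split => //; exists l, m; split => //.
    rewrite zE /k (lift_unique hT hf hg (vtx_pos Ta0) (vtx_pos Ta)).
    by apply/rowP => ?; rewrite !mxE; ring.
  move=> /hs[x [b [[d dD ->] cb e]]]; exists d, b; split => //.
  by rewrite -[z](addrK k) e; apply/rowP => ?; rewrite !mxE; ring.
pose okb (nz : nat * 'rV[R]_4) (b : 'rV[R]_4) := cube (ct nz.1).2 b /\
  (stepped_surface T f nz.2 -> exists2 d, d \in D & nz.2 = (ct nz.1).1 + d + b).
have /choice[b hb] : forall nz, exists b : 'rV[R]_4, okb nz b.
  move=> [n z]; have [t1 tl hs] := hct n.
  have [zs|nz] := EM (stepped_surface T f z); last first.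
    by exists 0; split => // k; rewrite mxE lexx.
  have [d [b [dD cb e]]] := hs _ zs; exists b; split => // _; by exists d.
have [G [UG Goo]] := ultraFilterLemma (@eventually_filter).
have FI B C' : G B -> G C' -> G (B `&` C') by exact: filterI.
have FE B : G B -> B !=set0 by exact: filter_ex.
have GN N : G [set n | (N <= n)%N] by apply: Goo; exact: nbhs_infty_ge.
have bb n z k : `|b (n, z) 0 k| <= t0 + 1.
  have [/(_ k)/andP[b0 b1] _] := hb (n, z); have [t1 tl _] := hct n.
  rewrite ger0_norm // (le_trans b1) // (le_trans (ltW tl)) // lerD2l.
  by rewrite invf_le1 // ler1n.
have /choice[l hl] : forall zk : 'rV[R]_4 * 'I_4, exists l, forall e, 0 < e ->
    G [set n | `|b (n, zk.1) 0 zk.2 - l| < e].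
  by move=> [z k]; apply: (ultra_limit (u := fun n => b (n, z) 0 k) (M := t0 + 1)).
pose be (z : 'rV[R]_4) : 'rV[R]_4 := \row_k l (z, k).
have hbe z e : 0 < e -> G [set n | `|b (n, z) - be z| < e].
  move=> e0; have h k := hl (z, k) _ e0.
  have := FI _ _ (FI _ _ (h 0) (h 1)) (FI _ _ (h 2%:R) (h 3%:R)).
  apply: filterS => n [[/= h0 h1] [h2 h3]]; apply: mxnormP_lt => i k; rewrite ord1 !mxE.
  by case: k => -[|[|[|[|//]]]] hk; [move: h0|move: h1|move: h2|move: h3];
    congr (`|b (n, z) _ _ - l (z, _)| < e); exact/val_inj.
have cbe z : cube t0 (be z).
  move=> k; apply/andP; split.
    apply/ler_addgt0Pr => e e0; have [n /= hne] := FE _ (hl (z, k) _ e0).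
    have [/(_ k)/andP[b0 b1] _] := hb (n, z); rewrite /= in b0 b1.
    by move: hne; rewrite mxE ltr_norml => /andP[? ?]; lra.
  apply/ler_addgt0Pr => e e0; have e2 : 0 < e / 2 by rewrite divr_gt0.
  have := FE _ (FI _ _ (hl (z, k) _ e2) (GN (Num.bound (e / 2)^-1))).
  move=> [n [/= hne Nn]].
  have [/(_ k)/andP[b0 b1] _] := hb (n, z); have [t1 tl _] := hct n; rewrite /= in b0 b1.
  have : n.+1%:R^-1 < e / 2.
    rewrite invf_plt ?posrE //; apply: lt_le_trans (archi_boundP _) _.
      by rewrite invr_ge0 ltW.
    by rewrite ler_nat ltnW.
  have -> : be z 0 k = l (z, k) by rewrite mxE.
  move: (n.+1%:R^-1) tl (e / 2) (splitr e) hne => r tl h eh.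
  by rewrite ltr_norml => /andP[? ?] ?; lra.
have LD : lifts_into v T D t0.
  split; first exact: row_of_dim LA hD.
  pose z0 := f (tile_pos a0).
  exists f, (z0 - be z0); split => // z zs.
  exists (z - be z), (be z); split; [|exact: cbe|by rewrite subrK].
  exists (z - z0 - be z + be z0); last by apply/rowP => ?; rewrite !mxE; ring.
  apply/(row_ofP _ LA hD).
  have [CM CM0 hM] := mulmx_norm 0 (1%:M - A *m L).
  apply/rowP => j; rewrite [RHS]mxE; apply: (@small_eq0 _ (CM * 2)) => e e0.
  have [n [/= h1 h2]] := FE _ (FI _ _ (hbe z _ e0) (hbe z0 _ e0)).
  have [_ /(_ zs)[d dD /= zE]] := hb (n, z).
  have [_ /(_ (surface_pos f Ta0))[d' dD' /= zE']] := hb (n, z0).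
  have dd : (d - d') *m (1%:M - A *m L) = 0 by apply/(row_ofP _ LA hD); exact: rpredB.
  have -> : z - z0 - be z + be z0 =
      (b (n, z) - be z) - (b (n, z0) - be z0) + (d - d').
    apply/rowP => i; have hz := congr1 (fun w : 'rV[R]_4 => w 0 i) zE.
    have hz' := congr1 (fun w : 'rV[R]_4 => w 0 i) zE'.
    by move: hz hz'; rewrite !mxE => hz hz'; lra.
  rewrite mulmxDl dd addr0 (le_trans (mxnorm_coord _ _ _)) // (le_trans (hM _)) //.
  rewrite -mulrA ler_wpM2l // (le_trans (ler_normB _ _)) //.
  by rewrite mulr_natl mulr2n lerD // ltW.
exists t0; split => //; last by apply: ge_inf => //; case: lbT.
split => //; first by exists D.
move=> t D' t1 hD'; have [L' [LA' rD' hL']] := planar_linear hT hD'.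
have [C' hn'] := hL' _ hf; have LL := near_linear_eq hT hn hn'.
have DD : D' = D.
  apply/vspaceP => u; apply/idP/idP => [/rD' h|/hD h].
    by apply/hD; rewrite LL.
  by apply/rD'; rewrite -LL.
by apply: ge_inf; [case: lbT|split => //; rewrite -DD].
Qed.

End Lift.

(** * The signs of the Grassmann coordinates of the slope *)
Section Strip.
Variables (R : realType) (v : 'I_4 -> 'rV[R]_2).
Hypothesis vcross : forall i j, i != j -> cross (v i) (v j) != 0.
Implicit Types (a : tile R 4) (y : 'rV[R]_2) (T U : set (tile R 4)).
Implicit Types (f : 'rV[R]_2 -> 'rV[R]_4) (L : 'M[R]_(2, 4)).

Local Notation e_ k := (basis_vec R k : 'rV[R]_4).

Lemma v_neq0 i : v i != 0.
Proof.
apply/eqP => e; pose j : 'I_4 := if i == 0 then 1 else 0.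
have ij : i != j by rewrite /j; case: (i =P 0) => [->//|/eqP].
by have := vcross ij; rewrite e /cross !mxE !mul0r subrr eqxx.
Qed.

Lemma edge_mid a y i y' k : tile_det v a != 0 -> tile_edge v a y i ->
  tile_edge v a y' k -> segment v y' k (y + 2^-1 *: v i) -> y' = y /\ k = i.
Proof.
case: a => p q x h he he' [l [_ e]].
have lx := @tile_lE R 4 v (Tile p q x) _ _ h.
have mx := @tile_mE R 4 v (Tile p q x) _ _ h; rewrite /= in lx mx.
pose pt (s t : R) := x + (s *: v p + t *: v q).
have inj s t s' t' : pt s t = pt s' t' -> s = s' /\ t = t'.
  move=> E; split.
    by have := congr1 (tile_l v (Tile p q x)) E; rewrite /pt !lx.
  by have := congr1 (tile_m v (Tile p q x)) E; rewrite /pt !mx.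
have half (b : bool) : b%:R <> 2^-1 :> R by clear; case: b => /= H; lra.
have std z m w : tile_edge v (Tile p q x) z m -> exists b : bool,
   (m = p /\ z = pt 0 b%:R /\ z + w *: v m = pt w b%:R) \/
   (m = q /\ z = pt b%:R 0 /\ z + w *: v m = pt b%:R w).
  rewrite /pt; case=> [[-> [->|->]]|[-> [->|->]]].
  - exists false; left; rewrite !scale0r !addr0; split => //; split => //.
  - by exists true; left; rewrite !scale1r scale0r add0r -addrA [v q + _]addrC.
  - by exists false; right; rewrite !scale0r !addr0 add0r.
  - by exists true; right; rewrite !scale1r scale0r addr0 -addrA.
have [b hb] := std _ _ 2^-1 he; have [b' hb'] := std _ _ l he'.
case: hb => [[ip [yE zE]]|[iq [yE zE]]]; case: hb' => [[kp [yE' zE']]|[kq [yE' zE']]];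
  have := e; rewrite zE zE' => /inj[h1 h2].
- by rewrite ip kp yE yE' h2.
- by case: (half b').
- by case: (half b').
- by rewrite iq kq yE yE' h1.
Qed.

Lemma edge_mid_supp a y i : tile_edge v a y i -> tile_supp v a (y + 2^-1 *: v i).
Proof.
move=> /tile_vertex_edge[[b1 [c1 E1]] [b2 [c2 E2]]].
exists ((b1%:R + b2%:R) / 2), ((c1%:R + c2%:R) / 2); split.
- by case: b1 {E1}; case: b2 {E2} => /=; apply/andP; split; lra.
- by case: c1 {E1}; case: c2 {E2} => /=; apply/andP; split; lra.
- have -> : y + 2^-1 *: v i = 2^-1 *: (y + (y + v i)).
    by apply/rowP => ?; rewrite !mxE; field.
  by rewrite {1}E1 E2; apply/rowP => ?; rewrite !mxE; field.
Qed.

(** Across its edge (y, v_i) a tile continues into the next one of the strip, on the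
    side where the determinant with v_i is positive; the opposite edge of that tile is
    obtained by adding v_j if det (v_i, v_j) > 0 and by subtracting it otherwise. *)
Lemma strip_step T f y i : rhombus_tiling v T -> is_lift v T f ->
  (exists2 a, T a & tile_edge v a y i) -> exists j,
  [/\ j != i, exists2 b, T b & tile_edge v b (y + Num.sg (cross (v i) (v j)) *: v j) i &
  f (y + Num.sg (cross (v i) (v j)) *: v j) = f y + Num.sg (cross (v i) (v j)) *: e_ j].
Proof.
move=> hT [_ hf] [a Ta ai].
pose z0 := y + 2^-1 *: v i.
have [d d0 hd] := tile_local_finite vcross z0 hT.
have [w w0 ww] : exists2 w, w != 0 & 0 < cross (v i) w.
  pose j : 'I_4 := if i == 0 then 1 else 0.
  have ij : i != j by rewrite /j; case: (i =P 0) => [->//|/eqP].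
  exists (Num.sg (cross (v i) (v j)) *: v j).
    by rewrite scaler_eq0 negb_or v_neq0 sgr_eq0 vcross.
  by rewrite crossZr -normrEsg normr_gt0 vcross.
pose z := z0 + (d / (2 * `|w|)) *: w.
have w1 : 0 < `|w| by rewrite normr_gt0.
have e0 : 0 < d / (2 * `|w|) by rewrite divr_gt0 // mulr_gt0.
have [b Tb bz] := tiling_at z hT.
have bz0 : tile_supp v b z0.
  apply: hd Tb bz _; rewrite /z addrAC subrr add0r normrZ gtr0_norm //.
  rewrite invfM mulrA mulfVK ?gt_eqF //; lra.
have az0 : segment v y i z0.
  by exists 2^-1; split => //; apply/andP; split; lra.
have az := edge_mid_supp ai; rewrite -/z0 in az.
have bi : tile_edge v b y i.
  have [<- //|nab] := EM (a = b).
  have ne : tile_supp v a `&` tile_supp v b !=set0 by exists z0.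
  have [[p [ap bp E]]|[y' [k [ay by_ E]]]] := tiling_edge_to_edge hT Ta Tb nab ne.
    have zp : z0 = p by have : [set p] z0 by rewrite -E.
    rewrite -zp in ap.
    have half : 2^-1 *: v i != 0 by rewrite scaler_eq0 negb_or v_neq0 invr_eq0 pnatr_eq0.
    case: (vertex_on_edge (tile_det_neq0 vcross hT Ta) ai ap az0) => /eqP.
      by rewrite /z0 -subr_eq0 addrAC subrr add0r (negPf half).
    rewrite /z0 -subr_eq0 opprD addrACA subrr add0r -{2}[v i]scale1r -scalerBl.
    rewrite scaler_eq0 (negPf (v_neq0 i)) orbF => /eqP; lra.
  have sz : segment v y' k z0 by rewrite -E; split.
  by have [<- <-] := edge_mid (tile_det_neq0 vcross hT Ta) ai ay sz.
have side : 0 < cross (v i) (z - y).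
  have -> : z - y = 2^-1 *: v i + (d / (2 * `|w|)) *: w.
    by apply/rowP => ?; rewrite !mxE; ring.
  by rewrite !crossE mulr0 add0r mulr_gt0.
case: b Tb bz bz0 bi => p q x Tb bz _ bi; have pq := tile_neq hT Tb; rewrite /= in pq.
move: bz => [l [m [/= /andP[l0 l1] /andP[m0 m1] zE]]].
have nz : cross (v p) (v q) != 0 by exact: vcross.
have edge u k : tile_edge v (Tile p q x) u k -> f (u + v k) = f u + e_ k by exact: hf Tb.
have pos c t : 0 < t * c -> 0 <= t -> Num.sg c = 1 :> R.
  by move=> tc t0; apply: gtr0_sg; rewrite -(pmulr_rgt0 _ (_ : 0 < t)) // lt_def t0 andbT;
    apply: contraTneq tc => ->; rewrite mul0r ltxx.
have neg c t : 0 < t * c -> t <= 0 -> Num.sg c = - 1 :> R.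
  move=> tc t0; apply: ltr0_sg; rewrite -oppr_gt0 -(pmulr_rgt0 _ (_ : 0 < - t)) ?mulrNN //.
  rewrite oppr_gt0 lt_def t0 andbT eq_sym.
  by apply: contraTneq tc => ->; rewrite mul0r ltxx.
have finish j u : j != i -> Num.sg (cross (v i) (v j)) = 1 :> R -> u = y ->
    tile_edge v (Tile p q x) u j -> tile_edge v (Tile p q x) (u + v j) i ->
    exists j, [/\ j != i,
     exists2 b, T b & tile_edge v b (y + Num.sg (cross (v i) (v j)) *: v j) i &
     f (y + Num.sg (cross (v i) (v j)) *: v j) = f y + Num.sg (cross (v i) (v j)) *: e_ j].
  move=> ji sj -> h1 h2; exists j; rewrite sj !scale1r; split => //; last exact: edge.
  by exists (Tile p q x).
have finish' j u : j != i -> Num.sg (cross (v i) (v j)) = -1 :> R -> u + v j = y ->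
    tile_edge v (Tile p q x) u j -> tile_edge v (Tile p q x) u i ->
    exists j, [/\ j != i,
     exists2 b, T b & tile_edge v b (y + Num.sg (cross (v i) (v j)) *: v j) i &
     f (y + Num.sg (cross (v i) (v j)) *: v j) = f y + Num.sg (cross (v i) (v j)) *: e_ j].
  move=> ji sj <- h1 h2; exists j; rewrite sj !scaleN1r addrK; split => //.
    by exists (Tile p q x).
  by rewrite (edge _ _ h1) addrK.
case: bi => [[ip [yE|yE]]|[iq [yE|yE]]].
- apply: (finish q x) => //; rewrite ?ip ?(eq_sym q) //.
  + apply: (pos _ m) => //; move: side; rewrite zE yE ip.
    by rewrite [x + _]addrC addrK !crossE mulr0 add0r.
  + by right; split => //; left.
  + by left; split => //; right.
- apply: (finish' q x) => //; rewrite ?ip ?(eq_sym q) //.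
  + apply: (neg _ (m - 1)); last lra; move: side; rewrite zE yE ip.
    have -> : x + (l *: v p + m *: v q) - (x + v q) = l *: v p + (m - 1) *: v q.
      by apply/rowP => ?; rewrite !mxE; ring.
    by rewrite !crossE mulr0 add0r.
  + by right; split => //; left.
  + by left; split => //; left.
- apply: (finish p x) => //; rewrite ?iq //.
  + apply: (pos _ l) => //; move: side; rewrite zE yE iq.
    by rewrite [x + _]addrC addrK !crossE mulr0 addr0.
  + by left; split => //; left.
  + by right; split => //; right.
- apply: (finish' p x) => //; rewrite ?iq //.
  + apply: (neg _ (l - 1)); last lra; move: side; rewrite zE yE iq.
    have -> : x + (l *: v p + m *: v q) - (x + v p) = (l - 1) *: v p + m *: v q.
      by apply/rowP => ?; rewrite !mxE; ring.
    by rewrite !crossE mulr0 addr0.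
  + by left; split => //; left.
  + by right; split => //; left.
Qed.

Definition grass L i j : R := L 0 i * L 1 j - L 0 j * L 1 i.

Lemma mulL_E L (x : 'rV[R]_2) k : (x *m L) 0 k = x 0 0 * L 0 k + x 0 1 * L 1 k.
Proof.
rewrite mxE big_ord_recl big_ord1 (_ : lift ord0 ord0 = 1) //; exact/val_inj.
Qed.

Lemma grass_cross L i j (x y : 'rV[R]_2) :
  (x *m L) 0 i * (y *m L) 0 j - (x *m L) 0 j * (y *m L) 0 i = grass L i j * cross x y.
Proof. rewrite !mulL_E /grass /cross; ring. Qed.

Lemma grass_plucker L i j k l :
  grass L i j * grass L k l = grass L i k * grass L j l - grass L i l * grass L j k.
Proof. rewrite /grass; ring. Qed.

Lemma grassC L i j : grass L j i = - grass L i j.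
Proof. rewrite /grass; ring. Qed.

Lemma mulA_E (x : 'rV[R]_2) L : L *m dirmx v = 1%:M ->
  \sum_k (x *m L) 0 k *: v k = x.
Proof. by move=> LA; rewrite -mul_dirE -mulmxA LA mulmx1. Qed.

(** Iterating strip_step n times goes arbitrarily far, as each step increases the
    determinant with v_i by at least m. *)
Lemma strip_path T f i n : rhombus_tiling v T -> is_lift v T f ->
  forall (m : R) (y : _), (forall j, j != i -> m <= `|cross (v i) (v j)|) ->
  (exists2 a, T a & tile_edge v a y i) -> exists y',
  [/\ exists2 a, T a & tile_edge v a y' i, (f y' - f y) 0 i = 0,
   forall j, 0 <= Num.sg (cross (v i) (v j)) * (f y' - f y) 0 j &
   m *+ n <= cross (v i) (y' - y)].
Proof.
move=> hT hf m y hm; elim: n => [|n IH] hy.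
  exists y; rewrite !subrr mulr0n; split => //; first by rewrite mxE.
    by move=> j; rewrite mxE mulr0.
  by rewrite /cross !mxE !mulr0 subrr.
have [y' [hy' fi fj c]] := IH hy.
have [j [ji hy'' fj']] := strip_step hT hf hy'.
set s := Num.sg (cross (v i) (v j)) in hy'' fj'.
exists (y' + s *: v j); split => //.
- rewrite fj' addrAC mxE fi add0r mxE basisE (eq_sym i) (negPf ji) mulr0 //.
- move=> k; rewrite fj' addrAC mxE mulrDr addr_ge0 // mxE basisE.
  have [->|] := eqVneq k j; last by rewrite !mulr0.
  by rewrite /s mulr1 -expr2 sqr_ge0.
- rewrite addrAC crossDr mulrSr lerD // crossZr -normrEsg; exact: hm.
Qed.

Lemma cross_min i : exists2 m, 0 < m & forall j, j != i -> m <= `|cross (v i) (v j)|.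
Proof.
exists (\big[Num.min/1]_(j | j != i) `|cross (v i) (v j)|).
  apply: lt_bigmin => // j ji; by rewrite normr_gt0 vcross // eq_sym.
by move=> j ji; apply: bigmin_le_cond.
Qed.

(** Without edge v_i the i-th coordinate of the lift is constant. *)
Lemma has_edge_or_flat T f L C i : rhombus_tiling v T -> is_lift v T f ->
  near_linear v T f L C ->
  (exists y, exists2 a, T a & tile_edge v a y i) \/ forall x : 'rV[R]_2, (x *m L) 0 i = 0.
Proof.
move=> hT hf hn; have [|no] := EM (exists y, exists2 a, T a & tile_edge v a y i).
  by left.
right => x.
have hfi : forall y y', vtx v T y -> vtx v T y' -> f y 0 i = f y' 0 i.
  apply: (edge_constantT vcross (h := fun y => f y 0 i) hT) => a y k Ta ak.
  rewrite (hf.2 _ _ _ Ta ak) mxE basisE; case: eqP => [ik|]; last by rewrite addr0.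
  by case: no; exists y, a; rewrite ?ik.
have [y0 vy0 _] := vtx_near 0 hT.
have [CL CL0 hL] := mulmx_norm 0 L.
apply: (@le_scale_eq0 _ _ (C + `|f y0 0 i| + CL * (2 * vsum v))) => n.
have [y vy hy] := vtx_near (n%:R *: x) hT.
rewrite -[n%:R]ger0_norm // -normrM.
have -> : n%:R * (x *m L) 0 i =
   - (f y - y *m L) 0 i + f y0 0 i + ((n%:R *: x - y) *m L) 0 i.
  rewrite mulmxBl -scalemxAl (hfi _ _ vy0 vy).
  have E3 (p q : 'rV[R]_4) : (p - q) 0 i = p 0 i - q 0 i by rewrite !mxE.
  by rewrite !E3 [X in _ = _ + (X - _)]mxE; ring.
apply: (le_trans (ler_normD _ _)); apply: lerD.
  apply: (le_trans (ler_normD _ _)); rewrite normrN lerD //.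
  exact: le_trans (mxnorm_coord _ _ _) (hn _ vy).
by rewrite (le_trans (mxnorm_coord _ _ _)) // (le_trans (hL _)) // ler_wpM2l.
Qed.

(** Far along a strip, the lift has moved by D with D_i = 0 and D_j of the sign of
    det (v_i, v_j), while the position has moved by z with det (v_i, z) large. As z L
    is near D, G_ij det (v_i, z) is near (v_i L)_i D_j. The factor s covers both signs of
    (v_i L)_i. *)
Lemma grass_sign T f L C i j (s : R) : rhombus_tiling v T -> is_lift v T f ->
  near_linear v T f L C -> `|s| = 1 -> 0 <= s * (v i *m L) 0 i ->
  0 <= s * (cross (v i) (v j) * grass L i j).
Proof.
move=> hT hf hn hs h.
have [[y0 hy0]|flat] := has_edge_or_flat i hT hf hn; last first.
  have -> : grass L i j = 0.
    have e0 := flat (delta_mx 0 0); have e1 := flat (delta_mx 0 1).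
    move: e0 e1; rewrite !mulL_E !mxE /= !mul1r !mul0r addr0 add0r /grass => -> ->.
    by rewrite mul0r mulr0 subrr.
  by rewrite !mulr0.
rewrite leNgt; apply/negP => neg.
set sj := Num.sg (cross (v i) (v j)).
have C0 : 0 <= C.
  have [y vy _] := vtx_near 0 hT; exact: le_trans (normr_ge0 _) (hn y vy).
have cE : cross (v i) (v j) = `|cross (v i) (v j)| * sj by rewrite mulrC -numEsg.
have [m m0 hm] := cross_min i.
have vt y : (exists2 a, T a & tile_edge v a y i) -> vtx v T y.
  by move=> [a Ta /tile_vertex_edge[ay _]]; exists a.
set K := `|(v i *m L) 0 i| * (2 * C) + `|(v i *m L) 0 j| * (2 * C).
suff g0 : grass L i j = 0 by move: neg; rewrite g0 !mulr0 ltxx.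
apply: (@le_scale_eq0 _ _ (K / m)) => n.
have [y [hy fi fj c]] := strip_path n hT hf hm hy0.
set z := y - y0 in c.
have near k : `|(z *m L) 0 k - (f y - f y0) 0 k| <= 2 * C.
  have -> : (z *m L) 0 k - (f y - f y0) 0 k =
     (f y0 - y0 *m L) 0 k - (f y - y *m L) 0 k.
    have E3 (p q : 'rV[R]_4) : (p - q) 0 k = p 0 k - q 0 k by rewrite !mxE.
    by rewrite /z mulmxBl !E3; ring.
  rewrite (le_trans (ler_normB _ _)) // mulr_natl mulr2n lerD //;
  exact: le_trans (mxnorm_coord _ _ _) (hn _ (vt _ _)).
have ge := grass_cross L i j (v i) z.
rewrite ler_pdivlMr // -mulrA mulrC -mulrA.
have c' : m * n%:R <= cross (v i) z by rewrite mulr_natr.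
have : `|grass L i j| * (m * n%:R) <= `|grass L i j| * cross (v i) z by rewrite ler_wpM2l.
move=> /le_trans -> //.
have z0 : 0 <= cross (v i) z by apply: le_trans c'; rewrite mulr_ge0 // ltW.
have sjn : sj != 0.
  by apply/eqP => e; move: neg; rewrite cE e mulr0 mul0r mulr0 ltxx.
have sj1 : `|sj| = 1.
  by rewrite /sj normr_sg; move: sjn; rewrite /sj sgr_eq0 => ->.
have -> : `|grass L i j| = - (s * sj * grass L i j).
  rewrite -[LHS]mul1r -[X in X * _ = _]mulr1 -{1}hs -sj1 -!normrM ltr0_norm //.
  move: neg; rewrite cE; have : 0 < `|cross (v i) (v j)|.
    by rewrite normr_gt0; move: sjn; rewrite /sj sgr_eq0.
  move: (`|_|) => A A0; have -> : s * (A * sj * grass L i j) = A * (s * sj * grass L i j) by ring.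
  by rewrite (pmulr_rlt0 _ A0).
have -> : - (s * sj * grass L i j) * cross (v i) z = - (s * sj * (grass L i j * cross (v i) z)) by ring.
rewrite -ge.
have := near j; have := near i; rewrite fi subr0.
set p := (z *m L) 0 i; set q := (z *m L) 0 j; set D := (f y - f y0) 0 j.
set u := (v i *m L) 0 i; set w := (v i *m L) 0 j; move=> hp hq.
have -> : - (s * sj * (u * q - w * p)) =
   - (s * u * (sj * D)) - s * u * (sj * (q - D)) + s * sj * (w * p) by ring.
have h1 : 0 <= s * u * (sj * D) by rewrite mulr_ge0 //; exact: fj.
have h2 : - (s * u * (sj * (q - D))) <= `|u| * (2 * C).
  apply: le_trans (ler_norm _) _; rewrite normrN !normrM hs sj1 !mul1r.
  by rewrite ler_wpM2l.
have h3 : s * sj * (w * p) <= `|w| * (2 * C).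
  apply: le_trans (ler_norm _) _; rewrite !normrM hs sj1 !mul1r.
  by rewrite ler_wpM2l.
rewrite /K -/u -/w; lra.
Qed.

Lemma trace_grass L i : L *m dirmx v = 1%:M ->
  \sum_m cross (v i) (v m) * grass L i m = (v i *m L) 0 i.
Proof.
move=> LA.
have row k : \sum_m L k m *: v m = delta_mx 0 k.
  rewrite -(mulA_E (delta_mx 0 k) LA); apply: eq_bigr => m _; congr (_ *: _).
  by rewrite -rowE mxE.
transitivity (cross (v i) (L 0 i *: \sum_m L 1 m *: v m - L 1 i *: \sum_m L 0 m *: v m)).
  rewrite crossDr crossNr !crossZr !cross_sumr !mulr_sumr -sumrB.
  apply: eq_bigr => m _; rewrite !crossZr /grass; ring.
rewrite !row mulL_E /cross !mxE /=; ring.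
Qed.

(** By grass_sign, a violation at (i, j) forces (v_i L)_i and (v_j L)_j to be negative.
    As the sum of all (v_k L)_k is the trace of L A = 1, some (v_k L)_k is positive, so
    that G_ki = G_kj = 0 and G_km <> 0 for some m, against the Pluecker relation. *)
Theorem grass_ge0 T f L C : rhombus_tiling v T -> is_lift v T f ->
  L *m dirmx v = 1%:M -> near_linear v T f L C ->
  forall i j, 0 <= cross (v i) (v j) * grass L i j.
Proof.
move=> hT hf LA hn.
have pos i j := @grass_sign T f L C i j 1 hT hf hn (normr1 _).
have neg i j := @grass_sign T f L C i j (-1) hT hf hn (normrN1 _).
have Psym i j : cross (v j) (v i) * grass L j i = cross (v i) (v j) * grass L i j.
  by rewrite crossC grassC mulrNN.
move=> i j; rewrite leNgt; apply/negP => P0.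
have ni : (v i *m L) 0 i < 0.
  by rewrite ltNge; apply/negP => h; have := pos i j; rewrite !mul1r => /(_ h); rewrite leNgt P0.
have nj : (v j *m L) 0 j < 0.
  by rewrite ltNge; apply/negP => h; have := pos j i; rewrite !mul1r => /(_ h); rewrite leNgt Psym P0.
have tr : \sum_k (v k *m L) 0 k = 2.
  have -> : 2 = \tr (L *m dirmx v) by rewrite LA mxtrace1.
  rewrite mxtrace_mulC /mxtrace; apply: eq_bigr => k _.
  have -> : v k = row k (dirmx v) by apply/rowP => m; rewrite !mxE.
  by rewrite -row_mul mxE.
have [k pk] : exists k, 0 < (v k *m L) 0 k.
  apply/not_existsP => h; suff : \sum_k (v k *m L) 0 k <= 0 by rewrite tr; lra.
  by apply: sumr_le0 => k _; rewrite leNgt; apply/negP/h.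
have zero m : (v m *m L) 0 m < 0 -> cross (v k) (v m) * grass L k m = 0.
  move=> hm; apply/eqP; rewrite eq_le; apply/andP; split.
    have := neg m k; rewrite !mulN1r !oppr_ge0 Psym => -> //; exact: ltW.
  by have := pos k m; rewrite !mul1r => -> //; exact: ltW.
have gz m : (v m *m L) 0 m < 0 -> grass L k m = 0.
  move=> hm; have km : k != m by apply: contraTneq hm => <-; rewrite -leNgt ltW.
  by apply/eqP; have /eqP := zero m hm; rewrite mulf_eq0 (negPf (vcross km)).
have [m pm] : exists m, 0 < cross (v k) (v m) * grass L k m.
  apply/not_existsP => h; suff : (v k *m L) 0 k <= 0 by rewrite leNgt pk.
  rewrite -(trace_grass k LA); apply: sumr_le0 => m _; rewrite leNgt; apply/negP/h.
have := grass_plucker L i j k m.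
rewrite [grass L i k]grassC [grass L j k]grassC (gz _ ni) (gz _ nj) !oppr0 mul0r mulr0 subrr.
move=> /eqP; rewrite mulf_eq0 => /orP[]/eqP e.
  by move: P0; rewrite e mulr0 ltxx.
by move: pm; rewrite e mulr0 ltxx.
Qed.

End Strip.

(** * Integer staircases *)
Section Stair.
Variable R : realType.
Implicit Types (s y t : R).

(** The graph of the floor function, with its jumps filled: at an integer y, s ranges
    over [y - 1, y]. *)
Definition stair s y : bool := (Num.ceil s)%:~R <= y <= ((Num.floor s)%:~R + 1 : R).

Lemma stairE s y : stair s y = ((Num.ceil y)%:~R - 1 <= s <= (Num.floor y)%:~R).
Proof.
rewrite /stair; apply/andP/andP => -[h1 h2]; split.
- have : (Num.ceil y <= Num.floor s + 1)%R.
    by rewrite ceil_le_int intrD.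
  rewrite -(ler_int R) intrD => h; have := floor_le s; lra.
- have : (Num.ceil s <= Num.floor y)%R by rewrite floor_ge_int.
  rewrite -(ler_int R) => h; have := ceil_ge s; lra.
- have : (Num.ceil s <= Num.floor y)%R by rewrite ceil_le_int.
  rewrite -(ler_int R) => h; have := floor_le y; lra.
- have : (Num.ceil y - 1 <= Num.floor s)%R.
    by rewrite floor_ge_int intrD.
  rewrite -(ler_int R) intrD => h; have := ceil_ge y; lra.
Qed.

Lemma stair_bound s y : stair s y -> y - 1 <= s <= y.
Proof.
rewrite /stair => /andP[h1 h2]; have := ceil_ge s; have := floor_le s.
by move=> h3 h4; apply/andP; split; lra.
Qed.

Lemma stair_gap s s' : s' < s -> (Num.floor s')%:~R + 1 <= (Num.ceil s)%:~R :> R.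
Proof.
move=> h; have : (Num.floor s' < Num.ceil s)%R.
  rewrite -(ltr_int R); have := ceil_ge s; have := floor_le s'; lra.
by rewrite -lezD1 -(ler_int R) intrD.
Qed.

Lemma stair_mono s s' y y' : stair s y -> stair s' y' -> y < y' -> s <= s'.
Proof.
move=> /andP[h1 h2] /andP[h3 h4] h; rewrite leNgt; apply/negP => /stair_gap; lra.
Qed.

Lemma stair_eq s s' y : stair s y -> stair s' y -> s != s' -> y \is a Num.int.
Proof.
wlog lt : s s' / s' < s.
  move=> wl h h' ne; have [lt|lt|e] := ltrgtP s s'; last by rewrite e eqxx in ne.
    by apply: (wl s' s) => //; rewrite eq_sym.
  exact: (wl s s').
move=> /andP[h1 h2] /andP[h3 h4] _; have := stair_gap lt => h.
have -> : y = (Num.ceil s)%:~R by lra.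
by rewrite intr_int.
Qed.

Lemma stair_nint s y : stair s y -> y \isn't a Num.int -> s = (Num.floor y)%:~R.
Proof.
rewrite stairE => /andP[h1 h2] ny; apply/eqP; rewrite eq_le h2 /=.
have : (Num.floor y < Num.ceil y)%R.
  rewrite -(ltr_int R) lt_neqAle (le_trans (floor_le _) (ceil_ge _)) andbT.
  apply/eqP => e; case/negP: ny.
  have -> : y = (Num.floor y)%:~R.
    by have := floor_le y; have := ceil_ge y; rewrite -e; lra.
  by rewrite intr_int.
by rewrite -lezD1 -(ler_int R) intrD; lra.
Qed.

Lemma stair_int s y : y \is a Num.int -> y - 1 <= s <= y -> stair s y.
Proof.
move=> iy /andP[h1 h2]; rewrite stairE.
by move: iy => /intrP[m e]; rewrite e intrKceil intrKfloor -e h1 h2.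
Qed.

Lemma stair_floor y : stair (Num.floor y)%:~R y.
Proof.
rewrite /stair intrKceil intrKfloor floor_le /=.
by have /andP[_] := floor_itv y; rewrite intrD => /ltW.
Qed.

Lemma stair_ceil s : stair s (Num.ceil s)%:~R.
Proof.
rewrite /stair lexx /=; have /andP[h _] := ceil_itv s.
have : (Num.ceil s - 1 <= Num.floor s)%R by rewrite floor_ge_int ltW.
by rewrite -(ler_int R) intrB; lra.
Qed.

Lemma stair_shift s y (m : int) : stair s y -> stair (s + m%:~R) (y + m%:~R).
Proof. by rewrite /stair ceilDrz ?intr_int // floorDrz ?intr_int // !intrKfloor !intrKceil !intrD
  => /andP[? ?]; apply/andP; split; lra. Qed.

Lemma stair_convex s s' y (t : R) : 0 <= t <= 1 -> stair s y -> stair s' y ->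
  stair (s + t * (s' - s)) y.
Proof.
rewrite !stairE => /andP[t0 t1] /andP[h1 h2] /andP[h3 h4].
by apply/andP; split; nra.
Qed.

End Stair.

(** A closed graph; d is the distance from y to the other integers. *)
Lemma stair_usc (R : realType) (y : R) : exists2 d, 0 < d &
  forall s z, `|z - y| < d -> stair s z -> stair s y.
Proof.
have g1 : 0 < (Num.floor y)%:~R + 1 - y.
  by have /andP[_] := floor_itv y; rewrite intrD; lra.
have g2 : 0 < y - ((Num.ceil y)%:~R - 1).
  by have /andP[+ _] := ceil_itv y; rewrite intrB; lra.
exists (Num.min ((Num.floor y)%:~R + 1 - y) (y - ((Num.ceil y)%:~R - 1))).
  by rewrite lt_min g1 g2.
move=> s z; rewrite lt_min !ltr_norml !stairE => /andP[/andP[h1 h2] /andP[h3 h4]].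
move=> /andP[h5 h6]; apply/andP; split.
  have : (Num.ceil y - 1 < Num.ceil z)%R by rewrite ceil_gt_int intrB; lra.
  by rewrite -lezD1 subrK -(ler_int R); lra.
have : (Num.floor z < Num.floor y + 1)%R by rewrite floor_lt_int intrD; lra.
by rewrite ltzD1 -(ler_int R); lra.
Qed.

Lemma stair_pos (R : realType) (s s' y y' : R) : stair s y -> stair s' y' -> 0 <= (s - s') * (y - y').
Proof.
move=> h h'; have [lt|lt|->] := ltrgtP y y'; last by rewrite subrr mulr0.
  by have := stair_mono h h' lt; nra.
by have := stair_mono h' h lt; nra.
Qed.

Lemma fin_min_pos (R : realType) (P : 'I_4 -> R -> Prop) :
  (forall k, exists2 d, 0 < d & P k d) ->
  (forall k d d', d' <= d -> P k d -> P k d') ->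
  exists2 d, 0 < d & forall k, P k d.
Proof.
move=> h mon; have [f f0 fP] : exists2 f : 'I_4 -> R, (forall k, 0 < f k) & forall k, P k (f k).
  have /choice[f hf] : forall k, exists d, 0 < d /\ P k d by move=> k; have [d] := h k; exists d.
  by exists f => k; case: (hf k).
exists (\big[Num.min/1]_k f k); first by apply: lt_bigmin.
by move=> k; apply: mon (fP k); apply: bigmin_le_cond.
Qed.

Section StairSum.
Variables (R : realType) (J : pred 'I_4) (al be ga : 'I_4 -> R).
Let yk k (t : R) := al k + be k * t.

(** Intermediate values for t |-> \sum_(k | J k) ga k * stair (yk k t), whose values are
    intervals: at the infimum of the t where the upper values are at least tau, the
    interval contains tau. *)
Lemma stair_ivt (tau : R) :
  (exists t, tau <= \sum_(k | J k) ga k * (Num.floor (yk k t))%:~R) ->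
  (exists B, forall t, tau <= \sum_(k | J k) ga k * (Num.floor (yk k t))%:~R -> B <= t) ->
  exists (t : R) (s : 'I_4 -> R), (forall k, stair (s k) (yk k t)) /\
    \sum_(k | J k) ga k * s k = tau.
Proof.
move=> [t1 ht1] [B hB].
pose M t := \sum_(k | J k) ga k * (Num.floor (yk k t))%:~R.
pose S := [set t | tau <= M t].
have iS : has_inf S by split; [exists t1|exists B => t /hB].
pose t0 := inf S.
have [d d0 hd] : exists2 d, 0 < d &
    forall k t, `|t - t0| < d -> stair (Num.floor (yk k t))%:~R (yk k t0).
  apply: (@fin_min_pos R (fun k d => forall t, `|t - t0| < d -> stair (Num.floor (yk k t))%:~R (yk k t0))).
    move=> k; have [d d0 hd] := stair_usc (yk k t0).
    have b0 : 0 < `|be k| + 1 by rewrite ltr_wpDl.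
    exists (d / (`|be k| + 1)); first by rewrite divr_gt0.
    move=> t; rewrite ltr_pdivlMr // => ht; apply: hd (stair_floor _).
    have -> : yk k t - yk k t0 = (t - t0) * be k by rewrite /yk; ring.
    by rewrite normrM; apply: le_lt_trans ht; rewrite ler_wpM2l // lerDl.
  by move=> k d d' dd h t ht; apply: h; apply: lt_le_trans dd.
have [t St tl] := inf_adherent d0 iS.
have t0t : t0 <= t by apply: ge_inf => //; case: iS.
pose t' := t0 - d / 2.
have nS : M t' < tau.
  rewrite ltNge; apply/negP => h; have : t0 <= t' by apply: ge_inf => //; case: iS.
  by rewrite /t'; lra.
pose s1 k : R := (Num.floor (yk k t'))%:~R; pose s2 k : R := (Num.floor (yk k t))%:~R.
pose th := (tau - M t') / (M t - M t').
have Mt : tau <= M t by [].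
have den : 0 < M t - M t' by lra.
exists t0, (fun k => s1 k + th * (s2 k - s1 k)); split.
  move=> k; apply: stair_convex.
  - rewrite /th divr_ge0 ?ler_pdivrMr //=; try lra; rewrite ler_pdivrMr //; lra.
  - by apply: hd; rewrite /t' ltr_norml; apply/andP; split; lra.
  - by apply: hd; rewrite ltr_norml; apply/andP; split; lra.
have -> : \sum_(k | J k) ga k * (s1 k + th * (s2 k - s1 k)) = M t' + th * (M t - M t').
  rewrite /M mulrBr !mulr_sumr -sumrB -big_split /=; apply: eq_bigr => k _.
  rewrite /s1 /s2; ring.
by rewrite /th mulfVK ?gt_eqF //; lra.
Qed.

End StairSum.

Lemma stair_ivt_linear (R : realType) (J : pred 'I_4) (al be ga : 'I_4 -> R) (tau : R) :
  0 < \sum_(k | J k) ga k * be k ->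
  exists (t : R) (s : 'I_4 -> R), (forall k, stair (s k) (al k + be k * t)) /\
    \sum_(k | J k) ga k * s k = tau.
Proof.
set b := \sum_(k | J k) _ => b0.
pose a := \sum_(k | J k) ga k * al k; pose K := \sum_(k | J k) `|ga k|.
have main t : `|\sum_(k | J k) ga k * (Num.floor (al k + be k * t))%:~R - (a + b * t)| <= K.
  rewrite /a /b mulr_suml -big_split -sumrB /= (le_trans (ler_norm_sum _ _ _)) //.
  apply: ler_sum => k _.
  have -> : ga k * (Num.floor (al k + be k * t))%:~R - (ga k * al k + ga k * be k * t) =
    ga k * ((Num.floor (al k + be k * t))%:~R - (al k + be k * t)) by ring.
  rewrite normrM -[X in _ <= X]mulr1 ler_wpM2l // ler_norml.
  have /andP[h1 h2] := floor_itv (al k + be k * t).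
  by move: h1 h2; rewrite intrD; set F := _%:~R => h1 h2; apply/andP; split; lra.
apply: stair_ivt.
  exists ((tau - a + K) / b); have := main ((tau - a + K) / b).
  by rewrite [b * _]mulrC mulfVK ?gt_eqF // ler_norml => /andP[h1 h2]; lra.
exists ((tau - a - K) / b) => t ht; rewrite ler_pdivrMr //.
by have := main t; rewrite ler_norml => /andP[h1 h2]; lra.
Qed.

(** The intersection of two integer intervals of length at most one is again such an
    interval, of length one only if both are equal. *)
Lemma box_meet (m m' d d' : int) : d = 0 \/ d = 1 -> d' = 0 \/ d' = 1 ->
  m <= m' + d' -> m' <= m + d ->
  let N := if m <= m' then m' else m in
  let F : int := [&& m == m', d == 1 & d' == 1]%:R in
  (N + F = m + d \/ N + F = m' + d') /\
  [/\ m <= N, m' <= N, N + F <= m + d & N + F <= m' + d'].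
Proof.
move=> hd hd' h h'.
have e (b : bool) : (b%:R : int) = if b then 1 else 0 by case: b.
cbv zeta; rewrite e.
have [->|ne] := eqVneq m m'; rewrite ?lexx.
  by case: hd => ->; case: hd' => -> /=; split; [lia|split; lia|lia|split; lia|lia|split; lia|lia|split; lia].
case: (leP m m') => hm /=; case: hd h h' => ->; case: hd' => -> h h';
  split; [lia|split; lia|lia|split; lia|lia|split; lia|lia|split; lia|
          lia|split; lia|lia|split; lia|lia|split; lia|lia|split; lia].
Qed.

(** * Canonical tilings *)
Section Cut.
Variables (R : realType) (v : 'I_4 -> 'rV[R]_2) (L : 'M[R]_(2, 4)) (c : 'I_4 -> R).
Hypothesis vcross : forall i j, i != j -> cross (v i) (v j) != 0.
Hypothesis LA : L *m dirmx v = 1%:M.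
Hypothesis sgn : forall i j, 0 <= cross (v i) (v j) * grass L i j.
Implicit Types (x u d : 'rV[R]_2) (s a : 'rV[R]_4).

Local Notation A := (dirmx v).
Local Notation e_ k := (basis_vec R k : 'rV[R]_4).
Definition lf (x : 'rV[R]_2) k : R := (x *m L) 0 k.
Definition level x k : R := lf x k + c k.

(* genericity of the shift: a grid line exists only in a nontrivial family, two grid
   lines of different families through a point are not parallel, and no three grid
   lines of different families are concurrent *)
Hypothesis gen1 : forall x i, level x i \is a Num.int -> exists u, lf u i != 0.
Hypothesis gen2 : forall x i j, i != j -> level x i \is a Num.int ->
  level x j \is a Num.int -> grass L i j != 0.
Hypothesis gen3 : forall x i j k, uniq [:: i; j; k] -> level x i \is a Num.int ->
  level x j \is a Num.int -> level x k \isn't a Num.int.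

Lemma lf_cross i j x u : lf x i * lf u j - lf x j * lf u i = grass L i j * cross x u.
Proof. exact: grass_cross. Qed.

Lemma lfD x u k : lf (x + u) k = lf x k + lf u k.
Proof. by rewrite /lf mulmxDl mxE. Qed.
Lemma lfB x u k : lf (x - u) k = lf x k - lf u k.
Proof. by rewrite /lf mulmxBl !mxE. Qed.
Lemma lfZ t u k : lf (t *: u) k = t * lf u k.
Proof. by rewrite /lf -scalemxAl mxE. Qed.

Lemma lf_eq0 x : (forall k, lf x k = 0) -> x = 0.
Proof.
move=> h; rewrite -(mulA_E x LA) big1 // => k _.
by rewrite -[(x *m L) 0 k]/(lf x k) h scale0r.
Qed.

Lemma relation_single a i : a *m A = 0 -> (forall k, k != i -> a 0 k = 0) -> a = 0.
Proof.
move=> e h; have : a 0 i *: v i = 0.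
  rewrite -e mul_dirE (bigD1 i) //= big1 ?addr0 // => k ki; by rewrite h // scale0r.
move/eqP; rewrite scaler_eq0 (negPf (v_neq0 vcross i)) orbF => /eqP ai.
by apply/rowP => k; rewrite mxE; have [->//|] := eqVneq k i; exact: h.
Qed.

Lemma relation_cross a j : a *m A = 0 -> \sum_k a 0 k * cross (v j) (v k) = 0.
Proof.
move=> e; transitivity (cross (v j) (a *m A)); last by rewrite e /cross !mxE !mulr0 subrr.
by rewrite mul_dirE cross_sumr; apply: eq_bigr => k _; rewrite crossZr.
Qed.

(** In the relation sum_k a_k v_k = 0, crossed with v_j, all the terms have the same
    sign. *)
Lemma relation_side a d j (ka : R) : a *m A = 0 -> ka != 0 ->
  (forall k, 0 <= a 0 k * lf d k) ->
  (forall k, k != j -> a 0 k != 0 -> grass L j k = ka * lf d k /\ lf d k != 0) ->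
  forall k, k != j -> a 0 k = 0.
Proof.
move=> e k0 pos h.
have term k : 0 <= ka * (a 0 k * cross (v j) (v k)).
  have [->|kj] := eqVneq k j; first by rewrite crossxx !mulr0.
  have [->|ak] := eqVneq (a 0 k) 0; first by rewrite mul0r mulr0.
  have [g l] := h _ kj ak.
  have l2 : 0 < lf d k ^+ 2 by rewrite lt_def sqr_ge0 sqrf_eq0 l.
  rewrite -(pmulr_lge0 _ l2).
  have -> : ka * (a 0 k * cross (v j) (v k)) * lf d k ^+ 2 =
     (a 0 k * lf d k) * (cross (v j) (v k) * (ka * lf d k)) by ring.
  by rewrite -g mulr_ge0.
have : \sum_k ka * (a 0 k * cross (v j) (v k)) = 0.
  by rewrite -mulr_sumr relation_cross // mulr0.
move=> /eqP; rewrite psumr_eq0 // => /allP z k kj.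
have := z k (mem_index_enum _); rewrite /= !mulf_eq0 (negPf k0) /=.
by rewrite [cross _ _ == 0]negbTE ?orbF => [/eqP|] //; apply: vcross; rewrite eq_sym.
Qed.

Lemma exists_cross d : d != 0 -> exists u, cross u d = 1.
Proof.
move=> d0; pose q := d 0 0 ^+ 2 + d 0 1 ^+ 2.
have q0 : q != 0.
  apply: contraNneq d0 => /eqP; rewrite paddr_eq0 ?sqr_ge0 // !sqrf_eq0 => /andP[/eqP h0 /eqP h1].
  by apply/eqP/row2P; rewrite mxE.
exists (q^-1 *: \row_k (if k == 0 then d 0 1 else - d 0 0)).
rewrite /cross !mxE /=; move: q0; rewrite /q => q0; by field.
Qed.

(** The monotonicity that makes the tiles cover the plane only once: a relation between
    the v_k whose coefficients have the signs of the lf d k is trivial. If lf d i = 0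
    for some coefficient a_i, then relation_side applies with j = i. Otherwise write
    a_k = b_k lf d k with b_k >= 0; the sum of the nonnegative numbers
    b_i b_k det (v_i, v_k) G_ik vanishes, so that the forms lf^~ k with b_k <> 0 are
    proportional to each other, and relation_side applies with any other form. *)
Lemma relation_zero a d x : a *m A = 0 -> (forall k, 0 <= a 0 k * lf d k) ->
  (forall k, lf d k = 0 -> a 0 k != 0 -> level x k \is a Num.int) -> a = 0.
Proof.
move=> e pos int.
have [d0|d0] := eqVneq d 0.
  have int' k : a 0 k != 0 -> level x k \is a Num.int.
    by apply: int; rewrite d0 /lf mul0mx mxE.
  have only i j : i != j -> a 0 i != 0 -> a 0 j = 0.
    move=> ij ai; apply/eqP/negPn/negP => aj.
    have rest k : k != i -> k != j -> a 0 k = 0.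
      move=> ki kj; apply/eqP/negPn/negP => ak.
      have u : uniq [:: i; j; k] by rewrite /= !inE negb_or ij (eq_sym i) ki (eq_sym j) kj.
      by have := gen3 u (int' _ ai) (int' _ aj); rewrite int'.
    have := relation_cross i e; rewrite (bigD1 i) //= crossxx mulr0 add0r.
    rewrite (bigD1 j) ?(eq_sym j) //= big1 ?addr0; last first.
      by move=> k /andP[ki kj]; rewrite rest // mul0r.
    by move=> /eqP; rewrite mulf_eq0 (negPf aj) (negPf (vcross ij)).
  apply/eqP/negPn/negP => /matrix0Pn[i' [i]]; rewrite ord1 => ai.
  have : a = 0 by apply: (relation_single (i := i)) => // k ki; apply: (only i) => //; rewrite eq_sym.
  by move=> a0; move: ai; rewrite a0 mxE eqxx.
have [[i [di ai]]|none] := EM (exists i, lf d i = 0 /\ a 0 i != 0).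
  have [u ui] := gen1 (int _ di ai).
  have cu : cross u d != 0.
    apply: contraNneq ui => cu.
    have [w wd] := exists_cross d0.
    have -> : u = cross w u *: d.
      have := cross_decomp u (_ : cross w d != 0); rewrite wd => /(_ (oner_neq0 _)) ->.
      by rewrite cu mul0r scale0r add0r !crossE wd !mulr1 divr1.
    by rewrite lfZ di mulr0.
  apply: (relation_single (i := i)) => //.
  apply: (relation_side e (ka := lf u i / cross u d) _ pos).
    by rewrite mulf_neq0 ?invr_eq0.
  move=> k ki ak.
  have dk : lf d k != 0.
    apply/eqP => dk; have g := gen2 (_ : i != k) (int _ di ai) (int _ dk ak).
    have := lf_cross i k u d; rewrite di dk !mulr0 subrr => /esym/eqP.
    by rewrite mulf_eq0 (negPf cu) orbF (negPf (g _)) // eq_sym.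
  split => //; have := lf_cross i k u d; rewrite di mulr0 subr0 => E.
  by rewrite mulrAC E mulfK.
have nz k : a 0 k != 0 -> lf d k != 0.
  by move=> ak; apply/eqP => dk; apply: none; exists k.
have [w wd] := exists_cross d0.
pose b k := a 0 k / lf d k.
have ab k : a 0 k = b k * lf d k.
  have [a0|ak] := eqVneq (a 0 k) 0; first by rewrite /b a0 !mul0r.
  by rewrite /b mulfVK // nz.
have b0 k : 0 <= b k.
  have [l0|l0] := eqVneq (lf d k) 0; first by rewrite /b l0 invr0 mulr0.
  have l2 : 0 < lf d k ^+ 2 by rewrite lt_def sqr_ge0 sqrf_eq0 l0.
  rewrite -(pmulr_lge0 _ l2); have -> : b k * lf d k ^+ 2 = a 0 k * lf d k.
    by rewrite ab; ring.
  exact: pos.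
have bE k : (b k != 0) = (a 0 k != 0) && (lf d k != 0).
  by rewrite /b mulf_eq0 invr_eq0 negb_or.
clearbody b.
have tot : \sum_i \sum_k b i * b k * (cross (v i) (v k) * grass L i k) = 0.
  pose F i k := b i * b k * cross (v i) (v k) * (lf w i * lf d k).
  have F0 : \sum_i \sum_k F i k = 0.
    apply: big1 => i _; transitivity (b i * lf w i * \sum_k a 0 k * cross (v i) (v k)).
      rewrite mulr_sumr; apply: eq_bigr => k _; rewrite /F [a 0 k]ab; ring.
    by rewrite relation_cross // mulr0.
  transitivity (\sum_i \sum_k F i k + \sum_i \sum_k F k i).
    rewrite -big_split /=; apply: eq_bigr => i _; rewrite -big_split /=.
    apply: eq_bigr => k _.
    have := lf_cross i k w d; rewrite wd mulr1 => <-.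
    rewrite /F [cross (v k) (v i)]crossC; ring.
  by rewrite [X in _ + X]exchange_big /= F0 addr0.
have par i k : b i != 0 -> b k != 0 -> i != k -> grass L i k = 0.
  move=> bi bk ik.
  have t0 i' k' : 0 <= b i' * b k' * (cross (v i') (v k') * grass L i' k').
    by rewrite mulr_ge0 // mulr_ge0.
  move: tot => /eqP; rewrite psumr_eq0 => [|i' _]; last exact: sumr_ge0.
  move=> /allP/(_ i (mem_index_enum _)); rewrite /= psumr_eq0 => [|//].
  move=> /allP/(_ k (mem_index_enum _)); rewrite /= !mulf_eq0 (negPf bi) (negPf bk) /=.
  by rewrite (negPf (vcross ik)) => /eqP.
apply/eqP/negPn/negP => /matrix0Pn[i' [i]]; rewrite ord1 => ai.
have di := nz _ ai.
have bi : b i != 0 by rewrite bE ai di.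
pose u := lf w i *: d - lf d i *: w.
have ui : lf u i = 0 by rewrite /u lfB !lfZ; ring.
have cu : cross u d = - lf d i by rewrite /u !crossE wd; ring.
have cu0 : cross u d != 0 by rewrite cu oppr_eq0.
have [j uj] : exists j, lf u j != 0.
  apply/not_existsP => h; have u0 : u = 0.
    by apply: lf_eq0 => k; apply/eqP/negPn/negP/h.
  by move: cu0; rewrite u0 /cross !mxE !mul0r subrr eqxx.
have uk k : b k != 0 -> lf u k = 0.
  move=> bk; have [->//|ki] := eqVneq k i.
  have := lf_cross k i u d; rewrite (par k i) // mul0r ui mul0r subr0.
  by move=> /eqP; rewrite mulf_eq0 (negPf di) orbF => /eqP.
have ij : i != j by apply: contraTneq uj => <-; rewrite ui eqxx.
have : a 0 i = 0.
  apply: (relation_side e (ka := lf u j / cross u d) (j := j) _ pos) => //.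
    by rewrite mulf_neq0 ?invr_eq0.
  move=> k kj ak; split; last exact: nz.
  have bk : b k != 0 by rewrite bE ak nz.
  have := lf_cross j k u d; rewrite (uk k) // mul0r subr0 => E.
  by rewrite mulrAC E mulfK.
by move=> a0; rewrite a0 eqxx in ai.
Qed.

(** De Bruijn's duality: s lies on the stepped surface, in the face, edge or vertex dual
    to the position of x with respect to the grid lines, where a level is an integer. *)
Definition rel s x := forall k, stair (s 0 k) (level x k).

Lemma levelB x u k : level x k - level u k = lf (x - u) k.
Proof. by rewrite /level lfB; ring. Qed.

(** The relation rel is monotone, hence relation_zero applies to s - s'. *)
Lemma rel_inj s x s' x' : rel s x -> rel s' x' -> s *m A = s' *m A -> s = s'.
Proof.
move=> h h' e; apply/eqP; rewrite -subr_eq0; apply/eqP.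
apply: (@relation_zero _ (x - x') x).
- by rewrite mulmxBl e subrr.
- by move=> k; rewrite !mxE -levelB; exact: stair_pos.
- move=> k /eqP; rewrite -levelB subr_eq0 !mxE subr_eq0 => /eqP lk.
  by apply: stair_eq (h k) _; rewrite lk.
Qed.

(** The plane is covered by induction on the set J of the families of grid lines that are
    taken into account. *)
Definition solves (J : pred 'I_4) w s x :=
  [/\ forall k, J k -> stair (s 0 k) (level x k), forall k, ~~ J k -> s 0 k = 0
   & s *m A = w].

(** Again by relation_zero. *)
Lemma solves_mono (J : pred 'I_4) l w s x sg s' x' sg' : ~~ J l ->
  solves J (w - sg *: v l) s x -> solves J (w - sg' *: v l) s' x' ->
  level x l < level x' l -> sg' <= sg.
Proof.
move=> Jl [h z e] [h' z' e'] lt; rewrite leNgt; apply/negP => ltsg.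
pose a := s - s' + (sg - sg') *: e_ l.
have aE k : a 0 k = s 0 k - s' 0 k + (sg - sg') * (k == l)%:R.
  by rewrite /a !mxE eqxx.
have al : a 0 l = sg - sg' by rewrite aE z // z' // eqxx subrr add0r mulr1.
have ak k : k != l -> a 0 k = s 0 k - s' 0 k by move=> kl; rewrite aE (negPf kl) mulr0 addr0.
have : a = 0.
  apply: (@relation_zero _ (x - x') x).
  - rewrite /a mulmxDl mulmxBl e e' -scalemxAl basis_dir.
    by apply/rowP => ?; rewrite !mxE; ring.
  - move=> k; rewrite -levelB; have [->|kl] := eqVneq k l; first by rewrite al; nra.
    rewrite ak //; have [Jk|nJk] := boolP (J k); last by rewrite z // z' // subrr mul0r.
    by apply: stair_pos; [exact: h|exact: h'].
  - move=> k /eqP; rewrite -levelB subr_eq0 => /eqP lk.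
    have [kl|kl] := eqVneq k l; first by move: lt; rewrite -kl lk ltxx.
    rewrite ak // subr_eq0 => ne; have [Jk|nJk] := boolP (J k); last first.
      by move: ne; rewrite z // z' // eqxx.
    by apply: stair_eq (h k Jk) _ ne; rewrite lk; exact: h'.
by move=> /rowP/(_ l); rewrite al mxE; lra.
Qed.

(** The direction of the grid lines of family l. *)
Definition ndir l : 'rV[R]_2 := \row_k (if k == 0 then - L 1 l else L 0 l).

Lemma lf_ndir l k : lf (ndir l) k = grass L l k.
Proof. by rewrite /lf mulL_E !mxE /= /grass; ring. Qed.

Lemma lf_ex l u : lf u l != 0 -> ndir l != 0.
Proof.
apply: contraNneq => n0; have h0 := congr1 (fun w : 'rV[R]_2 => w 0 0) n0.
have h1 := congr1 (fun w : 'rV[R]_2 => w 0 1) n0; move: h0 h1; rewrite !mxE /= => h0 h1.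
by rewrite /lf mulL_E h1 (_ : L 1 l = 0) ?mulr0 ?addr0 //; lra.
Qed.

Lemma lf_base l (r : R) u : lf u l != 0 -> exists x, level x l = r.
Proof.
move=> ul; exists (((r - c l) / lf u l) *: u).
by rewrite /level lfZ mulfVK // subrK.
Qed.

(** Along a grid line of family l, the multivalued map of the families of J is monotone
    in the direction transverse to v_l and unbounded on both sides, so the
    intermediate value theorem applies; the difference with w is a multiple of v_l. *)
Lemma solves_line (J : pred 'I_4) i j l (m : R) w u : J i -> J j -> ~~ J l ->
  grass L i j != 0 -> lf u l != 0 ->
  exists s x sg, solves J (w - sg *: v l) s x /\ level x l = m.
Proof.
move=> Ji Jj Jl gij ul; have [x0 x0l] := lf_base m ul.
have n0 := lf_ex ul.
have b0 : 0 < \sum_(k | J k) cross (v l) (v k) * grass L l k.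
  have [k [Jk gk]] : exists k, J k /\ grass L l k != 0.
    apply/not_existsP => h; have gz k : J k -> lf (ndir l) k = 0.
      by move=> Jk; rewrite lf_ndir; apply/eqP/negPn/negP => gk; apply: (h k).
    have [w' w'd] := exists_cross n0.
    have := lf_cross i j w' (ndir l); rewrite gz // gz // !mulr0 subrr w'd mulr1.
    by move/esym/eqP; rewrite (negPf gij).
  rewrite (bigD1 k) //= ltr_wpDr ?sumr_ge0 // lt_def sgn andbT mulf_neq0 //.
  by apply: vcross; apply: contraNneq Jl => ->.
have [t [s' [hs es]]] := stair_ivt_linear (fun k => level x0 k) (cross (v l) w) b0.
pose s : 'rV[R]_4 := \row_k (if J k then s' k else 0).
pose x := x0 + t *: ndir l.
have lx k : level x k = level x0 k + grass L l k * t.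
  by rewrite /level lfD lfZ lf_ndir; ring.
have cs : cross (v l) (w - s *m A) = 0.
  rewrite crossDr crossNr mul_dirE cross_sumr -es.
  apply/eqP; rewrite subr_eq0 eq_sym; apply/eqP.
  rewrite [RHS]big_mkcond /=; apply: eq_bigr => k _; rewrite mxE crossZr.
  by case: (J k); rewrite ?mul0r // mulrC.
have [k kl] : exists k : 'I_4, k != l.
  by exists i; apply: contraNneq Jl => <-.
pose sg := cross (w - s *m A) (v k) / cross (v l) (v k).
have wE : w - sg *: v l = s *m A.
  have := cross_decomp (w - s *m A) (_ : cross (v l) (v k) != 0).
  rewrite cs mul0r scale0r addr0 -/sg => <-; last by apply: vcross; rewrite eq_sym.
  by rewrite opprB addrC subrK.
exists s, x, sg; split; last by rewrite lx /grass x0l; ring.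
split => [p Jp|p Jp|]; last by rewrite wE.
  by rewrite mxE Jp lx.
by rewrite mxE (negPf Jp).
Qed.

(** The multiples sg N of v_l given by solves_line on the lines of levels N decrease
    with N. At the N where sg crosses its level, either the line of level N carries a
    solution, or one lies strictly between two lines, where the l-th stair is flat. *)
Lemma solves_insert (J : pred 'I_4) i j l : J i -> J j -> ~~ J l ->
  grass L i j != 0 -> (forall w, exists s x, solves J w s x) ->
  forall w, exists s x, solves [predU1 l & J] w s x.
Proof.
move=> Ji Jj Jl gij solv w.
have finish s x sg : solves J (w - sg *: v l) s x -> stair sg (level x l) ->
    exists s x, solves [predU1 l & J] w s x.
  move=> [h z e] st; exists (s + sg *: e_ l), x.
  have sE k : (s + sg *: e_ l) 0 k = s 0 k + sg * (k == l)%:R by rewrite !mxE eqxx.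
  split=> [k|k|].
  - rewrite sE /= => /orP[/eqP ->|Jk]; first by rewrite eqxx mulr1 z // add0r.
    have kl : k != l by apply: contraNneq Jl => <-.
    by rewrite (negPf kl) mulr0 addr0; exact: h.
  - by rewrite sE /= negb_or => /andP[kl Jk]; rewrite (negPf kl) mulr0 addr0 z.
  - by rewrite mulmxDl e -scalemxAl basis_dir subrK.
have [[u ul]|flat] := EM (exists u, lf u l != 0); last first.
  have [s [x h]] := solv (w - (Num.floor (level 0 l))%:~R *: v l).
  apply: finish h _.
  have -> : level x l = level 0 l; last exact: stair_floor.
  have fz y : lf y l = 0 by apply/eqP/negPn/negP => h'; apply: flat; exists y.
  by rewrite /level !fz.
have /choice[F hF] : forall N : int, exists p : 'rV[R]_4 * 'rV[R]_2 * R,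
    solves J (w - p.2 *: v l) p.1.1 p.1.2 /\ level p.1.2 l = N%:~R.
  move=> N; have [s [x [sg h]]] := solves_line N%:~R w Ji Jj Jl gij ul.
  by exists (s, x, sg).
pose sg N := (F N).2.
have sol N : solves J (w - sg N *: v l) (F N).1.1 (F N).1.2 by case: (hF N).
have lev N : level (F N).1.2 l = N%:~R by case: (hF N).
have mono N M : (N < M)%R -> sg M <= sg N.
  by move=> NM; apply: solves_mono Jl (sol N) (sol M) _; rewrite !lev ltr_int.
have [N [hN hN1]] : exists N : int, N%:~R - 1 <= sg N /\ sg (N + 1) < N%:~R.
  pose K : nat := (Num.bound `|sg 0|).+1.
  have bd : `|sg 0| < K%:R - 1.
    by rewrite /K -addn1 natrD addrK; apply: archi_boundP; exact: normr_ge0.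
  move: bd; rewrite ltr_norml => /andP[b1 b2].
  pose P (m : nat) := sg (m%:Z - K%:Z) < (m%:Z - K%:Z)%:~R - 1.
  have exP : exists m, P m.
    exists (K + K)%N; rewrite /P PoszD addrK.
    by apply: le_lt_trans (mono 0 _ _) _; [rewrite /K|rewrite -[Posz K]/(K%:Z) //; rewrite -pmulrn; lra].
  have P0 : ~~ P 0%N.
    rewrite /P sub0r -leNgt; have h := mono (- K%:Z) 0.
    have := h (_ : - K%:Z < 0); rewrite oppr_lt0 => /(_ isT).
    by rewrite intrN -pmulrn; lra.
  case: (ex_minnP exP) => -[|m] Pm minm; first by rewrite Pm in P0.
  exists (m%:Z - K%:Z); have nPm : ~~ P m by apply/negP => /minm; rewrite ltnn.
  split; first by move: nPm; rewrite /P -leNgt.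
  move: Pm; rewrite /P; have -> : m.+1%:Z - K%:Z = m%:Z - K%:Z + 1.
    by rewrite -addn1 PoszD; ring.
  by rewrite intrD addrK.
have [le|gt] := leP (sg N) N%:~R.
  apply: finish (sol N) _; rewrite lev; apply: stair_int; first exact: intr_int.
  by rewrite hN le.
have [s [x h]] := solv (w - N%:~R *: v l); apply: (finish _ _ _ h).
have low : N%:~R <= level x l.
  rewrite leNgt; apply/negP => lt; move: gt; rewrite ltNge => /negP; apply.
  by apply: solves_mono Jl h (sol N) _; rewrite lev.
have high : level x l <= N%:~R + 1.
  rewrite leNgt; apply/negP => lt; move: hN1; rewrite ltNge => /negP; apply.
  by apply: solves_mono Jl (sol (N + 1)) h _; rewrite lev intrD.
by rewrite /stair intrKceil intrKfloor low high.
Qed.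

Lemma grass_neq0 : exists i j, i != j /\ grass L i j != 0.
Proof.
apply/not_existsP => h; have g0 i j : grass L i j = 0.
  have [->|ij] := eqVneq i j; first by rewrite /grass subrr.
  by apply/eqP/negPn/negP => g; apply: (h i); exists j.
have d0 i : ndir i = 0 by apply: lf_eq0 => k; rewrite lf_ndir g0.
have e : delta_mx 0 0 = 0 :> 'rV[R]_2.
  apply: lf_eq0 => k; apply/eqP/negPn/negP => /lf_ex; by rewrite d0 eqxx.
by move: e => /rowP/(_ 0); rewrite !mxE /= => /eqP; rewrite oner_eq0.
Qed.

Lemma solves_base i j : i != j -> grass L i j != 0 ->
  forall w, exists s x, solves (pred2 i j) w s x.
Proof.
move=> ij g w; have cij := vcross ij.
pose si := cross w (v j) / cross (v i) (v j); pose sj := cross (v i) w / cross (v i) (v j).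
pose s : 'rV[R]_4 := si *: e_ i + sj *: e_ j.
have sE k : s 0 k = si * (k == i)%:R + sj * (k == j)%:R by rewrite !mxE !eqxx.
pose p := ((Num.ceil si)%:~R - c i) / - grass L i j.
pose q := ((Num.ceil sj)%:~R - c j) / grass L i j.
pose x := p *: ndir j + q *: ndir i.
have lx k : lf x k = p * grass L j k + q * grass L i k by rewrite lfD !lfZ !lf_ndir.
have gii k : grass L k k = 0 by rewrite /grass subrr.
have li : level x i = (Num.ceil si)%:~R.
  rewrite /level lx gii mulr0 addr0 grassC /p mulfVK ?oppr_eq0 //; ring.
have lj : level x j = (Num.ceil sj)%:~R.
  rewrite /level lx gii mulr0 add0r /q mulfVK //; ring.
exists s, x; split.
- move=> k /orP[/eqP ->|/eqP ->]; rewrite sE eqxx.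
    by rewrite (negPf ij) mulr1 mulr0 addr0 li stair_ceil.
  by rewrite eq_sym (negPf ij) mulr0 add0r mulr1 lj stair_ceil.
- by move=> k /norP[/negPf ki /negPf kj]; rewrite sE ki kj !mulr0 addr0.
- by rewrite mulmxDl -!scalemxAl !basis_dir -cross_decomp.
Qed.

Lemma rel_cover w : exists s x, rel s x /\ s *m A = w.
Proof.
have [i [j [ij g]]] := grass_neq0.
have main n : (n <= 4)%N -> (2 <= n)%N -> exists J : pred 'I_4,
    [/\ J i, J j, #|J| = n & forall w, exists s x, solves J w s x].
  elim: n => // n IH n4; rewrite leq_eqVlt => /orP[/eqP <-|n2].
    exists (pred2 i j); split; rewrite /= ?eqxx ?orbT //; first by rewrite card2 ij.
    exact: solves_base.
  have [J [Ji Jj cJ hJ]] := IH (ltnW n4) n2.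
  have [l Jl] : exists l, ~~ J l.
    apply/existsP; rewrite -negb_forall; apply/negP => /forallP all.
    have : #|J| = 4 by rewrite -[RHS]card_ord; apply: eq_card => k; rewrite !inE; exact: all.
    by rewrite cJ => nE; rewrite nE in n4.
  exists [predU1 l & J]; split; [by apply/orP; right|by apply/orP; right| |].
    rewrite -cJ (cardU1 l J) (_ : (l \in J) = false) //; exact: negbTE Jl.
  exact: solves_insert Ji Jj Jl g hJ.
have [J [_ _ cJ hJ]] := main 4 isT isT.
have [s [x [h _ e]]] := hJ w; exists s, x; split => // k; apply: h.
have := cardC J; rewrite cJ card_ord -[RHS]addn0 => /eqP.
by rewrite eqn_add2l => /eqP/card0_eq/(_ k); rewrite !inE => /negbFE.
Qed.

(** Move along the ray until the first level reaches the end of its interval: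
    no other level has left its own interval by then. *)
Lemma rel_hit s x d k0 : rel s x -> lf d k0 != 0 -> exists t k,
  [/\ rel s (x + t *: d), lf d k != 0 & level (x + t *: d) k \is a Num.int].
Proof.
move=> h dk0.
pose bd k : R := if 0 < lf d k then (Num.floor (s 0 k))%:~R + 1 else (Num.ceil (s 0 k))%:~R.
pose tt k := (bd k - level x k) / lf d k.
have t0 k : lf d k != 0 -> 0 <= tt k.
  move=> dk; have /andP[h1 h2] := h k; rewrite /tt /bd.
  have [d0|d0] := ltP 0 (lf d k); first by rewrite divr_ge0 ?subr_ge0 // ltW.
  by rewrite mulr_le0 ?subr_le0 // invr_le0.
have [k dk min] := @arg_minP _ R _ k0 (fun k => lf d k != 0) tt dk0.
have lx t p : level (x + t *: d) p = level x p + t * lf d p.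
  by rewrite /level lfD lfZ; ring.
exists (tt k), k; split => //; last first.
  rewrite lx /tt mulfVK // [level x k + _]addrC subrK /bd; case: ifP => _; last exact: intr_int.
  by rewrite rpredD ?intr_int ?rpred1.
move=> p; rewrite /stair lx; have /andP[h1 h2] := h p.
have tk := t0 _ dk.
have [dp|dp] := eqVneq (lf d p) 0; first by rewrite dp mulr0 addr0 h1 h2.
have mp := min _ dp.
have e : tt p * lf d p = bd p - level x p by rewrite /tt mulfVK.
have [d0|d0] := ltP 0 (lf d p).
  have : tt k * lf d p <= tt p * lf d p by rewrite ler_pM2r.
  have : 0 <= tt k * lf d p by rewrite mulr_ge0 // ltW.
  by rewrite e /bd d0 => h3 h4; apply/andP; split; lra.
have : tt p * lf d p <= tt k * lf d p by rewrite ler_wnM2r.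
have : tt k * lf d p <= 0 by rewrite mulr_ge0_le0.
by rewrite e /bd ltNge d0 /= => h3 h4; apply/andP; split; lra.
Qed.

Lemma rel_crossing s x : rel s x -> exists x' (i j : 'I_4), [/\ (i < j)%N, rel s x',
  level x' i \is a Num.int & level x' j \is a Num.int].
Proof.
move=> h; have [i0 [j0 [_ g]]] := grass_neq0.
have n0 : lf (ndir i0) j0 != 0 by rewrite lf_ndir.
have [t [i [h1 di i1]]] := rel_hit h n0.
have [j gij] : exists j, grass L i j != 0.
  apply/not_existsP => gz; have := lf_ex di; case/eqP; apply: lf_eq0 => k.
  by rewrite lf_ndir; apply/eqP/negPn/negP/gz.
have dj : lf (ndir i) j != 0 by rewrite lf_ndir.
have [t' [k [h2 dk k2]]] := rel_hit h1 dj.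
have i2 : level (x + t *: ndir i0 + t' *: ndir i) i \is a Num.int.
  rewrite /level lfD lfZ lf_ndir (_ : grass L i i = 0) ?mulr0 ?addr0 //.
  by rewrite /grass subrr.
have ik : i != k by apply: contraNneq dk => <-; rewrite lf_ndir /grass subrr.
have [lt|gt|/val_inj e] := ltngtP i k; last by rewrite e eqxx in ik.
  by exists (x + t *: ndir i0 + t' *: ndir i), i, k.
by exists (x + t *: ndir i0 + t' *: ndir i), k, i.
Qed.

(** The tile dual to the crossing x has its lowest corner in the cell of the
    grid that lies below both lines i and j. *)
Definition corner x i j k : int :=
  if (k == i) || (k == j) then Num.floor (level x k) - 1 else Num.floor (level x k).
Definition introw (m : 'I_4 -> int) : 'rV[R]_4 := \row_k (m k)%:~R.

(** The multigrid dual of de Bruijn: two grid lines cross at x if the levels i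
    and j are both integers there. *)
Definition cut_tiling : set (tile R 4) := [set a | exists (i j : 'I_4) x,
  [/\ (i < j)%N, level x i \is a Num.int, level x j \is a Num.int &
      a = Tile i j (introw (corner x i j) *m A)]].

Lemma crossing_rel x i j (l m : R) : i != j -> level x i \is a Num.int ->
  level x j \is a Num.int -> 0 <= l <= 1 -> 0 <= m <= 1 ->
  rel (introw (corner x i j) + (l *: e_ i + m *: e_ j)) x.
Proof.
move=> ij ii jj /andP[l0 l1] /andP[m0 m1] k; rewrite !mxE !eqxx /= /corner.
have [->|ki] := eqVneq k i.
  rewrite (negPf ij) /= mulr1 mulr0 addr0 intrB floorK //; apply: stair_int => //.
  by apply/andP; split; lra.
have [->|kj] := eqVneq k j.
  rewrite /= mulr1 mulr0 add0r intrB floorK //; apply: stair_int => //.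
  by apply/andP; split; lra.
by rewrite /= !mulr0 !addr0; exact: stair_floor.
Qed.

Lemma crossing_face x i j s : i != j -> level x i \is a Num.int ->
  level x j \is a Num.int -> rel s x ->
  exists l m : R, [/\ 0 <= l <= 1, 0 <= m <= 1 &
    s = introw (corner x i j) + (l *: e_ i + m *: e_ j)].
Proof.
move=> ij ii jj h.
exists (s 0 i - level x i + 1), (s 0 j - level x j + 1).
have /andP[h1 h2] := stair_bound (h i); have /andP[h3 h4] := stair_bound (h j).
split; [apply/andP; split; lra|apply/andP; split; lra|].
apply/rowP => k; rewrite !mxE !eqxx /= /corner.
have [->|ki] := eqVneq k i.
  by rewrite (negPf ij) /= mulr1 mulr0 addr0 intrB floorK //; ring.
have [->|kj] := eqVneq k j.
  by rewrite /= mulr1 mulr0 add0r intrB floorK //; ring.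
rewrite /= !mulr0 !addr0; apply: stair_nint (h k) _.
by apply: gen3 ii jj; rewrite /= !inE negb_or ij eq_sym ki eq_sym kj.
Qed.

Lemma cut_supp i j x z : i != j -> level x i \is a Num.int -> level x j \is a Num.int ->
  tile_supp v (Tile i j (introw (corner x i j) *m A)) z <->
  exists2 s, rel s x & s *m A = z.
Proof.
move=> ij ii jj; split.
  move=> [l [m [hl hm ->]]].
  exists (introw (corner x i j) + (l *: e_ i + m *: e_ j)); first exact: crossing_rel.
  by rewrite !mulmxDl -!scalemxAl !basis_dir.
move=> [s h <-]; have [l [m [hl hm ->]]] := crossing_face ij ii jj h.
by exists l, m; split => //; rewrite !mulmxDl -!scalemxAl !basis_dir.
Qed.

Definition side (i j k : 'I_4) : int := if (k == i) || (k == j) then 1 else 0.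

Lemma face_box x i j s : i != j -> level x i \is a Num.int -> level x j \is a Num.int ->
  rel s x <-> forall k, (corner x i j k)%:~R <= s 0 k <= (corner x i j k + side i j k)%:~R.
Proof.
move=> ij ii jj; split.
  move=> h k; have [l [m [/andP[l0 l1] /andP[m0 m1] ->]]] := crossing_face ij ii jj h.
  rewrite !mxE !eqxx /= intrD /side.
  have [->|ki] := eqVneq k i.
    by rewrite (negPf ij) /= mulr1 mulr0 addr0; apply/andP; split; lra.
  have [->|kj] := eqVneq k j.
    by rewrite /= mulr1 mulr0 add0r; apply/andP; split; lra.
  by rewrite /= !mulr0 !addr0 lexx.
move=> h.
have -> : s = introw (corner x i j) + ((s 0 i - (corner x i j i)%:~R) *: e_ i +
     (s 0 j - (corner x i j j)%:~R) *: e_ j).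
  apply/rowP => k; rewrite !mxE !eqxx /=.
  have [->|ki] := eqVneq k i.
    by rewrite (negPf ij) /= mulr1 mulr0 addr0 addrC subrK.
  have [->|kj] := eqVneq k j.
    by rewrite /= mulr1 mulr0 add0r addrC subrK.
  have := h k; rewrite /side (negPf ki) (negPf kj) addr0 !mulr0 !addr0 => /andP[h1 h2].
  by apply/eqP; rewrite eq_le h1 h2.
apply: crossing_rel => //.
  by have := h i; rewrite /side eqxx intrD => /andP[h1 h2]; apply/andP; split; lra.
by have := h j; rewrite /side eqxx orbT intrD => /andP[h1 h2]; apply/andP; split; lra.
Qed.

Lemma box_vertexE (m N : 'I_4 -> int) i j : i != j ->
  (forall k, m k <= N k <= m k + side i j k)%R ->
  introw N = introw m + ((N i != m i)%:R *: e_ i + (N j != m j)%:R *: e_ j).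
Proof.
move=> ij h; apply/rowP => k; rewrite !mxE !eqxx /=; have := h k; rewrite /side.
have [->|ki] := eqVneq k i.
  rewrite (negPf ij) /= mulr1 mulr0 addr0 => hi.
  have [->|ne] := eqVneq (N i) (m i); first by rewrite addr0.
  have -> : N i = m i + 1 by lia.
  by rewrite intrD.
have [->|kj] := eqVneq k j.
  rewrite /= mulr1 mulr0 add0r => hj.
  have [->|ne] := eqVneq (N j) (m j); first by rewrite addr0.
  have -> : N j = m j + 1 by lia.
  by rewrite intrD.
by rewrite /= !mulr0 !addr0 => hk; congr (_%:~R); lia.
Qed.

Lemma vertex_of_box (m N : 'I_4 -> int) i j : i != j ->
  (forall k, m k <= N k <= m k + side i j k)%R ->
  tile_vertex v (Tile i j (introw m *m A)) (introw N *m A).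
Proof.
move=> ij h; exists (N i != m i), (N j != m j).
by rewrite (box_vertexE ij h) !mulmxDl -!scalemxAl !basis_dir.
Qed.

Lemma edge_of_box (m N : 'I_4 -> int) i j k : i != j ->
  (forall k, m k <= N k <= m k + side i j k)%R -> (k == i) || (k == j) -> N k = m k ->
  tile_edge v (Tile i j (introw m *m A)) (introw N *m A) k.
Proof.
move=> ij h kij Nk.
rewrite (box_vertexE ij h) !mulmxDl -!scalemxAl !basis_dir.
case/orP: kij Nk => /eqP -> ->; rewrite eqxx /= scale0r ?add0r ?addr0; [left|right].
  by split => //; case: (N j != m j); rewrite /= ?scale1r ?scale0r ?addr0; [right|left].
by split => //; case: (N i != m i); rewrite /= ?scale1r ?scale0r ?addr0; [right|left].
Qed.

(** By rel_inj the intersection of two tiles lifts to the intersection of two faces of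
    the integer lattice, which is computed coordinatewise by box_meet. *)
Lemma cut_tiling_edge (a b : tile R 4) : cut_tiling a -> cut_tiling b -> a <> b ->
    tile_supp v a `&` tile_supp v b !=set0 ->
    (exists p, [/\ tile_vertex v a p, tile_vertex v b p &
       tile_supp v a `&` tile_supp v b = [set p]]) \/
    (exists y k, [/\ tile_edge v a y k, tile_edge v b y k &
       tile_supp v a `&` tile_supp v b = segment v y k]).
Proof.
move=> [i [j [x [lij ii jj ->]]]] [i' [j' [x' [lij' ii' jj' ->]]]] nab.
have ij : i != j by rewrite neq_ltn lij.
have ij' : i' != j' by rewrite neq_ltn lij'.
set m := corner x i j in nab *; set m' := corner x' i' j' in nab *.
pose d := side i j; pose d' := side i' j'.
pose common s := forall k, (m k)%:~R <= s 0 k <= (m k + d k)%:~R /\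
  (m' k)%:~R <= s 0 k <= (m' k + d' k)%:~R.
have both z : (tile_supp v (Tile i j (introw m *m A)) `&`
    tile_supp v (Tile i' j' (introw m' *m A))) z <-> exists2 s, common s & s *m A = z.
  split.
    move=> [/(cut_supp _ ij ii jj)[s h e] /(cut_supp _ ij' ii' jj')[s' h' e']].
    exists s => // k; have ss : s = s' by apply: rel_inj h h' _; rewrite e e'.
    split; first exact: (proj1 (face_box s ij ii jj) h).
    by rewrite ss; exact: (proj1 (face_box s' ij' ii' jj') h').
  move=> [s h e]; split; [apply/(cut_supp _ ij ii jj)|apply/(cut_supp _ ij' ii' jj')];
    exists s => //.
    by apply: (proj2 (face_box s ij ii jj)) => k; case: (h k).
  by apply: (proj2 (face_box s ij' ii' jj')) => k; case: (h k).
move=> [z0 /both[s0 h0 _]].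
pose N k : int := if m k <= m' k then m' k else m k.
pose fr k := [&& m k == m' k, d k == 1 & d' k == 1].
have d01 k : d k = 0 \/ d k = 1 by rewrite /d /side; case: ifP; [right|left].
have d01' k : d' k = 0 \/ d' k = 1 by rewrite /d' /side; case: ifP; [right|left].
have meet k : (m k <= m' k + d' k)%R /\ (m' k <= m k + d k)%R.
  have [/andP[h1 h2] /andP[h3 h4]] := h0 k.
  by rewrite -!(ler_int R); split; [apply: le_trans h1 h4|apply: le_trans h3 h2].
have bm k := box_meet (d01 k) (d01' k) (proj1 (meet k)) (proj2 (meet k)).
have Nm k : (m k <= N k <= m k + d k)%R.
  have [_ [h1 _ h2 _]] := bm k; rewrite h1 /=; apply: le_trans h2.
  by rewrite lerDl; case: [&& _, _ & _].
have Nm' k : (m' k <= N k <= m' k + d' k)%R.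
  have [_ [_ h1 _ h2]] := bm k; rewrite h1 /=; apply: le_trans h2.
  by rewrite lerDl; case: [&& _, _ & _].
have comE s : common s <-> forall k, (N k)%:~R <= s 0 k <= (N k)%:~R + (fr k)%:R.
  have cE k : (N k)%:~R + (fr k)%:R = (N k + (fr k)%:R)%:~R :> R.
    by rewrite intrD; case: (fr k).
  split=> h k.
    have [/andP[h1 h2] /andP[h3 h4]] := h k.
    have [hN _] := bm k.
    apply/andP; split; first by rewrite /N; case: ifP.
    by rewrite cE; case: hN => ->.
  have := h k; rewrite cE => /andP[h1 h2].
  have [_ [h3 h4 h5 h6]] := bm k; rewrite -/(N k) -/(fr k) in h3 h4 h5 h6.
  move: h3 h4 h5 h6; rewrite -!(ler_int R) => ? ? ? ?.
  by split; apply/andP; split; lra.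
have frij k : fr k -> (k == i) || (k == j).
  by case/and3P => _ + _; rewrite /d /side; case: ifP.
have frij' k : fr k -> (k == i') || (k == j').
  by case/and3P => _ _; rewrite /d' /side; case: ifP.
have notboth : ~~ (fr i && fr j).
  apply/negP => /andP[fi fj]; apply: nab.
  have := frij' _ fi; have := frij' _ fj.
  have [e1 e2] : i = i' /\ j = j'.
    move: (frij' _ fi) (frij' _ fj).
    case/orP => /eqP e1; case/orP => /eqP e2; subst => //; move: lij lij' ij; rewrite ?ltnn ?eqxx //.
    by move=> l1 l2; rewrite ltnNge ltnW in l2.
  have mm : m =1 m'.
    move=> k; have [/orP[/eqP->|/eqP->]|nk] := boolP ((k == i) || (k == j)).
    - by case/and3P: fi => /eqP.
    - by case/and3P: fj => /eqP.
    have := meet k; rewrite /d /d' /side -e1 -e2 (negPf nk) !addr0 => -[h1 h2].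
    by apply/eqP; rewrite eq_le h1 h2.
  move=> _ _; rewrite e1 e2; congr (Tile _ _ (_ *m _)).
  by apply/rowP => k; rewrite !mxE mm.
have seg k : fr k -> (forall p, fr p -> p = k) ->
    (exists y k, [/\ tile_edge v (Tile i j (introw m *m A)) y k,
      tile_edge v (Tile i' j' (introw m' *m A)) y k &
      tile_supp v (Tile i j (introw m *m A)) `&`
      tile_supp v (Tile i' j' (introw m' *m A)) = segment v y k]).
  move=> fk only; exists (introw N *m A), k; split.
  - apply: edge_of_box ij Nm (frij _ fk) _.
    by case/and3P: fk => /eqP e _ _; rewrite /N -e lexx.
  - apply: edge_of_box ij' Nm' (frij' _ fk) _.
    by case/and3P: fk => /eqP e _ _; rewrite /N e lexx.
  apply/seteqP; split => z.
    move=> /both[s /comE h <-]; exists (s 0 k - (N k)%:~R); split.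
      by have := h k; rewrite fk /= => /andP[? ?]; apply/andP; split; lra.
    rewrite -basis_dir scalemxAl -mulmxDl; congr (_ *m _).
    apply/rowP => p; rewrite !mxE !eqxx /=; have [->|pk] := eqVneq p k.
      by rewrite mulr1 addrC subrK.
    have := h p; rewrite (_ : fr p = false); last by apply: contraNF pk => /only ->.
    by rewrite mulr0 !addr0 => h'; apply/eqP; rewrite eq_le andbC.
  move=> [l [/andP[l0 l1] ->]]; apply/both; exists (introw N + l *: e_ k); last first.
    by rewrite mulmxDl -scalemxAl basis_dir.
  apply/comE => p; rewrite !mxE !eqxx /=; have [->|pk] := eqVneq p k.
    by rewrite fk /= mulr1; apply/andP; split; lra.
  by rewrite mulr0 addr0 lexx lerDl ler0n.
have [fi|nfi] := boolP (fr i).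
  right; apply: (seg i) => // p fp; case/orP: (frij _ fp) => /eqP // e.
  by move: notboth; rewrite -e fi fp.
have [fj|nfj] := boolP (fr j).
  right; apply: (seg j) => // p fp; case/orP: (frij _ fp) => /eqP // e.
  by rewrite e (negPf nfi) in fp.
have nof p : fr p = false.
  by apply/negP => fp; case/orP: (frij _ fp) => /eqP e; move: fp; rewrite e ?(negPf nfi) ?(negPf nfj).
left; exists (introw N *m A); split; [exact: vertex_of_box ij Nm|exact: vertex_of_box ij' Nm'|].
apply/seteqP; split => z.
  move=> /both[s /comE h <-] /=; congr (_ *m _); apply/rowP => p; rewrite !mxE.
  by have := h p; rewrite nof addr0 => h'; apply/eqP; rewrite eq_le andbC.
move=> /= ->; apply/both; exists (introw N) => //; apply/comE => p.
by rewrite nof addr0 !mxE lexx.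
Qed.

Lemma interior_segment (S : set 'rV[R]_2) (y z : 'rV[R]_2) k :
  S `<=` segment v y k -> interior S z -> False.
Proof.
move=> Sy; rewrite /interior /= -nbhs_nbhs_norm => -[d /= d0 hd].
pose i : 'I_4 := if k == 0 then 1 else 0.
have ki : k != i by rewrite /i; case: (k =P 0) => [->//|/eqP].
have V0 : 0 < `|v i| + 1 by rewrite ltr_wpDl.
pose e := d / (`|v i| + 1); have e0 : 0 < e by rewrite divr_gt0.
have in0 : S z by apply: hd; rewrite /ball_ /= subrr normr0.
have in1 : S (z + e *: v i).
  apply: hd; rewrite /ball_ /= opprD addrA subrr sub0r normrN normrZ gtr0_norm //.
  rewrite /e mulrAC ltr_pdivrMr // ltr_pM2l // ltrDl //.
have [l [_ e1]] := Sy _ in0; have [m [_ e2]] := Sy _ in1.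
have : cross (v k) (e *: v i) = 0.
  have -> : e *: v i = (m - l) *: v k.
    rewrite -[LHS](addKr z) e2 {1}e1; apply/rowP => ?; rewrite !mxE; ring.
  by rewrite crossZr crossxx mulr0.
by move/eqP; rewrite crossZr mulf_eq0 (negPf (vcross ki)) orbF gt_eqF.
Qed.

(** As tiles meet along segments or points, their interiors are disjoint. *)
Lemma cut_tiling_rhombus : rhombus_tiling v cut_tiling.
Proof.
split; last exact: cut_tiling_edge.
- by move=> a [i [j [x [ij _ _ ->]]]].
- apply/seteqP; split => // w _; have [s [x [h e]]] := rel_cover w.
  have [x' [i [j [ij h' ii jj]]]] := rel_crossing h.
  exists (Tile i j (introw (corner x' i j) *m A)); first by exists i, j, x'.
  by apply/cut_supp => //; [rewrite neq_ltn ij|exists s].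
- move=> a b Ta Tb nab; apply/seteqP; split => // z; rewrite -interiorI => hz.
  have ne : tile_supp v a `&` tile_supp v b !=set0.
    by exists z; exact: interior_subset hz.
  have [[p [_ _ E]]|[y [k [_ _ E]]]] := cut_tiling_edge Ta Tb nab ne.
    apply: (@interior_segment _ p z 0 _ hz); rewrite E => _ ->.
    by exists 0; rewrite lexx ler01 scale0r addr0.
  by apply: (@interior_segment _ y z k _ hz); rewrite E.
Qed.

Definition cut_height w : 'rV[R]_4 := sval (cid (rel_cover w)).

Lemma cut_heightP w : exists x, rel (cut_height w) x /\ cut_height w *m A = w.
Proof. by rewrite /cut_height; case: cid => s. Qed.

Lemma cut_heightE s x : rel s x -> cut_height (s *m A) = s.
Proof. by move=> h; have [x' [h' e]] := cut_heightP (s *m A); exact: rel_inj h' h e. Qed.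

Definition cut_lift (w0 w : 'rV[R]_2) : 'rV[R]_4 := cut_height w - cut_height w0.

Lemma cut_lift_edge (a : tile R 4) y k : cut_tiling a -> tile_edge v a y k ->
  cut_height (y + v k) = cut_height y + e_ k.
Proof.
move=> [i [j [x [lij ii jj ->]]]] /= h.
have ij : i != j by rewrite neq_ltn lij.
set m := introw _ in h.
have hm (b c' : bool) : rel (m + (b%:R *: e_ i + c'%:R *: e_ j)) x.
  by apply: crossing_rel => //; [case: b|case: c']; rewrite /= ?lexx ?ler01.
have hh (b c' : bool) : cut_height (m *m A + (b%:R *: v i + c'%:R *: v j)) =
    m + (b%:R *: e_ i + c'%:R *: e_ j).
  by rewrite -(cut_heightE (hm b c')) !mulmxDl -!scalemxAl !basis_dir.
have h00 := hh false false; have h10 := hh true false; have h01 := hh false true; have h11 := hh true true.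
rewrite /= !scale0r !scale1r !addr0 !add0r in h00 h10 h01 h11.
case: h => [[-> [->|->]]|[-> [->|->]]]; rewrite ?h00 ?h10 ?h01 ?h11 //.
  by rewrite -!addrA [v j + _]addrC h11 [e_ j + _]addrC.
by rewrite -!addrA h11.
Qed.

Lemma cut_liftP (a0 : tile R 4) : cut_tiling a0 -> is_lift v cut_tiling (cut_lift (tile_pos a0)).
Proof.
move=> Ta0; split.
  by exists a0, (tile_pos a0); rewrite /cut_lift subrr; split => //; exact: tile_pos_vertex.
by move=> a y k Ta ak; rewrite /cut_lift (cut_lift_edge Ta ak) addrAC.
Qed.

(** An integer point of the surface is in relation with a crossing, by rel_crossing. *)
Lemma cut_vtxP y : vtx v cut_tiling y <->
  exists s x, [/\ rel s x, forall k, s 0 k \is a Num.int & s *m A = y].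
Proof.
split.
  move=> [a [i [j [x [lij ii jj ->]]]] [b [c' ->]]].
  have ij : i != j by rewrite neq_ltn lij.
  exists (introw (corner x i j) + (b%:R *: e_ i + c'%:R *: e_ j)), x; split.
  - by apply: crossing_rel => //; [case: b|case: c']; rewrite /= ?lexx ?ler01.
  - move=> k; rewrite !mxE /= -!natrM; apply: rpredD; first exact: intr_int.
    by apply: rpredD; rewrite -[_%:R]/(_%:Z%:~R) intr_int.
  - by rewrite !mulmxDl -!scalemxAl !basis_dir.
move=> [s [x [h si <-]]]; have [x' [i [j [lij h' ii jj]]]] := rel_crossing h.
have ij : i != j by rewrite neq_ltn lij.
pose N k := Num.floor (s 0 k).
have sN : s = introw N by apply/rowP => k; rewrite mxE /N floorK.
exists (Tile i j (introw (corner x' i j) *m A)); first by exists i, j, x'.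
rewrite sN; apply: vertex_of_box => // k.
have := proj1 (face_box s ij ii jj) h' k; rewrite sN mxE !ler_int => /andP[-> ->] //.
Qed.

Lemma cut_vtx_height y : vtx v cut_tiling y -> exists x,
  [/\ rel (cut_height y) x, forall k, cut_height y 0 k \is a Num.int & cut_height y *m A = y].
Proof.
move=> /cut_vtxP[s [x [h si <-]]]; rewrite (cut_heightE h); by exists x.
Qed.

(** The vector u L of the slope, whose entries off the l-th one are integers, is a
    period of the shadow that forgets this coordinate. The l-th coordinate of the image
    of a vertex is then corrected by tau to become an integer of the strip. *)
Lemma cut_period y u l : vtx v cut_tiling y ->
  (forall k, k != l -> lf u k \is a Num.int) ->
  exists y' (tau : R), [/\ vtx v cut_tiling y', `|tau| <= 1 &
    cut_height y' = cut_height y + u *m L + tau *: e_ l].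
Proof.
move=> /cut_vtx_height[x [h si e]] ui.
pose s := cut_height y.
pose s' : 'rV[R]_4 := \row_k (if k == l then (Num.floor (level (x + u) l))%:~R else s 0 k + lf u k).
have lx k : level (x + u) k = level x k + lf u k by rewrite /level lfD; ring.
have h' : rel s' (x + u).
  move=> k; rewrite mxE; have [->|kl] := eqVneq k l; first exact: stair_floor.
  rewrite lx; have /intrP[m ->] := ui _ kl; apply: stair_shift; exact: h.
have si' k : s' 0 k \is a Num.int.
  have -> : s' 0 k = if k == l then (Num.floor (level (x + u) l))%:~R else s 0 k + lf u k.
    by rewrite mxE.
  case: ifP => kl; first exact: intr_int.
  by apply: rpredD; [exact: si|apply: ui; rewrite kl].
exists (s' *m A), (s' 0 l - s 0 l - lf u l); split.
- by apply/cut_vtxP; exists s', (x + u).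
- have /andP[h1 h2] := stair_bound (h l); have /andP[h3 h4] := stair_bound (h' l).
  by move: h3 h4; rewrite lx ler_norml -/s in h1 h2 * => h3 h4; apply/andP; split; lra.
- rewrite (cut_heightE h') -/s; apply/rowP => k; rewrite [LHS]mxE.
  have E (p q r : 'rV[R]_4) : (p + q + r) 0 k = p 0 k + q 0 k + r 0 k by rewrite !mxE.
  rewrite E -[(u *m L) 0 k]/(lf u k) [X in _ = _ + X]mxE basisE.
  have [->|kl] := eqVneq k l.
    have -> : s' 0 l = (Num.floor (level (x + u) l))%:~R by rewrite mxE eqxx.
    by rewrite mulr1; ring.
  by rewrite mulr0 addr0.
Qed.

Lemma cut_period_int y u : vtx v cut_tiling y ->
  (forall k, lf u k \is a Num.int) ->
  exists y', vtx v cut_tiling y' /\ cut_height y' = cut_height y + u *m L.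
Proof.
move=> /cut_vtx_height[x [h si e]] ui.
have h' : rel (cut_height y + u *m L) (x + u).
  move=> k; rewrite mxE -[(u *m L) 0 k]/(lf u k).
  have -> : level (x + u) k = level x k + lf u k by rewrite /level lfD; ring.
  have /intrP[m ->] := ui k; apply: stair_shift; exact: h.
exists ((cut_height y + u *m L) *m A); split; last by rewrite (cut_heightE h').
apply/cut_vtxP; exists (cut_height y + u *m L), (x + u); split => // k.
rewrite mxE; apply: rpredD; [exact: si|exact: ui].
Qed.

(** The whole surface is in the relation rel with points of the plane, not just its
    vertices. *)
Lemma cut_strip (a0 : tile R 4) (z : 'rV[R]_4) : stepped_surface cut_tiling (cut_lift (tile_pos a0)) z ->
  exists x, rel (z + cut_height (tile_pos a0)) x.
Proof.
move=> [a [[i [j [x [lij ii jj ->]]]] [l [m [hl hm ->]]]]]; exists x.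
have ij : i != j by rewrite neq_ltn lij.
have h0 : rel (introw (corner x i j) + (0 *: e_ i + 0 *: e_ j)) x.
  by apply: crossing_rel => //; rewrite lexx ler01.
rewrite !scale0r !addr0 in h0.
rewrite /cut_lift /= (cut_heightE h0).
have -> : introw (corner x i j) - cut_height (tile_pos a0) + (l *: e_ i + m *: e_ j) +
   cut_height (tile_pos a0) = introw (corner x i j) + (l *: e_ i + m *: e_ j).
  by apply/rowP => k; rewrite !mxE; ring.
exact: crossing_rel.
Qed.

Lemma cut_lifts_into D : row_of L D -> lifts_into v cut_tiling D 1.
Proof.
move=> hD; split; first exact: row_of_dim LA hD.
have [a0 Ta0 _] := tiling_at 0 cut_tiling_rhombus.
pose cc : 'rV[R]_4 := \row_k (c k - 1) - cut_height (tile_pos a0).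
exists (cut_lift (tile_pos a0)), cc; split; first exact: cut_liftP.
move=> z /cut_strip[x h].
have E (p q : 'rV[R]_4) k : (p + q) 0 k = p 0 k + q 0 k by rewrite mxE.
exists (cc + x *m L), (z - (cc + x *m L)); split.
- by exists (x *m L) => //; apply/hD; exists x.
- move=> k; have := stair_bound (h k); rewrite E /level /lf.
  have -> : (z - (cc + x *m L)) 0 k =
     z 0 k - (c k - 1) + cut_height (tile_pos a0) 0 k - (x *m L) 0 k.
    have N (p : 'rV[R]_4) : (- p) 0 k = - p 0 k by rewrite mxE.
    rewrite E N E; have -> : cc 0 k = c k - 1 - cut_height (tile_pos a0) 0 k.
      by rewrite /cc E N mxE.
    ring.
  by move=> /andP[h1 h2]; apply/andP; split; lra.
- by rewrite [RHS]addrC subrK.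
Qed.

Lemma cut_strongly_planar D : row_of L D -> strongly_planar v cut_tiling.
Proof.
by move=> hD; split => //; exists D; exact: cut_lifts_into.
Qed.

Lemma cut_slope D : row_of L D -> is_slope v cut_tiling D.
Proof. by move=> hD; exists 1; split; [exact: cut_strongly_planar hD|exact: cut_lifts_into]. Qed.

End Cut.

(** * Generic shifts *)
Section Generic.
Variable R : realType.

(** A countable set has measure zero. *)
Lemma exists_outside_countable (S : set R) : countable S -> exists t, ~ S t.
Proof.
move=> cS; apply/not_existsP => h.
have ST : S = setT by apply/seteqP; split => // t _; apply/not_notP/h.
have := countable_lebesgue_measure0 cS.
have : (lebesgue_measure (`[0%R, 1%R]%classic : set R) <= lebesgue_measure S)%E.
  by apply: le_outer_measure; rewrite ST.
move=> + e; rewrite e lebesgue_measure_itv /= lte_fin ltr01 => /=.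
by rewrite oppr0 adde0 lee_fin ler10.
Qed.

Lemma poly_roots_countable (p : {poly R}) : p != 0 -> countable [set t | root p t].
Proof.
move=> p0; apply: finite_set_countable; apply/not_notP => inf.
have [B sub sz] := infinite_set_fset (size p) inf.
have : (size (finmap.enum_fset B) < size p)%N.
  apply: max_poly_roots => //; last exact: finmap.fset_uniq.
  by apply/allP => t tB; exact: sub.
by rewrite ltnNge sz.
Qed.

(** The shift c is chosen on the curve (t, t^2, t^3, t^4): each of the countably many
    conditions excludes the roots of a nonzero polynomial. *)
Lemma generic_shift (I : finType) (be : I -> 'I_4 -> R) : exists c : 'I_4 -> R,
  forall i, (exists k, be i k != 0) -> forall m : {ffun 'I_4 -> int},
    \sum_k be i k * c k <> \sum_k be i k * (m k)%:~R.
Proof.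
pose P (i : I) (m : {ffun 'I_4 -> int}) : {poly R} :=
  \sum_(k < 4) be i k *: 'X^(k.+1) - (\sum_k be i k * (m k)%:~R)%:P.
pose S := \bigcup_(im in [set im : I * {ffun 'I_4 -> int} | exists k, be im.1 k != 0])
  [set t | root (P im.1 im.2) t].
have cS : countable S.
  apply: bigcup_countable; first exact: countableP.
  move=> [i m] /= [k bk]; apply: poly_roots_countable.
  apply/eqP => /(congr1 (fun p : {poly R} => p`_k.+1)).
  rewrite /P coefB coefC /= subr0 coef0 coef_sum (bigD1 k) //= coefZ coefXn eqxx mulr1.
  rewrite big1 ?addr0; first by move/eqP; rewrite (negPf bk).
  move=> l lk; rewrite coefZ coefXn eqSS; case: eqP => [/val_inj e|]; last by rewrite mulr0.
  by rewrite e eqxx in lk.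
have [t ht] := exists_outside_countable cS.
exists (fun k => t ^+ k.+1) => i bi m e; apply: ht; exists (i, m) => //=.
rewrite /root /P hornerD hornerN hornerC horner_sum subr_eq0 -e; apply/eqP.
by apply: eq_bigr => k _; rewrite hornerZ hornerXn.
Qed.

Variables (L : 'M[R]_(2, 4)).
Local Notation lf := (lf L).

(** The linear relations between the four forms lf^~ k that an integer point of the grids
    could satisfy: that one form is zero (q = 0), that two are proportional (q = 1 and
    q = 2, from either row of L), and the relation between any three (q = 3). *)
Definition dependency (t : 'I_4 * 'I_4 * 'I_4 * 'I_4) (l : 'I_4) : R :=
  let: (q, i, j, k) := t in
  if q == 0 then (l == i)%:R
  else if q == 1 then L 0 j * (l == i)%:R - L 0 i * (l == j)%:R
  else if q == 2%:R then L 1 j * (l == i)%:R - L 1 i * (l == j)%:R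
  else grass L j k * (l == i)%:R - grass L i k * (l == j)%:R + grass L i j * (l == k)%:R.

Lemma sum_pick (F : 'I_4 -> R) i : \sum_l (l == i)%:R * F l = F i.
Proof.
rewrite (bigD1 i) //= eqxx mul1r big1 ?addr0 // => l li; by rewrite (negPf li) mul0r.
Qed.

Lemma sum_dependency q i j k (F : 'I_4 -> R) : \sum_l dependency (q, i, j, k) l * F l =
  if q == 0 then F i
  else if q == 1 then L 0 j * F i - L 0 i * F j
  else if q == 2%:R then L 1 j * F i - L 1 i * F j
  else grass L j k * F i - grass L i k * F j + grass L i j * F k.
Proof.
rewrite /dependency; case: ifP => _; first exact: sum_pick.
case: ifP => _; last case: ifP => _.
- rewrite -[F i]sum_pick -[F j]sum_pick !mulr_sumr -sumrB; apply: eq_bigr => l _; ring.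
- rewrite -[F i]sum_pick -[F j]sum_pick !mulr_sumr -sumrB; apply: eq_bigr => l _; ring.
- rewrite -[F i]sum_pick -[F j]sum_pick -[F k]sum_pick !mulr_sumr -sumrB -big_split /=.
  apply: eq_bigr => l _; ring.
Qed.

Lemma exists_generic : exists c : 'I_4 -> R,
  [/\ forall x i, level L c x i \is a Num.int -> exists u, lf u i != 0,
    forall x i j, i != j -> level L c x i \is a Num.int ->
      level L c x j \is a Num.int -> grass L i j != 0 &
    forall x i j k, uniq [:: i; j; k] -> level L c x i \is a Num.int ->
      level L c x j \is a Num.int -> level L c x k \isn't a Num.int].
Proof.
have [c hc] := generic_shift dependency; exists c.
have main t x : (exists l, dependency t l != 0) ->
    \sum_l dependency t l * lf x l = 0 ->
    (forall l, dependency t l != 0 -> level L c x l \is a Num.int) -> False.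
  move=> nz e int; apply: (hc t nz [ffun l => Num.floor (level L c x l)]).
  transitivity (\sum_l dependency t l * level L c x l).
    transitivity (\sum_l dependency t l * lf x l + \sum_l dependency t l * c l).
      by rewrite e add0r.
    by rewrite -big_split; apply: eq_bigr => l _; rewrite /level /= mulrDr.
  apply: eq_bigr => l _; rewrite ffunE.
  by have [->|nl] := eqVneq (dependency t l) 0; rewrite ?mul0r // floorK // int.
have g1 x i : level L c x i \is a Num.int -> exists u, lf u i != 0.
  move=> ii; apply/not_existsP => flat; apply: (main (0, i, i, i) x).
  - by exists i; rewrite /= eqxx oner_neq0.
  - by rewrite sum_dependency /=; apply/eqP/negPn/negP/flat.
  - by move=> l /=; case: (l =P i) => [->|]; rewrite ?eqxx.
have g2 x i j : i != j -> level L c x i \is a Num.int ->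
      level L c x j \is a Num.int -> grass L i j != 0.
  move=> ij ii jj; apply/eqP => g0.
  have off q l : dependency (q, i, j, j) l != 0 -> q \in [:: 0; 1; 2%:R] -> level L c x l \is a Num.int.
    move=> nz; rewrite !inE => hq; case/or3P: hq nz => /eqP -> /=; (have [->|li] := eqVneq l i => //);
      (have [->|lj] := eqVneq l j => //); by rewrite ?mulr0 ?subr0 ?eqxx.
  have row r : exists x0 : 'rV[R]_2, forall l, lf x0 l = L r l.
    by exists (delta_mx 0 r) => l; rewrite /lf -rowE mxE.
  have zero q r : q \in [:: 1; 2%:R] ->
     (forall F, \sum_l dependency (q, i, j, j) l * F l = L r j * F i - L r i * F j) ->
     (forall l, dependency (q, i, j, j) l = L r j * (l == i)%:R - L r i * (l == j)%:R) ->
     L r j * L 0 i - L r i * L 0 j = 0 -> L r j * L 1 i - L r i * L 1 j = 0 ->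
     L r i = 0.
    move=> hq hs hd e0 e1; apply/eqP/negPn/negP => nz; apply: (main (q, i, j, j) x).
    - exists j; rewrite hd eqxx (eq_sym j) (negPf ij) mulr0 sub0r mulr1 oppr_eq0 //.
    - rewrite hs /lf !mulL_E.
      have -> : L r j * (x 0 0 * L 0 i + x 0 1 * L 1 i) - L r i * (x 0 0 * L 0 j + x 0 1 * L 1 j)
        = x 0 0 * (L r j * L 0 i - L r i * L 0 j) + x 0 1 * (L r j * L 1 i - L r i * L 1 j) by ring.
      by rewrite e0 e1 !mulr0 addr0.
    - by move=> l nl; apply: off nl _; rewrite inE hq orbT.
  move: g0; rewrite /grass => g0.
  have z0 : L 0 i = 0.
    apply: (zero 1 0) => //; first by move=> F; rewrite sum_dependency.
      ring.
    by rewrite -[RHS]oppr0 -g0; ring.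
  have z1 : L 1 i = 0.
    apply: (zero 2%:R 1) => //; first by move=> F; rewrite sum_dependency.
      by rewrite -[RHS]g0; ring.
    ring.
  by have [u] := g1 _ _ ii; rewrite /lf mulL_E z0 z1 !mulr0 addr0 eqxx.
split=> // x i j k u ii jj; apply/negP => kk.
move: u; rewrite /= !inE negb_or andbT => /andP[/andP[ij ik] jk].
apply: (main (3%:R, i, j, k) x).
- exists k; rewrite /= eqxx !(eq_sym k) (negPf ik) (negPf jk) !mulr0 subr0 add0r mulr1.
  exact: g2 ij ii jj.
- rewrite sum_dependency /= /lf !mulL_E /grass; ring.
- move=> l /=; have [->//|li] := eqVneq l i; have [->//|lj] := eqVneq l j.
  by have [->//|lk] := eqVneq l k; rewrite !mulr0 subr0 addr0 eqxx.
Qed.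

End Generic.

(** * Potentials of local cocycles *)
(** A cocycle c p q defined for close p and q only is the variation of a function, since
    the plane is simply connected. The function is obtained by summing the cocycle along
    the segment from the origin, subdivided finely enough; refining the subdivision
    does not change the sum. *)
Section Potential.
Variables (R : realType) (m n : nat).
Local Notation V := 'rV[R]_m.+1.
Local Notation W := 'rV[R]_n.+1.
Variables (c : V -> V -> W) (rho : R).
Hypothesis rho0 : 0 < rho.
Hypothesis cocycle : forall p q w, `|p - q| <= rho -> `|q - w| <= rho ->
  `|p - w| <= rho -> c p q + c q w = c p w.

Lemma cocycle0 p : c p p = 0.
Proof.
have h : `|p - p| <= rho by rewrite subrr normr0 ltW.
by apply: (addrI (c p p)); rewrite cocycle // addr0.
Qed.

Lemma cocycle_chain (x w : V) M : `|w| <= rho -> (0 < M)%N ->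
  forall k, (k <= M)%N ->
  \sum_(j < k) c (x + (j%:R / M%:R) *: w) (x + (j.+1%:R / M%:R) *: w) =
  c x (x + (k%:R / M%:R) *: w).
Proof.
move=> hw M0; have M0' : 0 < M%:R :> R by rewrite ltr0n.
have small (t : R) : 0 <= t <= 1 -> `|t *: w| <= rho.
  move=> /andP[t0 t1]; rewrite normrZ ger0_norm //; apply: le_trans hw.
  by rewrite -[X in _ <= X]mul1r ler_wpM2r.
have frac k : (k <= M)%N -> 0 <= (k%:R / M%:R : R) <= 1.
  by move=> kM; rewrite divr_ge0 ?ler0n //= ler_pdivrMr // mul1r ler_nat.
elim=> [|k IH] kM.
  by rewrite big_ord0 mul0r scale0r addr0 cocycle0.
rewrite big_ord_recr /= IH; last exact: ltnW.
apply: cocycle.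
- by rewrite opprD addrA subrr sub0r normrN small // frac // ltnW.
- rewrite opprD addrACA subrr add0r -scalerBl -mulrBl -normrN -scaleNr -mulNr opprB.
  rewrite -[k.+1%:R]natr1 addrAC subrr add0r small // -[1]/(1%:R) frac //.
- by rewrite opprD addrA subrr sub0r normrN small // frac.
Qed.

Definition path_sum N k (p : V) : W :=
  \sum_(j < k) c ((j%:R / N%:R) *: p) ((j.+1%:R / N%:R) *: p).

Lemma path_refine N M k p : (0 < N)%N -> (0 < M)%N -> `|p| <= N%:R * rho ->
  path_sum (N * M) (k * M) p = path_sum N k p.
Proof.
move=> N0 M0 hp; have N0' : 0 < N%:R :> R by rewrite ltr0n.
have M0' : 0 < M%:R :> R by rewrite ltr0n.
elim: k => [|k IH]; first by rewrite mul0n /path_sum !big_ord0.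
rewrite {1}/path_sum mulSnr big_split_ord /= [X in X + _]IH /path_sum big_ord_recr /=.
congr (_ + _).
have hw : `|N%:R^-1 *: p| <= rho.
  by rewrite normrZ ger0_norm ?invr_ge0 ?ler0n // ler_pdivrMl.
have e (j : nat) : ((k * M + j)%N%:R / (N * M)%:R) *: p =
    (k%:R / N%:R) *: p + (j%:R / M%:R) *: (N%:R^-1 *: p).
  rewrite !scalerA -scalerDl; congr (_ *: _).
  by rewrite natrD !natrM; field; rewrite !gt_eqF.
transitivity (\sum_(j < M) c ((k%:R / N%:R) *: p + (j%:R / M%:R) *: (N%:R^-1 *: p))
    ((k%:R / N%:R) *: p + (j.+1%:R / M%:R) *: (N%:R^-1 *: p))).
  by apply: eq_bigr => j _; rewrite -addnS !e.
rewrite (cocycle_chain _ hw M0 (leqnn M)) divff ?gt_eqF // scale1r -scalerDl.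
by congr (c _ (_ *: _)); rewrite -natr1 mulrDl mul1r.
Qed.

(** The quadrilaterals between two close segments from the origin telescope. *)
Lemma path_diff N p q k : (0 < N)%N -> `|p| <= N%:R * (rho / 2) ->
  `|q| <= N%:R * (rho / 2) -> `|q - p| <= rho / 2 -> (k <= N)%N ->
  path_sum N k q - path_sum N k p = c ((k%:R / N%:R) *: p) ((k%:R / N%:R) *: q).
Proof.
move=> N0 hp hq hpq; have N0' : 0 < N%:R :> R by rewrite ltr0n.
have r2 : rho / 2 <= rho by have := rho0; lra.
have frac l : (l <= N)%N -> 0 <= (l%:R / N%:R : R) <= 1.
  by move=> lN; rewrite divr_ge0 ?ler0n //= ler_pdivrMr // mul1r ler_nat.
have dist l : (l <= N)%N -> `|(l%:R / N%:R) *: p - (l%:R / N%:R) *: q| <= rho / 2.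
  move=> /frac/andP[l0 l1]; rewrite -scalerBr normrZ ger0_norm // distrC.
  by apply: le_trans hpq; rewrite -[X in _ <= X]mul1r ler_wpM2r.
have step l w : `|w| <= N%:R * (rho / 2) ->
   `|(l%:R / N%:R) *: w - (l.+1%:R / N%:R) *: w| <= rho / 2.
  move=> hw; rewrite distrC -scalerBl -mulrBl -[l.+1%:R]natr1 addrAC subrr add0r mul1r.
  by rewrite normrZ ger0_norm ?invr_ge0 ?ler0n // ler_pdivrMl.
elim: k => [|k IH] kN.
  by rewrite /path_sum !big_ord0 subrr mul0r !scale0r cocycle0.
rewrite /path_sum !big_ord_recr /= -!/(path_sum _ _ _).
rewrite opprD addrACA IH; last exact: ltnW.
set a := (k%:R / N%:R) *: p; set b := (k%:R / N%:R) *: q.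
set a' := (k.+1%:R / N%:R) *: p; set b' := (k.+1%:R / N%:R) *: q.
have hab : `|a - b| <= rho / 2 by apply: dist; exact: ltnW.
have hab' : `|a' - b'| <= rho / 2 by exact: dist.
have haa' : `|a - a'| <= rho / 2 by exact: step.
have hbb' : `|b - b'| <= rho / 2 by exact: step.
have h1 : `|a - b'| <= rho.
  have -> : a - b' = (a - b) + (b - b') by rewrite addrA subrK.
  by rewrite (splitr rho) (le_trans (ler_normD _ _)) // lerD.
rewrite addrA cocycle // ?(le_trans hab) ?(le_trans hbb') //.
rewrite -(@cocycle a a' b') ?(le_trans haa') ?(le_trans hab') //.
by rewrite addrAC subrr add0r.
Qed.

Lemma cocycle_potential : exists G : V -> W,
  forall p q : V, `|q - p| <= rho / 2 -> G q - G p = c p q.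
Proof.
pose N (p : V) := (Num.bound (`|p| / (rho / 2))).+1.
have hN (p : V) M : (0 < M)%N -> `|p| <= (N p * M)%:R * (rho / 2).
  move=> M0; have r2 : 0 < rho / 2 by rewrite divr_gt0.
  rewrite -ler_pdivrMr //; apply: (@le_trans _ _ (N p)%:R); last first.
    by rewrite ler_nat leq_pmulr.
  have := archi_boundP (_ : 0 <= `|p| / (rho / 2)) => /(_ (divr_ge0 _ (ltW r2))) h.
  by apply: ltW; apply: lt_le_trans (h _) _ => //; rewrite ler_nat.
exists (fun p => path_sum (N p) (N p) p) => p q pq.
have r2 : rho / 2 <= rho by have := rho0; lra.
have hN' (w : V) : `|w| <= (N w)%:R * rho.
  have := hN w 1%N isT; rewrite muln1 => /le_trans; apply.
  by rewrite ler_wpM2l ?ler0n.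
rewrite -(@path_refine (N p) (N q) (N p)) // -(@path_refine (N q) (N p) (N q)) //.
rewrite [(N q * N p)%N]mulnC path_diff ?divff ?scale1r //.
- by rewrite pnatr_eq0 muln_eq0.
- exact: hN.
- by rewrite mulnC; exact: hN.
Qed.

End Potential.

(** * Tilings with the local patterns of a planar tiling *)
Section Local.
Variables (R : realType) (v : 'I_4 -> 'rV[R]_2).
Hypothesis vcross : forall i j, i != j -> cross (v i) (v j) != 0.
Implicit Types (a : tile R 4) (y p q z d : 'rV[R]_2).
Local Notation e_ k := (basis_vec R k : 'rV[R]_4).

Lemma translate_supp a d z : tile_supp v (translate d a) (z + d) <-> tile_supp v a z.
Proof.
split=> -[l [m [hl hm e]]]; exists l, m; split => //; last first.
  by rewrite e /= addrAC.
by apply: (addIr d); rewrite e /= addrAC.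
Qed.

Lemma translate_vertex a d z : tile_vertex v (translate d a) (z + d) <-> tile_vertex v a z.
Proof.
split=> -[l [m e]]; exists l, m; last by rewrite e /= addrAC.
by apply: (addIr d); rewrite e /= addrAC.
Qed.

Lemma translate_edge a d y k : tile_edge v a y k -> tile_edge v (translate d a) (y + d) k.
Proof.
case: a => i j x /= [[-> h]|[-> h]]; [left|right]; split => //;
  by case: h => ->; [left|right]; rewrite // addrAC.
Qed.

Lemma translate0 a : translate 0 a = a.
Proof. by case: a => i j x; rewrite /translate /= addr0. Qed.

Lemma enorm_le (x : 'rV[R]_2) : enorm x <= 2 * `|x|.
Proof.
rewrite /enorm big_ord_recl big_ord1 -[2 * _]ger0_norm ?mulr_ge0 // -sqrtr_sqr.
apply: ler_wsqrtr; rewrite exprMn.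
have h k : x 0 k ^+ 2 <= `|x| ^+ 2.
  by rewrite -real_normK ?num_real // lerXn2r ?nnegrE // mxnorm_coord.
have := h ord0; have := h (lift ord0 ord0); have := sqr_ge0 `|x|; lra.
Qed.

Variables (T U : set (tile R 4)) (F : 'rV[R]_2 -> 'rV[R]_4) (L : 'M[R]_(2, 4)) (C rho : R).
Hypotheses (hT : rhombus_tiling v T) (hF : is_lift v T F)
  (hn : near_linear v T F L C) (hU : rhombus_tiling v U).
Hypothesis rhoV : 4 * vsum v + 1 <= rho.
Hypothesis hat : atlas v U (4 * rho) `<=` atlas v T (4 * rho).

Let rho0 : 0 < rho.
Proof. by apply: lt_le_trans rhoV; have := vsum_ge0 v; lra. Qed.

(** The atlas is taken at diameter 4 rho since the distances are measured with the sup
    norm, and disks are euclidean. *)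
Lemma pattern_transfer z : exists d, forall a p, U a -> tile_supp v a p ->
  `|p - z| <= rho -> T (translate d a).
Proof.
have : atlas v U (4 * rho) (disk_pattern v U z (4 * rho)).
  exists z, 0; apply/seteqP; split => a.
    by move=> h; exists a => //; rewrite translate0.
  by move=> [b h <-]; rewrite translate0.
move=> /hat[z' [d E]]; exists (- d) => a p Ua ap pz.
have : disk_pattern v U z (4 * rho) a.
  split => //; exists p; split => //; rewrite /edisk /=.
  apply: le_trans (enorm_le _) _; lra.
rewrite E => -[b [Tb _] <-].
have -> : translate (- d) (translate d b) = b by case: (b) => i j x; rewrite /translate /= addrK.
exact: Tb.
Qed.

Lemma exists_local : exists D : 'rV[R]_2 -> 'rV[R]_2, forall z a p, U a ->
  tile_supp v a p -> `|p - z| <= rho -> T (translate (D z) a).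
Proof. by have [D hD] := choice pattern_transfer; exists D. Qed.

Lemma exists_base : exists b : 'rV[R]_2 -> 'rV[R]_2,
  (forall p, exists a, [/\ U a, tile_supp v a p & tile_vertex v a (b p)]) /\
  (forall p, vtx v U p -> b p = p).
Proof.
have : forall p, exists q, (exists a, [/\ U a, tile_supp v a p & tile_vertex v a q]) /\
   (vtx v U p -> q = p).
  move=> p; have [[a Ua ap]|nv] := EM (vtx v U p).
    by exists p; split => //; exists a; split => //; exact: tile_vertex_supp.
  have [a Ua ap] := tiling_at p hU; exists (tile_pos a); split => //.
  by exists a; split => //; exact: tile_pos_vertex.
by move=> /choice[b hb]; exists b; split => p; case: (hb p).
Qed.

(** The lift of T, translated, provides a lift of U around each point z. The increments
    of two of them agree on the overlap of their domains, by vertex_constant, so they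
    form a cocycle. *)
Lemma transfer : exists f, [/\ is_lift v U f,
  forall y y', vtx v U y -> vtx v U y' -> `|y' - y| <= rho / 2 ->
    `|f y' - f y - (y' - y) *m L| <= 2 * C &
  forall Q : 'rV[R]_4 -> Prop, (forall d : 'rV[R]_4, Q d -> `|d *m dirmx v| <= rho / 2) ->
    (forall y, vtx v T y -> exists2 y', vtx v T y' & Q (F y' - F y)) ->
    forall y, vtx v U y -> exists2 y', vtx v U y' & Q (f y' - f y)].
Proof.
have [D hD] := exists_local; have [b [hb bv]] := exists_base.
pose g z y := F (y + D z).
have r2 : rho / 2 <= rho by have := rho0; lra.
have Vr : 2 * vsum v <= rho / 2 by have := rhoV; lra.
have V0 := vsum_ge0 v.
have gedge z a p y k : U a -> tile_supp v a p -> `|p - z| <= rho ->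
    tile_edge v a y k -> g z (y + v k) = g z y + e_ k.
  move=> Ua ap pz ak; rewrite /g addrAC; apply: (hF.2 (translate (D z) a)).
    exact: hD Ua ap pz.
  exact: translate_edge.
have gvtx z a p y : U a -> tile_supp v a p -> `|p - z| <= rho ->
    tile_vertex v a y -> vtx v T (y + D z).
  move=> Ua ap pz ay; exists (translate (D z) a); first exact: hD Ua ap pz.
  exact/translate_vertex.
have near0 (p : 'rV[R]_2) : `|p - p| <= rho by rewrite subrr normr0 ltW.
(* both local lifts satisfy the same edge equations around p and q, so their
   difference is constant there *)
have same z z' p q : `|p - z| <= rho -> `|q - z| <= rho ->
    `|p - z'| <= rho -> `|q - z'| <= rho -> g z (b q) - g z (b p) = g z' (b q) - g z' (b p).
  move=> h1 h2 h3 h4; apply/eqP; rewrite subr_eq addrAC -subr_eq opprK; apply/eqP.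
  have [a [Ua ap ab]] := hb p; have [a' [Ua' aq ab']] := hb q.
  pose h y := g z y - g z' y.
  suff : h (b q) = h (b p).
    rewrite /h => /eqP; rewrite subr_eq => /eqP ->.
    by apply/rowP => ?; rewrite !mxE; ring.
  have conv (w : 'rV[R]_2) (t : R) : 0 <= t <= 1 -> `|p - w| <= rho -> `|q - w| <= rho ->
      `|p + t *: (q - p) - w| <= rho.
    move=> /andP[t0 t1] hp hq.
    have -> : p + t *: (q - p) - w = (1 - t) *: (p - w) + t *: (q - w).
      by apply/rowP => ?; rewrite !mxE; ring.
    rewrite (le_trans (ler_normD _ _)) // !normrZ !ger0_norm ?subr_ge0 //.
    have -> : rho = (1 - t) * rho + t * rho by ring.
    by rewrite lerD // ler_wpM2l // subr_ge0.
  apply: esym; apply: (@vertex_constant _ _ _ vcross _ U h p q hU _ a a') => //.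
  move=> a1 t y y' Ua1 ht a1t a1y a1y'.
  have he : forall a2 y2 k, [set a1] a2 -> tile_edge v a2 y2 k -> h (y2 + v k) = h y2.
    move=> a2 y2 k -> e2; rewrite /h !(gedge _ _ _ _ _ Ua1 a1t _ e2) ?conv //.
    by rewrite opprD addrACA subrr addr0.
  by rewrite (edge_constant (T := [set a1]) _ he a1y) // (edge_constant (T := [set a1]) _ he a1y').
pose c p q := g p (b q) - g p (b p).
have cocyc p q w : `|p - q| <= rho -> `|q - w| <= rho -> `|p - w| <= rho ->
    c p q + c q w = c p w.
  move=> h1 h2 h3; rewrite /c (@same q p q w) ?near0 // ?[`|w - q|]distrC // ?[`|q - p|]distrC //
    ?[`|w - p|]distrC //.
  by rewrite addrC addrA subrK.
have [G hG] := cocycle_potential rho0 cocyc.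
have [a0 Ua0 _] := tiling_at 0 hU.
pose f y := G y - G (tile_pos a0).
have fB y y' : f y' - f y = G y' - G y by rewrite /f; apply/rowP => ?; rewrite !mxE; ring.
have cv y y' : vtx v U y -> vtx v U y' -> c y y' = g y y' - g y y.
  by move=> vy vy'; rewrite /c !bv.
exists f; split.
- split.
    exists a0, (tile_pos a0); rewrite /f subrr; split => //; exact: tile_pos_vertex.
  move=> a y k Ua ak; have [ay ayk] := tile_vertex_edge ak.
  suff e : f (y + v k) - f y = e_ k by rewrite -e [RHS]addrC subrK.
  rewrite fB hG; last first.
    by rewrite [y + _]addrC addrK; have := le_vsum v k; lra.
  rewrite cv; [|by exists a|by exists a].
  by rewrite (gedge y a y y k Ua (tile_vertex_supp ay) (near0 y) ak) addrAC subrr add0r.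
- move=> y y' vy vy' hy; rewrite fB hG // cv // /g.
  have vT w : vtx v U w -> `|w - y| <= rho / 2 -> vtx v T (w + D y).
    move=> [a Ua aw] wy; apply: (gvtx y a w) => //; last exact: le_trans r2.
    exact: tile_vertex_supp.
  have h1 := hn (vT _ vy' hy).
  have h2 := hn (vT y vy (_ : `|y - y| <= _)); rewrite subrr normr0 in h2.
  have -> : F (y' + D y) - F (y + D y) - (y' - y) *m L =
    (F (y' + D y) - (y' + D y) *m L) - (F (y + D y) - (y + D y) *m L).
    by rewrite !mulmxDl mulNmx; apply/rowP => ?; rewrite ![in RHS]mxE ![in LHS]mxE; ring.
  rewrite (le_trans (ler_normB _ _)) // mulr_natl mulr2n lerD //.
  by apply: h2; rewrite divr_ge0 // ltW.
- move=> Q hQ hQT y vy; have [a Ua ay] := vy.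
  have ays := tile_vertex_supp ay.
  have vTy : vtx v T (y + D y) by apply: (gvtx y a y).
  have [q vq Qq] := hQT _ vTy.
  have qE : q - (y + D y) = (F q - F (y + D y)) *m dirmx v.
    have := lift_dir vcross hT hF vq vTy => /eqP; rewrite subr_eq => /eqP e.
    by rewrite mulmxBl e; apply/rowP => ?; rewrite !mxE; ring.
  pose y' := q - D y.
  have y'y : `|y' - y| <= rho / 2.
    have -> : y' - y = q - (y + D y) by rewrite /y' opprD addrA addrAC.
    by rewrite qE; exact: hQ.
  have [a' Ua' ay'] := tiling_at y' hU.
  have Ta' : T (translate (D y) a') by apply: hD Ua' ay' _; exact: le_trans r2.
  have vy' : vtx v U y'.
    exists a' => //; apply/(translate_vertex _ (D y)); rewrite subrK.
    have [a2 Ta2 a2q] := vq; apply: (tile_vertex_shared vcross hT Ta2 Ta' a2q).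
    by rewrite -[q](subrK (D y)); apply/translate_supp.
  exists y' => //; rewrite fB hG // cv // /g.
  by rewrite /y' subrK.
Qed.

End Local.

(** * Quasi-additive functions *)
Section QuasiAdditive.
Variable R : realType.

(** The bound b on the error disappears in the limit. *)
Lemma archimedean_le (x a b : R) : (forall n : nat, n%:R * x <= n%:R * a + b) -> x <= a.
Proof.
move=> h; rewrite leNgt; apply/negP => ax.
have d0 : 0 < x - a by rewrite subr_gt0.
have := archi_boundP (divr_ge0 (normr_ge0 b) (ltW d0)); rewrite ltr_pdivrMr // => h'.
have := h (Num.bound (`|b| / (x - a))); have := ler_norm b.
set n := _%:R in h' *; have : n * (x - a) = n * x - n * a by ring.
lra.
Qed.

Variables (X : R -> R) (Q : R).
Hypothesis X0 : X 0 = 0.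
Hypothesis qadd : forall s t, `|X (s + t) - X s - X t| <= Q.

Lemma quasi_natmul s (n : nat) : `|X (n%:R * s) - n%:R * X s| <= n%:R * Q.
Proof.
elim: n => [|n IH]; first by rewrite !mul0r X0 subrr normr0.
have := qadd (n%:R * s) s; rewrite -natr1 !mulrDl !mul1r => h.
have -> : X (n%:R * s + s) - (n%:R * X s + X s) =
  (X (n%:R * s + s) - X (n%:R * s) - X s) + (X (n%:R * s) - n%:R * X s) by ring.
by rewrite addrC [_ + Q]addrC (le_trans (ler_normD _ _)) // addrC lerD.
Qed.

Lemma quasi_intmul s (m : int) :
  `|X (m%:~R * s) - m%:~R * X s| <= (`|m%:~R| + 1) * Q.
Proof.
have Q0 : 0 <= Q by apply: le_trans (qadd 0 0).
case: m => n; rewrite ?NegzE ?mulrNz ?normrN -!pmulrn.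
  apply: le_trans (quasi_natmul _ _) _; rewrite [`|n%:R|]ger0_norm ?ler0n //.
  by rewrite ler_wpM2r //; lra.
rewrite [`|n.+1%:R|]ger0_norm ?ler0n //.
have h := quasi_natmul s n.+1.
have := qadd (n.+1%:R * s) (- n.+1%:R * s).
rewrite -mulrDl subrr mul0r X0 => h'.
have -> : X (- n.+1%:R * s) - - n.+1%:R * X s =
  - (0 - X (n.+1%:R * s) - X (- n.+1%:R * s)) - (X (n.+1%:R * s) - n.+1%:R * X s) by ring.
rewrite (le_trans (ler_normB _ _)) // normrN mulrDl mul1r addrC lerD //.
Qed.

(** A quasi-additive function is within bounded distance of a linear one, so it
    cannot be approximately multiplied by something else than k when its argument
    is multiplied by k, unless it is bounded. The comparison is made between
    X (n s) and X (m s) with m the integer part of k n. *)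
Lemma quasi_scaling_bounded (k k' Q2 : R) :
  (forall s, exists M, forall th, 0 <= th <= 1 -> `|X (th * s)| <= M) ->
  (forall s, `|X s - k' * X (k * s)| <= Q2) -> k * k' != 1 ->
  forall s, `|X s| <= Q * (1 + `|k * k'|) / `|1 - k * k'|.
Proof.
move=> loc hk kk s.
have d0 : 0 < `|1 - k * k'| by rewrite normr_gt0 subr_eq0 eq_sym.
have Q0 : 0 <= Q by apply: le_trans (qadd 0 0).
have [M hM] := loc s.
have M0 : 0 <= M by apply: le_trans (hM 0 _); rewrite ?lexx ?ler01.
rewrite ler_pdivlMr // mulrC -normrM.
apply: (@archimedean_le _ _ (Q2 + `|k'| * (M + 3 * Q + `|X s|))) => n.
pose m := Num.floor (k * n%:R); pose th := k * n%:R - m%:~R.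
have th01 : 0 <= th <= 1.
  have := floor_le (k * n%:R); have := floorD1_gt (k * n%:R); rewrite intrD -/m /th => h1 h2.
  by apply/andP; split; lra.
have e1 := quasi_natmul s n; have e2 := quasi_intmul s m.
have e3 := hk (n%:R * s); have e4 := hM th th01.
have e5 := qadd (m%:~R * s) (th * s); rewrite -mulrDl in e5.
have em : m%:~R + th = k * n%:R by rewrite /th addrC subrK.
rewrite em -mulrA in e5.
set A := X (n%:R * s) in e1 e3; set B := X (k * (n%:R * s)) in e3 e5.
set D := X (m%:~R * s) in e2 e5; set H := X (th * s) in e4 e5.
have -> : n%:R * `|(1 - k * k') * X s| = `|n%:R * ((1 - k * k') * X s)|.
  by rewrite [RHS]normrM [`|n%:R|]ger0_norm ?ler0n.
have -> : n%:R * ((1 - k * k') * X s) = - (A - n%:R * X s) + (A - k' * B) +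
   k' * ((B - D - H) + H + (D - m%:~R * X s) - th * X s).
  have -> : m%:~R = k * n%:R - th by rewrite -em addrK.
  ring.
have nm : `|m%:~R : R| <= `|k| * n%:R + 1.
  have -> : (m%:~R : R) = k * n%:R - th by rewrite -em addrK.
  rewrite (le_trans (ler_normB _ _)) // normrM [`|n%:R|]ger0_norm ?ler0n // lerD2l.
  by case/andP: th01 => t0 t1; rewrite ger0_norm.
have b1 : `|(B - D - H) + H + (D - m%:~R * X s) - th * X s| <=
   `|k| * n%:R * Q + (M + 3 * Q + `|X s|).
  have h5 : `|th * X s| <= `|X s|.
    case/andP: th01 => t0 t1; rewrite normrM (ger0_norm t0) -[X in _ <= X]mul1r ler_wpM2r //.
  have h6 : (`|m%:~R| + 1) * Q <= `|k| * n%:R * Q + 2 * Q.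
    by rewrite -mulrDl ler_wpM2r //; lra.
  rewrite (le_trans (ler_normB _ _)) //.
  have := ler_normD ((B - D - H) + H) (D - m%:~R * X s); have := ler_normD (B - D - H) H.
  lra.
have b2 : `|k' * ((B - D - H) + H + (D - m%:~R * X s) - th * X s)| <=
   n%:R * (Q * `|k * k'|) + `|k'| * (M + 3 * Q + `|X s|).
  rewrite normrM (le_trans (ler_wpM2l (normr_ge0 _) b1)) // normrM.
  by rewrite le_eqVlt; apply/orP; left; apply/eqP; ring.
rewrite (le_trans (ler_normD _ _)) //.
have := ler_normD (- (A - n%:R * X s)) (A - k' * B); rewrite normrN.
have -> : n%:R * (Q * (1 + `|k * k'|)) = n%:R * Q + n%:R * (Q * `|k * k'|) by ring.
lra.
Qed.

End QuasiAdditive.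

(** * Coarse solutions of a Pexider equation *)
Section Pexider.
Variables (R : realType) (V : Type) (Z : set V).
Variables (t0 t1 u0 u1 : V -> R).
Variables (al be ga de al' be' ga' de' K C : R).
Hypotheses (al0 : al != 0) (be0 : be != 0) (ga0 : ga != 0) (de0 : de != 0).
Hypotheses (al'0 : al' != 0) (be'0 : be' != 0) (ga'0 : ga' != 0) (de'0 : de' != 0).
Hypothesis K0 : 0 <= K.
Let K' := 2 * (1 + `|al| + `|be| + `|ga| + `|de|) * K.
Hypothesis surj : forall s t, exists y, [/\ Z y, `|t0 y - s| <= K & `|t1 y - t| <= K].
Hypothesis h0 : forall y z, Z y -> Z z -> `|t0 y - t0 z| <= K' -> `|u0 y - u0 z| <= C.
Hypothesis h1 : forall y z, Z y -> Z z -> `|t1 y - t1 z| <= K' -> `|u1 y - u1 z| <= C.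
Hypothesis h2 : forall y z, Z y -> Z z ->
  `|(al * t0 y + be * t1 y) - (al * t0 z + be * t1 z)| <= K' ->
  `|(al' * u0 y + be' * u1 y) - (al' * u0 z + be' * u1 z)| <= C.
Hypothesis h3 : forall y z, Z y -> Z z ->
  `|(ga * t0 y + de * t1 y) - (ga * t0 z + de * t1 z)| <= K' ->
  `|(ga' * u0 y + de' * u1 y) - (ga' * u0 z + de' * u1 z)| <= C.
Hypothesis loc : forall M, exists C', forall y z, Z y -> Z z ->
  `|t0 y - t0 z| <= M -> `|u0 y - u0 z| <= C'.
Hypothesis ratio : (be * ga) / (de * al) * ((de' * al') / (ga' * be')) != 1.

Let E := C + 2 * (`|al'| + `|be'|) * C.
Let k := be * ga / (de * al).
Let k' := de' * al' / (ga' * be').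
Let BX := (3 * E / `|al'|) * (1 + `|k * k'|) / `|1 - k * k'|.
Definition pexider_bound := 2 * C + 2 * BX + 2 * ((E + `|al'| * BX) / `|be'|).

Lemma norm_mul_le (a x B : R) : `|x| <= B -> `|a * x| <= `|a| * B.
Proof. by move=> h; rewrite normrM ler_wpM2l. Qed.

(** The functions X and W are u0 and u1 along the two axes of the (t0, t1) plane. The
    equation h2 makes X quasi-additive and expresses W by X; the equation h3 expresses
    W by X in another way, with another scaling, so that quasi_scaling_bounded
    applies. *)
Lemma pexider_bounded y z : Z y -> Z z ->
  `|u0 y - u0 z| <= pexider_bound /\ `|u1 y - u1 z| <= pexider_bound.
Proof.
have [Y hY] := choice (fun st => surj st.1 st.2).
have Y1 s t : Z (Y (s, t)) by case: (hY (s, t)).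
have Y2 s t : `|t0 (Y (s, t)) - s| <= K by case: (hY (s, t)).
have Y3 s t : `|t1 (Y (s, t)) - t| <= K by case: (hY (s, t)).
have C0 : 0 <= C.
  have := h0 (Y1 0 0) (Y1 0 0); rewrite !subrr normr0; apply.
  by rewrite /K' !mulr_ge0 // !addr_ge0.
have nn := (normr_ge0 al, normr_ge0 be, normr_ge0 ga, normr_ge0 de).
have K1 : 2 * K <= K'.
  rewrite /K' -!mulrA ler_wpM2l // -[X in X <= _]mul1r ler_wpM2r //.
  by case: nn => [[[? ?] ?] ?]; lra.
pose X s := u0 (Y (s, 0)) - u0 (Y (0, 0)).
pose W t := u1 (Y (0, t)) - u1 (Y (0, 0)).
have close0 p s : Z p -> `|t0 p - s| <= K -> `|u0 p - (X s + u0 (Y (0, 0)))| <= C.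
  move=> Zy hy; rewrite /X subrK; apply: h0 => //.
  have := Y2 s 0; move: hy; rewrite !ler_norml => /andP[? ?] /andP[? ?]; apply/andP; split; lra.
have close1 p t : Z p -> `|t1 p - t| <= K -> `|u1 p - (W t + u1 (Y (0, 0)))| <= C.
  move=> Zy hy; rewrite /W subrK; apply: h1 => //.
  have := Y3 0 t; move: hy; rewrite !ler_norml => /andP[? ?] /andP[? ?]; apply/andP; split; lra.
have pair (a b a' b' : R) : 2 * (`|a| + `|b|) * K <= K' ->
  (forall p q, Z p -> Z q -> `|(a * t0 p + b * t1 p) - (a * t0 q + b * t1 q)| <= K' ->
    `|(a' * u0 p + b' * u1 p) - (a' * u0 q + b' * u1 q)| <= C) ->
  forall s t s' t', a * s + b * t = a * s' + b * t' ->
    `|a' * (X s - X s') + b' * (W t - W t')| <= C + 2 * (`|a'| + `|b'|) * C.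
  move=> hK h s t s' t' e.
  have := h _ _ (Y1 s t) (Y1 s' t').
  set p := Y (s, t); set q := Y (s', t').
  have -> : a * t0 p + b * t1 p - (a * t0 q + b * t1 q) =
    a * (t0 p - s) + b * (t1 p - t) - (a * (t0 q - s') + b * (t1 q - t')).
    have e' : a * s = a * s' + b * t' - b * t by rewrite -e; ring.
    rewrite !mulrBr e'; ring.
  have b1 := norm_mul_le a (Y2 s t); have b2 := norm_mul_le b (Y3 s t).
  have b3 := norm_mul_le a (Y2 s' t'); have b4 := norm_mul_le b (Y3 s' t').
  rewrite -/p -/q in b1 b2 b3 b4.
  have H : `|a * (t0 p - s) + b * (t1 p - t) - (a * (t0 q - s') + b * (t1 q - t'))| <= K'.
    apply: le_trans hK; rewrite (le_trans (ler_normB _ _)) //.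
    have -> : 2 * (`|a| + `|b|) * K = (`|a| * K + `|b| * K) + (`|a| * K + `|b| * K) by ring.
    by rewrite lerD // (le_trans (ler_normD _ _)) // lerD.
  move=> /(_ H) {}H.
  have c1 := norm_mul_le a' (close0 _ _ (Y1 s t) (Y2 s t)).
  have c2 := norm_mul_le b' (close1 _ _ (Y1 s t) (Y3 s t)).
  have c3 := norm_mul_le a' (close0 _ _ (Y1 s' t') (Y2 s' t')).
  have c4 := norm_mul_le b' (close1 _ _ (Y1 s' t') (Y3 s' t')).
  rewrite -/p -/q in c1 c2 c3 c4.
  set g0 := u0 (Y (0, 0)) in c1 c2 c3 c4; set g1 := u1 (Y (0, 0)) in c1 c2 c3 c4.
  have -> : a' * (X s - X s') + b' * (W t - W t') =
    (a' * u0 p + b' * u1 p - (a' * u0 q + b' * u1 q)) +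
    ((a' * (u0 q - (X s' + g0)) + b' * (u1 q - (W t' + g1))) -
     (a' * (u0 p - (X s + g0)) + b' * (u1 p - (W t + g1)))) by ring.
  have -> : 2 * (`|a'| + `|b'|) * C = (`|a'| * C + `|b'| * C) + (`|a'| * C + `|b'| * C) by ring.
  rewrite (le_trans (ler_normD _ _)) // lerD // (le_trans (ler_normB _ _)) // lerD //.
    by rewrite (le_trans (ler_normD _ _)) // lerD.
  by rewrite (le_trans (ler_normD _ _)) // lerD.
have X00 : X 0 = 0 by rewrite /X subrr.
have W00 : W 0 = 0 by rewrite /W subrr.
pose E' := C + 2 * (`|ga'| + `|de'|) * C.
have A s t : `|al' * X s + be' * (W t - W (t + al * s / be))| <= E.
  have := pair al be al' be' _ h2 s t 0 (t + al * s / be); rewrite X00 subr0; apply.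
    by rewrite /K' ler_wpM2r // ler_wpM2l //; case: nn => [[[? ?] ?] ?]; lra.
  by field.
have A0 s : `|al' * X s - be' * W (al * s / be)| <= E.
  by have := A s 0; rewrite add0r W00 sub0r mulrN.
have B0 s : `|ga' * X s - de' * W (ga * s / de)| <= E'.
  have := pair ga de ga' de' _ h3 s 0 0 (ga * s / de).
  rewrite X00 subr0 W00 sub0r mulrN; apply.
    by rewrite /K' ler_wpM2r // ler_wpM2l //; case: nn => [[[? ?] ?] ?]; lra.
  by field.
have qadd s s' : `|X (s + s') - X s - X s'| <= 3 * E / `|al'|.
  rewrite ler_pdivlMr ?normr_gt0 // mulrC -normrM.
  have h := A s (al * s' / be).
  rewrite (_ : al * s' / be + al * s / be = al * (s + s') / be) in h; last by field.
  have h' := A0 s'; have h'' := A0 (s + s').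
  move: h h' h''; set w := W _; set w' := W _ => h h' h''.
  have -> : al' * (X (s + s') - X s - X s') =
    (al' * X (s + s') - be' * w') - (al' * X s + be' * (w - w')) - (al' * X s' - be' * w) by ring.
  have := ler_normB (al' * X (s + s') - be' * w' - (al' * X s + be' * (w - w'))) (al' * X s' - be' * w).
  have := ler_normB (al' * X (s + s') - be' * w') (al' * X s + be' * (w - w')).
  lra.
have scal s : `|X s - k' * X (k * s)| <= `|ga'^-1| * E' + `|de' / (ga' * be')| * E.
  have h := A0 (k * s); have h' := B0 s.
  have e : al * (k * s) / be = ga * s / de by rewrite /k; field; rewrite al0 be0 de0.
  rewrite e in h.
  have -> : X s - k' * X (k * s) = ga'^-1 * (ga' * X s - de' * W (ga * s / de)) -
     de' / (ga' * be') * (al' * X (k * s) - be' * W (ga * s / de)).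
    by rewrite /k'; field; rewrite ga'0 be'0.
  by rewrite (le_trans (ler_normB _ _)) // lerD // norm_mul_le.
have lc s : exists M, forall th, 0 <= th <= 1 -> `|X (th * s)| <= M.
  have [M hM] := loc (`|s| + 2 * K); exists M => th /andP[th0 th1].
  apply: hM => //; have := Y2 (th * s) 0; have := Y2 0 0; rewrite subr0.
  have : `|th * s| <= `|s| by rewrite normrM (ger0_norm th0) -[X in _ <= X]mul1r ler_wpM2r.
  rewrite !ler_norml => /andP[? ?] /andP[? ?] /andP[? ?]; apply/andP; split; lra.
have hX := quasi_scaling_bounded X00 qadd lc scal ratio.
rewrite -/BX in hX.
have hW t : `|W t| <= (E + `|al'| * BX) / `|be'|.
  rewrite ler_pdivlMr ?normr_gt0 // mulrC -normrM.
  have := A0 (be * t / al); rewrite (_ : al * _ / be = t); last by field; rewrite al0 be0.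
  have := norm_mul_le al' (hX (be * t / al)); set x := X _ => h h'.
  have -> : be' * W t = al' * x - (al' * x - be' * W t) by ring.
  by rewrite (le_trans (ler_normB _ _)) // addrC lerD.
move=> Zy Zz.
have BX0 : 0 <= BX by apply: le_trans (hX 0).
have BW0 : 0 <= (E + `|al'| * BX) / `|be'| by apply: le_trans (hW 0).
rewrite /pexider_bound; clear -close0 close1 hX hW BX0 BW0 Zy Zz K0; split.
  have := close0 y (t0 y) Zy; have := close0 z (t0 z) Zz; rewrite !subrr normr0 => /(_ K0) + /(_ K0).
  have := hX (t0 y); have := hX (t0 z).
  rewrite !ler_norml => /andP[? ?] /andP[? ?] /andP[? ?] /andP[? ?]; apply/andP; split; lra.
have := close1 y (t1 y) Zy; have := close1 z (t1 z) Zz; rewrite !subrr normr0 => /(_ K0) + /(_ K0).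
have := hW (t1 y); have := hW (t1 z).
rewrite !ler_norml => /andP[? ?] /andP[? ?] /andP[? ?] /andP[? ?]; apply/andP; split; lra.
Qed.

End Pexider.

(** * Coarse geometry of almost linear maps *)
Section Coarse.
Variables (R : realType).
Implicit Types (p q w : 'rV[R]_2).

(** Steps of length about N, of either sign, along which kap moves and S holds,
    reach any value of kap up to a bounded error. *)
Lemma walk (V : Type) (Z : set V) (kap : V -> R) (S : V -> V -> Prop) (N e : R) :
  e + 1 <= N -> (forall y, S y y) -> (forall x y z, S x y -> S y z -> S x z) ->
  (forall y ep, Z y -> `|ep| = 1 ->
     exists z, [/\ Z z, S y z & `|kap z - kap y - ep * N| <= e]) ->
  forall y s, Z y -> exists z, [/\ Z z, S y z & `|kap z - s| <= N + e].
Proof.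
move=> eN Srefl Strans step y s Zy.
have main (n : nat) : forall y, Z y -> `|kap y - s| <= n%:R + (N + e) ->
    exists z, [/\ Z z, S y z & `|kap z - s| <= N + e].
  elim: n => [|n IH] x Zx hx; first by exists x; rewrite add0r in hx.
  have [small|big] := leP `|kap x - s| (N + e); first by exists x.
  pose ep : R := if kap x - s <= 0 then 1 else -1.
  have hep : `|ep| = 1 by rewrite /ep; case: ifP; rewrite ?normrN normr1.
  have [z [Zz Sxz hz]] := step x ep Zx hep.
  have [z' [Zz' Szz' hz']] : exists z', [/\ Z z', S z z' & `|kap z' - s| <= N + e].
    apply: IH => //; move: hz hx big; rewrite -natr1 /ep.
    case: (leP (kap x - s) 0) => h; [rewrite (ler0_norm h)|rewrite (gtr0_norm h)];
      rewrite !ler_norml => /andP[? ?] ? ?; apply/andP; split; lra.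
  by exists z'; split => //; exact: Strans Szz'.
have [n hn] : exists n : nat, `|kap y - s| <= n%:R + (N + e).
  have e0 : 0 <= e.
    by have [z [_ _ h]] := step y 1 Zy (normr1 _); exact: le_trans h.
  exists (Num.bound `|kap y - s|); have := archi_boundP (normr_ge0 (kap y - s)); lra.
exact: main hn.
Qed.

Variables (Z : set 'rV[R]_2) (h : 'rV[R]_2 -> 'rV[R]_4) (rho C : R).
Hypothesis rho0 : 0 < rho.
Hypothesis dense : forall p, exists2 y, Z y & `|p - y| <= rho / 8.
Hypothesis local : forall y z, Z y -> Z z -> `|z - y| <= rho / 2 -> `|h z - h y| <= C.

(** A map whose local variations are at most C grows with a slope which is as small
    as the local scale is large. *)
Lemma coarse_lipschitz y z : Z y -> Z z ->
  `|h z - h y| <= 4 * C / rho * `|z - y| + 3 * C.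
Proof.
move=> Zy Zz.
have C0 : 0 <= C.
  have := local Zy Zy; rewrite !subrr !normr0; apply; rewrite divr_ge0 ?ltW //.
have /choice[b hb] : forall p, exists q, Z q /\ `|p - q| <= rho / 8.
  by move=> p; have [q] := dense p; exists q.
have chain p w (n : nat) : `|w| <= rho / 4 ->
    `|h (b (p + n%:R *: w)) - h (b p)| <= n%:R * C.
  move=> hw; elim: n => [|n IH]; first by rewrite scale0r addr0 subrr normr0 mul0r.
  rewrite -natr1 mulrDl mul1r scalerDl scale1r addrA.
  set q := p + n%:R *: w in IH *.
  have -> : h (b (q + w)) - h (b p) = (h (b q) - h (b p)) + (h (b (q + w)) - h (b q)).
    by rewrite [RHS]addrC addrA subrK.
  rewrite (le_trans (ler_normD _ _)) // lerD //.
  have [Z1 h1] := hb q; have [Z2 h2] := hb (q + w); apply: local => //.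
  have -> : b (q + w) - b q = (q - b q) - (q + w - b (q + w)) + w.
    by apply/rowP => ?; rewrite !mxE; ring.
  rewrite (le_trans (ler_normD _ _)) //.
  have := ler_normB (q - b q) (q + w - b (q + w)); lra.
have hbz p : Z p -> `|h (b p) - h p| <= C.
  move=> Zp; have [Z1 h1] := hb p; apply: local => //; rewrite distrC.
  by apply: le_trans h1 _; have := rho0; lra.
pose n := (Num.truncn (4 * `|z - y| / rho)).+1.
have t0 : 0 <= 4 * `|z - y| / rho by rewrite divr_ge0 ?mulr_ge0 // ltW.
have /andP[n1 n2] : (Num.truncn (4 * `|z - y| / rho))%:R <= 4 * `|z - y| / rho < n%:R.
  exact: truncn_itv.
have n0 : 0 < n%:R :> R by rewrite ltr0n.
have hw : `|n%:R^-1 *: (z - y)| <= rho / 4.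
  rewrite normrZ ger0_norm ?invr_ge0 ?ler0n // ler_pdivrMl //.
  by move: n2; rewrite ltr_pdivrMr //; lra.
have := chain y _ n hw; rewrite scalerA divff ?gt_eqF // scale1r [y + _]addrC subrK.
have := hbz y Zy; have := hbz z Zz.
have nC : n%:R * C <= (4 * C / rho) * `|z - y| + C.
  have -> : 4 * C / rho * `|z - y| + C = (4 * `|z - y| / rho + 1) * C.
    by field; rewrite gt_eqF.
  by rewrite ler_wpM2r // /n -natr1; lra.
have -> : h z - h y = (h (b z) - h (b y)) - (h (b z) - h z) + (h (b y) - h y).
  by apply/rowP => ?; rewrite !mxE; ring.
have := ler_normD ((h (b z) - h (b y)) - (h (b z) - h z)) (h (b y) - h y).
have := ler_normB (h (b z) - h (b y)) (h (b z) - h z).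
lra.
Qed.

End Coarse.

(** * Bounding the deviation from the slope *)
Section Bounded.
Variables (R : realType) (v : 'I_4 -> 'rV[R]_2) (L : 'M[R]_(2, 4)) (C rho : R).
Implicit Types (y z p : 'rV[R]_2).
Local Notation A := (dirmx v).
Local Notation e_ k := (basis_vec R k : 'rV[R]_4).
Hypothesis LA : L *m A = 1%:M.

(** What is known of the vertices and of the lift of a tiling whose local patterns are
    those of a tiling of slope L. *)
Record locally_planar (Z : set 'rV[R]_2) (f : 'rV[R]_2 -> 'rV[R]_4) : Prop := LocallyPlanar {
  lp_dir : forall y z, Z y -> Z z -> (f z - f y) *m A = z - y;
  lp_dense : forall p, exists2 y, Z y & `|p - y| <= rho / 8;
  lp_local : forall y z, Z y -> Z z -> `|z - y| <= rho / 2 ->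
    `|f z - f y - (z - y) *m L| <= C }.

(** The deviation is periodic, with a fundamental domain of size at most rho / 2. *)
Lemma bounded_rational (u0 u1 : 'rV[R]_2) Z f : locally_planar Z f ->
  cross u0 u1 != 0 -> `|u0| + `|u1| <= rho / 2 ->
  (forall u ep y, u \in [:: u0; u1] -> `|ep| = 1 -> Z y ->
    exists2 z, Z z & f z = f y + (ep *: u) *m L) ->
  forall y z, Z y -> Z z -> `|f z - f y - (z - y) *m L| <= C.
Proof.
move=> [dir dense local] cu hr per y z Zy Zz.
pose k0 p := cross p u1 / cross u0 u1; pose k1 p := cross u0 p / cross u0 u1.
pose h p := f p - p *m L.
have step u ep p : u \in [:: u0; u1] -> Z p -> `|ep| = 1 ->
    Z (p + ep *: u) /\ h (p + ep *: u) = h p.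
  move=> hu Zp hep; have [q Zq e] := per u ep p hu hep Zp.
  have e' : q - p = ep *: u by rewrite -dir // e addrAC subrr add0r -mulmxA LA mulmx1.
  have <- : q = p + ep *: u by rewrite -e' addrC subrK.
  split => //; rewrite /h e; have -> : q *m L = p *m L + (ep *: u) *m L.
    by rewrite -mulmxDl -e' addrC subrK.
  by rewrite opprD addrACA subrr addr0.
have i0 : u0 \in [:: u0; u1] by rewrite inE eqxx.
have i1 : u1 \in [:: u0; u1] by rewrite !inE eqxx orbT.
have e01 : (0 : R) + 1 <= 1 by rewrite add0r.
have [p [Zp [hp ep] kp]] : exists p, [/\ Z p, h y = h p /\ k1 y = k1 p & `|k0 p - k0 z| <= 1 + 0].
  apply: (@walk _ _ Z k0 (fun y z => h y = h z /\ k1 y = k1 z)) => //.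
    by move=> ? ? ? [-> ->] [-> ->].
  move=> p ep Zp hep; have [Zq hq] := step u0 ep p i0 Zp hep.
  exists (p + ep *: u0); split => //.
    by rewrite hq; split => //; rewrite /k1 crossDr crossZr crossxx mulr0 addr0.
  by rewrite /k0 crossDl crossZl mulrDl mulfK // mulr1 [_ + ep]addrC addrK subrr normr0.
have [q [Zq [hq eq] kq]] : exists q, [/\ Z q, h p = h q /\ k0 p = k0 q & `|k1 q - k1 z| <= 1 + 0].
  apply: (@walk _ _ Z k1 (fun y z => h y = h z /\ k0 y = k0 z)) => //.
    by move=> ? ? ? [-> ->] [-> ->].
  move=> q ep' Zq hep; have [Zq' hq] := step u1 ep' q i1 Zq hep.
  exists (q + ep' *: u1); split => //.
    by rewrite hq; split => //; rewrite /k0 crossDl crossZl crossxx mulr0 addr0.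
  by rewrite /k1 crossDr crossZr mulrDl mulfK // mulr1 [_ + ep']addrC addrK subrr normr0.
have qz : `|z - q| <= rho / 2.
  apply: le_trans hr.
  have -> : z - q = (k0 z - k0 q) *: u0 + (k1 z - k1 q) *: u1.
    rewrite {1}(cross_decomp z cu) {1}(cross_decomp q cu).
    by rewrite !scalerBl opprD addrACA.
  rewrite (le_trans (ler_normD _ _)) // !normrZ.
  by rewrite lerD // -[X in _ <= X]mul1r ler_wpM2r // distrC -?eq -[1]addr0.
have -> : f z - f y - (z - y) *m L = f z - f q - (z - q) *m L.
  have : h y = h q by rewrite hp.
  rewrite /h => e; have -> : f y = f q - q *m L + y *m L by rewrite -e subrK.
  by rewrite !mulmxBl; apply/rowP => k; rewrite ![in LHS]mxE ![in RHS]mxE; ring.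
exact: local.
Qed.

Lemma locally_planar_lipschitz Z f : 0 < rho -> locally_planar Z f ->
  forall y z, Z y -> Z z ->
  `|f z - f y - (z - y) *m L| <= 4 * C / rho * `|z - y| + 3 * C.
Proof.
move=> rho0 [_ dense local] y z Zy Zz.
have e p q : f q - f p - (q - p) *m L = (f q - q *m L) - (f p - p *m L).
  by rewrite mulmxBl; apply/rowP => k; rewrite ![in LHS]mxE ![in RHS]mxE; ring.
rewrite e; apply: (@coarse_lipschitz _ Z (fun y => f y - y *m L)) => // p q Zp Zq hpq.
by rewrite -e; exact: local.
Qed.

Lemma mulmx_colE (M : 'M[R]_4) k (a b : R) (x : 'rV[R]_4) :
  (forall i, M i k = a * M i 0 + b * M i 1) ->
  (x *m M) 0 k = a * (x *m M) 0 0 + b * (x *m M) 0 1.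
Proof.
move=> h; rewrite !mxE !big_distrr -big_split; apply: eq_bigr => i _ /=.
by rewrite h; ring.
Qed.

(** The columns of X are linear forms that vanish on the slope, and those of Y are
    linear forms that vanish on another plane. Column l of each also vanishes on
    e_l and on q_l L, so that a step along q_l L + tau e_l moves neither of them. *)
Section Irrational.
Variables (X Y : 'M[R]_4) (q : 'I_4 -> 'rV[R]_2) (N : R).
Hypothesis LX : L *m X = 0.
Hypothesis Xe : forall l, X l l = 0.
Hypothesis Ye : forall l, Y l l = 0.
Hypothesis Yq : forall l, (q l *m L *m Y) 0 l = 0.
Hypothesis Yq_neq0 : forall l m, l != m -> (q l *m L *m Y) 0 m != 0.
Hypothesis N_large : forall l m, l != m -> `|Y l m / (q l *m L *m Y) 0 m| + 1 <= N.

Variables (c0 c1 c2 c3 K : R).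
Hypotheses (c0_ge0 : 0 <= c0) (c1_ge0 : 0 <= c1) (c2_ge0 : 0 <= c2) (c3_ge0 : 0 <= c3).
Hypothesis c0P : forall l m (x : 'rV[R]_2), l != m ->
  `|x| <= c0 * (`|(x *m L *m Y) 0 l| + `|(x *m L *m Y) 0 m|).
Hypothesis c1P : forall x : 'rV[R]_4, `|x *m Y| <= c1 * `|x|.
Hypothesis c2P : forall x : 'rV[R]_2, `|x *m L| <= c2 * `|x|.
Hypothesis c3P : forall x : 'rV[R]_4, `|x *m X| <= c3 * `|x|.
Hypothesis KP : forall l m, 2 * N * `|(q l *m L *m Y) 0 m| <= K.
Hypothesis rho0 : 0 < rho.
Hypothesis rho_large : 4 * (c0 * c1 * (4 * C / rho)) <= 1.

Variables (Z : set 'rV[R]_2) (f : 'rV[R]_2 -> 'rV[R]_4).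
Hypothesis Zf : locally_planar Z f.
Hypothesis step : forall l (ep : R) y, `|ep| = 1 -> Z y -> exists z tau,
  [/\ Z z, `|tau| <= 1 & f z = f y + (ep * N) *: (q l *m L) + tau *: e_ l].

Let t l y : R := (f y *m Y) 0 l.
Let u l y : R := (f y *m X) 0 l.

(** kap = Y_m / Y_m (q_l L) increases by N along a step in the direction q_l L, up to an
    error which is due to tau and less than N. *)
Lemma walk_along l m y s : l != m -> Z y ->
  exists z, [/\ Z z, t l y = t l z /\ u l y = u l z & `|t m z - s| <= K].
Proof.
move=> lm Zy; set d := (q l *m L *m Y) 0 m.
have d0 : d != 0 by exact: Yq_neq0.
have [z [Zz e h]] : exists z, [/\ Z z, t l y = t l z /\ u l y = u l z &
    `|t m z / d - s / d| <= N + `|Y l m / d|].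
  apply: (@walk _ _ Z (fun z => t m z / d) (fun y z => t l y = t l z /\ u l y = u l z)) => //.
  - by rewrite /d; exact: N_large.
  - by move=> ? ? ? [-> ->] [-> ->].
  move=> y' ep Zy' hep; have [z [tau [Zz htau e]]] := step l hep Zy'.
  have eM (M : 'M[R]_4) k : (f z *m M) 0 k =
      (f y' *m M) 0 k + ep * N * (q l *m L *m M) 0 k + tau * M l k.
    rewrite e !mulmxDl -!scalemxAl /basis_vec -rowE.
    have D (a b c : 'rV[R]_4) : (a + b + c) 0 k = a 0 k + b 0 k + c 0 k by rewrite !mxE.
    have S a (b : 'rV[R]_4) : (a *: b) 0 k = a * b 0 k by rewrite mxE.
    by rewrite D !S [row l M 0 k]mxE.
  exists z; split => //.
    rewrite /t /u !eM Yq Ye -[q l *m L *m X]mulmxA LX mulmx0 Xe.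
    by rewrite [(0 : 'rV[R]_4) 0 l]mxE !mulr0 !addr0.
  rewrite /t eM -/d.
  have -> : ((f y' *m Y) 0 m + ep * N * d + tau * Y l m) / d - (f y' *m Y) 0 m / d - ep * N =
    tau * (Y l m / d) by field.
  by rewrite normrM -[X in _ <= X]mul1r ler_wpM2r.
exists z; split => //; apply: le_trans (KP l m); rewrite -/d.
move: h; rewrite -mulrBl normrM normfV ler_pdivrMr ?normr_gt0 // => h.
apply: le_trans h _; rewrite ler_wpM2r //; have := N_large lm; rewrite -/d.
lra.
Qed.

Definition coarse_bound M := c3 * (c2 + 4 * C / rho) * (2 * c0 * (M + K + 6 * c1 * C)) + 3 * c3 * C.

(** Walking along the direction l changes neither X_l nor Y_l, so one may assume that the
    values of another form Y_m at y and z are close as well. As f is almost linear, and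
    Y_l and Y_m are coordinates on the slope, y is then close to z. *)
Lemma form_coarse l y z M : Z y -> Z z -> `|t l y - t l z| <= M -> `|u l y - u l z| <= coarse_bound M.
Proof.
move=> Zy Zz hM.
have [m lm] : exists m : 'I_4, l != m.
  have [->|l0] := eqVneq l 0; last by exists 0.
  by exists 1.
have [p [Zp [et eu] hp]] := walk_along (t m z) lm Zy.
rewrite eu; rewrite et in hM.
pose D := f p - f z; pose E := D - (p - z) *m L.
have hE : `|E| <= 4 * C / rho * `|p - z| + 3 * C.
  exact: (locally_planar_lipschitz rho0 Zf Zz Zp).
have eD : (p - z) *m L = D - E by rewrite /E opprB [RHS]addrC subrK.
have entry (W : 'M[R]_4) k : ((f p - f z) *m W) 0 k = (f p *m W) 0 k - (f z *m W) 0 k.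
  by rewrite mulmxBl; move: (f p *m W) (f z *m W) => a b; rewrite !mxE.
have hY k B : `|t k p - t k z| <= B -> `|((p - z) *m L *m Y) 0 k| <= B + c1 * `|E|.
  move=> hB; rewrite eD mulmxBl.
  have -> : (D *m Y - E *m Y) 0 k = (D *m Y) 0 k - (E *m Y) 0 k.
    by move: (D *m Y) (E *m Y) => a b; rewrite !mxE.
  rewrite (le_trans (ler_normB _ _)) // lerD //; first by rewrite /D entry.
  exact: le_trans (mxnorm_coord _ _ _) (c1P _).
have h1 := hY l M hM; have h2 := hY m K hp.
have hx := c0P (p - z) lm.
set x := `|p - z| in hE hx *; have hr := rho_large; set de := 4 * C / rho in hE hr *.
have C0 : 0 <= C.
  have [_ _ h] := Zf; apply: le_trans (h y y Zy Zy _) => //.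
  by rewrite subrr normr0 divr_ge0 // ltW.
have de0 : 0 <= de by rewrite /de divr_ge0 ?mulr_ge0 // ltW.
have x0 : 0 <= x by exact: normr_ge0.
have xB : x <= 2 * c0 * (M + K + 6 * c1 * C).
  have b1 : c0 * (`|((p - z) *m L *m Y) 0 l| + `|((p - z) *m L *m Y) 0 m|) <=
     c0 * (M + K + 2 * (c1 * (de * x + 3 * C))).
    rewrite ler_wpM2l //; have := ler_wpM2l c1_ge0 hE; lra.
  have b2 : 4 * (c0 * c1 * de) * x <= 1 * x by rewrite ler_wpM2r.
  have -> : 2 * c0 * (M + K + 6 * c1 * C) =
     2 * (c0 * (M + K + 2 * (c1 * (de * x + 3 * C))) - c0 * c1 * de * x * 2) by ring.
  lra.
have uE : u l p - u l z = (D *m X) 0 l by rewrite /D entry.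
rewrite uE (le_trans (mxnorm_coord _ _ _)) // (le_trans (c3P _)) //.
have Db : `|D| <= (c2 + de) * x + 3 * C.
  have -> : D = (p - z) *m L + E by rewrite eD subrK.
  rewrite (le_trans (ler_normD _ _)) //; have := c2P (p - z); rewrite -/x; lra.
have := ler_wpM2l (mulr_ge0 c3_ge0 (addr_ge0 c2_ge0 de0)) xB.
have := ler_wpM2l c3_ge0 Db; rewrite /coarse_bound -/de; lra.
Qed.

Variables (al be ga de al' be' ga' de' c4 : R).
Hypotheses (al0 : al != 0) (be0 : be != 0) (ga0 : ga != 0) (de0 : de != 0).
Hypotheses (al'0 : al' != 0) (be'0 : be' != 0) (ga'0 : ga' != 0) (de'0 : de' != 0).
Hypothesis Y2 : forall i, Y i 2 = al * Y i 0 + be * Y i 1.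
Hypothesis Y3 : forall i, Y i 3 = ga * Y i 0 + de * Y i 1.
Hypothesis X2 : forall i, X i 2 = al' * X i 0 + be' * X i 1.
Hypothesis X3 : forall i, X i 3 = ga' * X i 0 + de' * X i 1.
Hypothesis ratio : (be * ga) / (de * al) * ((de' * al') / (ga' * be')) != 1.
Hypothesis c4P : forall x : 'rV[R]_4, x *m A = 0 ->
  `|x| <= c4 * (`|(x *m X) 0 0| + `|(x *m X) 0 1|).
Hypothesis c4_ge0 : 0 <= c4.

Definition deviation_bound := c4 * (2 * pexider_bound al be ga de al' be' ga' de'
  (coarse_bound (2 * (1 + `|al| + `|be| + `|ga| + `|de|) * K))).

(** The relations between the forms make t and u satisfy Pexider equations. Once
    X_0 o f and X_1 o f are bounded, so is f - y L, since its image by e_k |-> v_k is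
    constant and this map is injective on the annihilated space, by c4P. *)
Lemma bounded_irrational y z : Z y -> Z z -> `|f z - f y - (z - y) *m L| <= deviation_bound.
Proof.
move=> Zy Zz.
have K0 : 0 <= K.
  by have [w [_ _ h]] := walk_along 0 (isT : (0 : 'I_4) != 1) Zy; exact: le_trans h.
have surj s s' : exists p, [/\ Z p, `|t 0 p - s| <= K & `|t 1 p - s'| <= K].
  have [p [Zp _ h]] := walk_along s (isT : (1 : 'I_4) != 0) Zy.
  have [w [Zw [e _] h']] := walk_along s' (isT : (0 : 'I_4) != 1) Zp.
  by exists w; split => //; rewrite -e.
have [b0 b1] : `|u 0 y - u 0 z| <= pexider_bound al be ga de al' be' ga' de'
  (coarse_bound (2 * (1 + `|al| + `|be| + `|ga| + `|de|) * K)) /\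
  `|u 1 y - u 1 z| <= pexider_bound al be ga de al' be' ga' de'
  (coarse_bound (2 * (1 + `|al| + `|be| + `|ga| + `|de|) * K)).
  apply: (@pexider_bounded _ _ Z (t 0) (t 1) (u 0) (u 1) al be ga de al' be' ga' de' K) => //.
  - by move=> *; apply: form_coarse.
  - by move=> *; apply: form_coarse.
  - move=> p w Zp Zw; have := @form_coarse 2 p w (2 * (1 + `|al| + `|be| + `|ga| + `|de|) * K) Zp Zw.
    by rewrite /t /u !(mulmx_colE _ Y2) !(mulmx_colE _ X2).
  - move=> p w Zp Zw; have := @form_coarse 3 p w (2 * (1 + `|al| + `|be| + `|ga| + `|de|) * K) Zp Zw.
    by rewrite /t /u !(mulmx_colE _ Y3) !(mulmx_colE _ X3).
  - by move=> M; exists (coarse_bound M) => *; apply: form_coarse.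
have [dir _ _] := Zf.
have DA : (f z - f y - (z - y) *m L) *m A = 0.
  by rewrite mulmxBl dir // -mulmxA LA mulmx1 subrr.
have DX k : ((f z - f y - (z - y) *m L) *m X) 0 k = - (u k y - u k z).
  rewrite mulmxBl -mulmxA LX mulmx0 subr0 opprB mulmxBl /u.
  by move: (f z *m X) (f y *m X) => a b; rewrite !mxE.
rewrite (le_trans (c4P DA)) // !DX !normrN ler_wpM2l //; lra.
Qed.

End Irrational.

End Bounded.

(** * Quasi-periodic slopes *)
(** The data that bound the deviation from the slope of L: linear forms, the columns
    of X, which vanish on the slope, linear forms, the columns of Y, which vanish on
    another plane, and vectors q_l L of the slope with integer coordinates off the
    l-th one. *)
Record quasi_periodic (R : realType) (L : 'M[R]_(2, 4)) (X Y : 'M[R]_4)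
    (q : 'I_4 -> 'rV[R]_2) (al be ga de al' be' ga' de' : R) : Prop := QuasiPeriodic {
  qp_int : forall l k, k != l -> (q l *m L) 0 k \is a Num.int;
  qp_LX : L *m X = 0;
  qp_ker : forall x : 'rV[R]_4, x *m X = 0 -> exists u, x = u *m L;
  qp_Xe : forall l, X l l = 0;
  qp_Ye : forall l, Y l l = 0;
  qp_Yq : forall l, (q l *m L *m Y) 0 l = 0;
  qp_Yq_neq0 : forall l m, l != m -> (q l *m L *m Y) 0 m != 0;
  qp_neq0 : [/\ al != 0, be != 0, ga != 0 & de != 0];
  qp_neq0' : [/\ al' != 0, be' != 0, ga' != 0 & de' != 0];
  qp_Y2 : forall i, Y i 2 = al * Y i 0 + be * Y i 1;
  qp_Y3 : forall i, Y i 3 = ga * Y i 0 + de * Y i 1;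
  qp_X2 : forall i, X i 2 = al' * X i 0 + be' * X i 1;
  qp_X3 : forall i, X i 3 = ga' * X i 0 + de' * X i 1;
  qp_ratio : (be * ga) / (de * al) * ((de' * al') / (ga' * be')) != 1 }.

Lemma ord4_ind (P : 'I_4 -> Prop) : P 0 -> P 1 -> P 2 -> P 3 -> forall k, P k.
Proof.
move=> P0 P1 P2 P3 [[|[|[|[|//]]]] hk].
- by rewrite (_ : Ordinal hk = 0) //; exact: val_inj.
- by rewrite (_ : Ordinal hk = 1) //; exact: val_inj.
- by rewrite (_ : Ordinal hk = 2) //; exact: val_inj.
- by rewrite (_ : Ordinal hk = 3) //; exact: val_inj.
Qed.

Section QuasiPeriodic.
Variables (R : realType) (v : 'I_4 -> 'rV[R]_2) (L : 'M[R]_(2, 4)).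
Local Notation A := (dirmx v).
Local Notation e_ k := (basis_vec R k : 'rV[R]_4).
Hypothesis LA : L *m A = 1%:M.

Lemma le_sum2 (F : 'I_4 -> 'I_4 -> R) l m : (forall i j, 0 <= F i j) ->
  F l m <= \sum_i \sum_j F i j.
Proof.
move=> F0; rewrite (bigD1 l) //= (bigD1 m) //= -addrA lerDl addr_ge0 ?sumr_ge0 // => i _.
by rewrite sumr_ge0.
Qed.

Lemma injective_bounded n (M : 'M[R]_(4, n.+1)) : (forall x : 'rV[R]_4, x *m M = 0 -> x = 0) ->
  exists2 c, 0 <= c & forall x : 'rV[R]_4, `|x| <= c * `|x *m M|.
Proof.
move=> inj; have fM : row_free M.
  rewrite -kermx_eq0; apply/eqP/row_matrixP => i; rewrite row0; apply: inj.
  by rewrite -row_mul mulmx_ker row0.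
have [c c0 hc] := mulmx_norm 0 (pinvmx M); exists c => // x.
by rewrite -{1}(mulmxKp fM x).
Qed.

Variables (X Y : 'M[R]_4) (q : 'I_4 -> 'rV[R]_2) (al be ga de al' be' ga' de' : R).
Hypothesis H : quasi_periodic L X Y q al be ga de al' be' ga' de'.

(** The constants of bounded_irrational exist. They do not depend on the tiling. *)
Lemma quasi_periodic_bounded (C : R) : exists (N : nat) rho1, forall rho, rho1 <= rho ->
  exists B, forall Z f, locally_planar v L C rho Z f ->
  (forall l (ep : R) y, `|ep| = 1 -> Z y -> exists z tau,
    [/\ Z z, `|tau| <= 1 & f z = f y + (ep * N%:R) *: (q l *m L) + tau *: e_ l]) ->
  forall y z, Z y -> Z z -> `|f z - f y - (z - y) *m L| <= B.
Proof.
case: H => qint LX kerX Xe Ye Yq Yq0 [al0 be0 ga0 de0] [al'0 be'0 ga'0 de'0] Y2 Y3 X2 X3 ratio.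
pose F l m : R := (q l *m L *m Y) 0 m.
have FE l m : l != m -> F l m != 0 by exact: Yq0.
pose c0 : R := \sum_l \sum_m (`|q l| / `|F l m| + `|q m| / `|F m l|).
have g0 l m : 0 <= `|q l| / `|F l m| + `|q m| / `|F m l|.
  by rewrite addr_ge0 // divr_ge0.
have c0_ge0 : 0 <= c0 by rewrite sumr_ge0 // => l _; rewrite sumr_ge0.
have c0P l m (x : 'rV[R]_2) : l != m ->
    `|x| <= c0 * (`|(x *m L *m Y) 0 l| + `|(x *m L *m Y) 0 m|).
  move=> lm; have ml : m != l by rewrite eq_sym.
  have cq : cross (q l) (q m) != 0.
    apply/eqP => e; have := grass_cross (L *m Y) l m (q l) (q m).
    rewrite e mulr0 !mulmxA !Yq mul0r sub0r => /eqP.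
    by rewrite oppr_eq0 mulf_eq0 (negPf (Yq0 l m lm)) (negPf (Yq0 m l ml)).
  set s := cross x (q m) / cross (q l) (q m); set t := cross (q l) x / cross (q l) (q m).
  have xE : x = s *: q l + t *: q m by exact: cross_decomp.
  have ev k : (x *m L *m Y) 0 k = s * F l k + t * F m k.
    rewrite /F xE !mulmxDl -!scalemxAl; move: (q l *m L *m Y) (q m *m L *m Y) => a b.
    by rewrite !mxE.
  have F0 k : F k k = 0 by exact: Yq.
  clearbody s t.
  rewrite !ev !F0 !mulr0 add0r addr0 !normrM.
  have hc := le_sum2 l m g0; rewrite -/c0 in hc.
  have Flm := FE l m lm; have Fml := FE m l ml.
  apply: (@le_trans _ _ ((`|q l| / `|F l m| + `|q m| / `|F m l|) * (`|t| * `|F m l| + `|s| * `|F l m|))).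
    have -> : (`|q l| / `|F l m| + `|q m| / `|F m l|) * (`|t| * `|F m l| + `|s| * `|F l m|) =
      `|s| * `|q l| + `|t| * `|q m| + (`|q l| / `|F l m| * (`|t| * `|F m l|) + `|q m| / `|F m l| * (`|s| * `|F l m|)).
      by field; rewrite !normr_eq0 Flm Fml.
    apply: (@le_trans _ _ (`|s| * `|q l| + `|t| * `|q m|)).
      by rewrite xE (le_trans (ler_normD _ _)) // !normrZ.
    by rewrite lerDl addr_ge0 ?mulr_ge0 ?divr_ge0.
  by rewrite ler_wpM2r // addr_ge0 // mulr_ge0.
have [c1 c1_ge0 c1P] := mulmx_norm 0 Y.
have [c2 c2_ge0 c2P] := mulmx_norm 0 L.
have [c3 c3_ge0 c3P] := mulmx_norm 0 X.
have [c4 c4_ge0 c4P] : exists2 c4, 0 <= c4 & forall x : 'rV[R]_4, x *m A = 0 ->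
    `|x| <= c4 * (`|(x *m X) 0 0| + `|(x *m X) 0 1|).
  pose W : 'M[R]_(4, 2 + (1 + 1)) := row_mx A (row_mx (col 0 X) (col 1 X)).
  have WE (x : 'rV[R]_4) :
      x *m W = row_mx (x *m A) (row_mx (col 0 (x *m X)) (col 1 (x *m X))).
    by rewrite mul_mx_row mul_mx_row !colE !mulmxA.
  have [|c c_ge0 hc] := @injective_bounded 3 W.
    move=> x e; have {e} : x *m W = 0 by exact: e.
    rewrite WE => /eqP; rewrite !row_mx_eq0 => /and3P[/eqP xA /eqP h0 /eqP h1].
    have e0 : (x *m X) 0 0 = 0.
      by have := congr1 (fun w : 'cV[R]_1 => w 0 0) h0; rewrite mxE => ->; rewrite mxE.
    have e1 : (x *m X) 0 1 = 0.
      by have := congr1 (fun w : 'cV[R]_1 => w 0 0) h1; rewrite mxE => ->; rewrite mxE.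
    have [|u xu] := kerX x; last by rewrite xu -mulmxA LA mulmx1 in xA; rewrite xu xA mul0mx.
    apply/rowP; apply: ord4_ind; rewrite [RHS]mxE //.
      by rewrite (mulmx_colE x X2) e0 e1 !mulr0 addr0.
    by rewrite (mulmx_colE x X3) e0 e1 !mulr0 addr0.
  exists c => // x xA; rewrite (le_trans (hc x)) // ler_wpM2l //.
  have ent j : `|(x *m W) 0 j| <= `|(x *m X) 0 0| + `|(x *m X) 0 1|.
    rewrite WE xA; case: (split_ordP j) => k -> {j}.
      by rewrite row_mxEl mxE normr0 addr_ge0.
    rewrite row_mxEr; case: (split_ordP k) => k' -> {k}.
      by rewrite row_mxEl mxE lerDl.
    by rewrite row_mxEr mxE lerDr.
  by apply: mxnormP => i j; rewrite ord1; exact: ent.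
pose N := Num.bound (\sum_l \sum_m `|Y l m / F l m| + 1).
have NP l m : `|Y l m / F l m| + 1 <= N%:R.
  have N0 : 0 <= \sum_l \sum_m `|Y l m / F l m|.
    by rewrite sumr_ge0 // => ? _; rewrite sumr_ge0.
  have := archi_boundP (addr_ge0 N0 ler01); rewrite -/N.
  by have := @le_sum2 (fun l m => `|Y l m / F l m|) l m (fun _ _ => normr_ge0 _); lra.
pose K : R := 2 * N%:R * \sum_l \sum_m `|F l m|.
have KP l m : 2 * N%:R * `|F l m| <= K.
  by rewrite ler_wpM2l ?mulr_ge0 //; exact: (@le_sum2 (fun l m => `|F l m|)).
exists N, (16 * (c0 * c1 * `|C|) + 1) => rho hrho.
have rho0 : 0 < rho.
  by apply: lt_le_trans hrho; have := mulr_ge0 (mulr_ge0 c0_ge0 c1_ge0) (normr_ge0 C); lra.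
exists (deviation_bound C rho c0 c1 c2 c3 K al be ga de al' be' ga' de' c4).
move=> Z f Zf step y z Zy Zz.
apply: (bounded_irrational LA LX Xe Ye Yq Yq0 (fun l m _ => NP l m) c0_ge0 c1_ge0 c2_ge0
  c3_ge0 c0P c1P c2P c3P KP rho0 _ Zf step) => //.
have e : 4 * (c0 * c1 * (4 * C / rho)) = 16 * (c0 * c1 * C) / rho by field; rewrite gt_eqF.
rewrite e ler_pdivrMr // mul1r.
have := ler_wpM2l (mulr_ge0 c0_ge0 c1_ge0) (ler_norm C); lra.
Qed.

End QuasiPeriodic.

(** * Alternating forms in dimension four *)
Section Alternating.
Variable F : fieldType.
Implicit Types x y : 'rV[F]_6.

Lemma sum4 (f : 'I_4 -> F) : \sum_k f k = f 0 + f 1 + f 2 + f 3.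
Proof.
rewrite !big_ord_recl big_ord0 addr0 !addrA.
by congr (_ + f _ + f _ + f _); apply: val_inj.
Qed.

Lemma sum6 (f : 'I_6 -> F) : \sum_k f k = f 0 + f 1 + f 2 + f 3 + f 4 + f 5.
Proof.
rewrite !big_ord_recl big_ord0 addr0 !addrA.
by congr (_ + f _ + f _ + f _ + f _ + f _); apply: val_inj.
Qed.

(** The coordinates of 'rV_6 are indexed by the pairs 01, 02, 03, 12, 13, 23. *)
Definition alt x : 'M[F]_4 := \matrix_(i, j)
  match val i, val j with
  | 0%N, 1%N => x 0 0 | 0%N, 2%N => x 0 1 | 0%N, 3%N => x 0 2
  | 1%N, 2%N => x 0 3 | 1%N, 3%N => x 0 4 | 2%N, 3%N => x 0 5
  | 1%N, 0%N => - x 0 0 | 2%N, 0%N => - x 0 1 | 3%N, 0%N => - x 0 2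
  | 2%N, 1%N => - x 0 3 | 3%N, 1%N => - x 0 4 | 3%N, 2%N => - x 0 5
  | _, _ => 0
  end.

(** The Hodge dual: if x lists the Grassmann coordinates of a plane then the rows of
    alt (star x) are linear forms that span the annihilator of this plane. *)
Definition star x : 'rV[F]_6 := \row_k
  match val k with
  | 0%N => x 0 5 | 1%N => - x 0 4 | 2%N => x 0 3 | 3%N => x 0 2 | 4%N => - x 0 1 | _ => x 0 0
  end.

Lemma altE x :
  ((alt x 0 1 = x 0 0) * (alt x 0 2 = x 0 1) * (alt x 0 3 = x 0 2) *
   (alt x 1 2 = x 0 3) * (alt x 1 3 = x 0 4) * (alt x 2 3 = x 0 5)) *
  ((alt x 1 0 = - x 0 0) * (alt x 2 0 = - x 0 1) * (alt x 3 0 = - x 0 2) *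
   (alt x 2 1 = - x 0 3) * (alt x 3 1 = - x 0 4) * (alt x 3 2 = - x 0 5)) *
  ((alt x 0 0 = 0) * (alt x 1 1 = 0) * (alt x 2 2 = 0) * (alt x 3 3 = 0)).
Proof. by do !split; rewrite mxE. Qed.

Lemma starE x : (star x 0 0 = x 0 5) * (star x 0 1 = - x 0 4) * (star x 0 2 = x 0 3) *
  (star x 0 3 = x 0 2) * (star x 0 4 = - x 0 1) * (star x 0 5 = x 0 0).
Proof. by do !split; rewrite mxE. Qed.

Lemma alt_linear : linear alt.
Proof.
move=> a x y; apply/matrixP => i j; rewrite !mxE.
by case: (val i) (val j) => [|[|[|[|?]]]] [|[|[|[|?]]]]; ring.
Qed.

Lemma star_linear : linear star.
Proof.
move=> a x y; apply/rowP => k; rewrite !mxE.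
by case: (val k) => [|[|[|[|[|?]]]]]; ring.
Qed.

HB.instance Definition _ := GRing.isLinear.Build F 'rV[F]_6 'M[F]_4 _ alt alt_linear.
HB.instance Definition _ := GRing.isLinear.Build F 'rV[F]_6 'rV[F]_6 _ star star_linear.

Lemma alt_anti x i j : alt x j i = - alt x i j.
Proof. by move: i j; apply: ord4_ind; apply: ord4_ind; rewrite !altE ?opprK ?oppr0. Qed.

Lemma alt_diag x i : alt x i i = 0.
Proof. by move: i; apply: ord4_ind; rewrite altE. Qed.

Lemma alt_surj (M : 'M[F]_4) : (forall i j, M j i = - M i j) -> (forall i, M i i = 0) ->
  exists x, alt x = M.
Proof.
move=> anti diag; exists (\row_k match val k with
  | 0%N => M 0 1 | 1%N => M 0 2 | 2%N => M 0 3 | 3%N => M 1 2 | 4%N => M 1 3 | _ => M 2 3 end).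
apply/matrixP => i j; move: i j; apply: ord4_ind; apply: ord4_ind;
  by rewrite altE ?diag // mxE //= anti.
Qed.

Lemma starK x : star (star x) = x.
Proof.
apply/rowP => k; rewrite [LHS]mxE.
by case: k => [[|[|[|[|[|[|//]]]]]] hk] /=; rewrite starE ?opprK; congr (x 0 _); apply: val_inj.
Qed.

(** The polarisation of twice the Pfaffian. *)
Definition bil x y : F :=
  x 0 0 * y 0 5 + x 0 5 * y 0 0 - (x 0 1 * y 0 4 + x 0 4 * y 0 1) +
  (x 0 2 * y 0 3 + x 0 3 * y 0 2).

Lemma bilE x y : (x *m (star y)^T) 0 0 = bil x y.
Proof. by rewrite mxE sum6 ![_^T _ _]mxE !starE /bil; ring. Qed.

Lemma bilC x y : bil x y = bil y x.
Proof. rewrite /bil; ring. Qed.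
Lemma bilDl x y z : bil (x + y) z = bil x z + bil y z.
Proof. rewrite /bil !mxE; ring. Qed.
Lemma bilZl a x y : bil (a *: x) y = a * bil x y.
Proof. rewrite /bil !mxE; ring. Qed.
Lemma bilDr x y z : bil x (y + z) = bil x y + bil x z.
Proof. by rewrite bilC bilDl !(bilC x). Qed.
Lemma bilZr a x y : bil x (a *: y) = a * bil x y.
Proof. by rewrite bilC bilZl bilC. Qed.

(** The polarisation of the identity between an alternating matrix, its dual and its
    Pfaffian. *)
Lemma alt_star_mul x y :
  alt (star x) *m alt y + alt (star y) *m alt x = (- bil x y)%:M.
Proof.
apply/matrixP => i j; move: i j; apply: ord4_ind; apply: ord4_ind;
  by rewrite [LHS]mxE [in X in X + _ = _]mxE [in X in _ + X = _]mxE [RHS]mxE !sum4 !altE !starE /bil /=; ring.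
Qed.

(** The relation is alternating in i, j, k, l, hence follows from a single case. *)
Lemma alt_plucker x : bil x x = 0 -> (2 : F) != 0 -> forall i j k l,
  alt x i j * alt x k l = alt x i k * alt x j l - alt x i l * alt x j k.
Proof.
move=> bx n2; have e : x 0 0 * x 0 5 = x 0 1 * x 0 4 - x 0 2 * x 0 3.
  apply: (mulfI n2); rewrite -[LHS]subr0 -bx /bil; ring.
move=> i j k l; have [->|ij] := eqVneq i j; first by rewrite alt_diag; ring.
have [->|ik] := eqVneq i k; first by rewrite alt_diag [alt x j k]alt_anti; ring.
have [->|il] := eqVneq i l.
  by rewrite alt_diag [alt x l j]alt_anti [alt x l k]alt_anti; ring.
have [->|jk] := eqVneq j k; first by rewrite alt_diag; ring.
have [->|jl] := eqVneq j l; first by rewrite alt_diag [alt x l k]alt_anti; ring.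
have [->|kl] := eqVneq k l; first by rewrite alt_diag; ring.
move: ij ik il jk jl kl; move: i j k l.
apply: ord4_ind; apply: ord4_ind => //; apply: ord4_ind => //; apply: ord4_ind => // *;
  by rewrite !altE; ring: e.
Qed.

Lemma alt_starZ a x i j : alt (star (a *: x)) i j = a * alt (star x) i j.
Proof.
have -> : star (a *: x) = a *: star x by exact: linearZ.
have -> : alt (a *: star x) = a *: alt (star x) by exact: linearZ.
by rewrite mxE.
Qed.

Lemma alt_starD x y i j : alt (star (x + y)) i j = alt (star x) i j + alt (star y) i j.
Proof.
have -> : star (x + y) = star x + star y by exact: linearD.
have -> : alt (star x + star y) = alt (star x) + alt (star y) by exact: linearD.
by rewrite mxE.
Qed.

(** The value on (e_l, d) of the form alt (star x). *)
Definition ev x l (d : 'rV[F]_4) : F := \sum_j alt (star x) l j * d 0 j.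

Definition evmx l (d : 'rV[F]_4) : 'cV[F]_6 :=
  \col_k ev (delta_mx 0 k) l d.

Lemma evmxE x l d : (x *m evmx l d) 0 0 = ev x l d.
Proof.
rewrite mxE /ev {2}(row_sum_delta x) 2!linear_sum /=.
transitivity (\sum_j \sum_k x 0 k * alt (star (delta_mx 0 k)) l j * d 0 j).
  rewrite exchange_big; apply: eq_bigr => k _; rewrite mxE /ev big_distrr /=.
  by apply: eq_bigr => j _; rewrite mulrA.
apply: eq_bigr => j _; rewrite summxE big_distrl /=; apply: eq_bigr => k _.
by rewrite alt_starZ.
Qed.

Lemma evDl x y l d : ev (x + y) l d = ev x l d + ev y l d.
Proof.
rewrite /ev -big_split; apply: eq_bigr => j _ /=.
by rewrite alt_starD mulrDl.
Qed.

Lemma evZl a x l d : ev (a *: x) l d = a * ev x l d.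
Proof.
rewrite /ev big_distrr; apply: eq_bigr => j _ /=.
by rewrite alt_starZ mulrA.
Qed.

Lemma evE x l d : ev x l d = - (d *m alt (star x)) 0 l.
Proof.
rewrite mxE /ev -sumrN; apply: eq_bigr => j _.
by rewrite [alt (star x) l j]alt_anti mulNr mulrC.
Qed.

End Alternating.

(** * Rational subspaces *)
Section Rational.
Variable R : realType.
Local Notation rq := (map_mx (ratr : rat -> R)).

(** The common kernel of a set of rational linear forms is spanned by rational
    vectors, since finitely many of these forms, in maximal number among the
    independent ones, have the same common kernel. *)
Lemma rational_kernel n (Th : set 'rV[rat]_n) : exists B : 'M[rat]_n, forall x : 'rV[R]_n,
  (forall th, Th th -> x *m (rq th)^T = 0) <-> (x <= rq B)%MS.
Proof.
pose P k := `[< exists m (M : 'M[rat]_(m, n)), (forall i, Th (row i M)) /\ \rank M = k >].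
have P0 : exists k, P k.
  by exists 0%N; apply/asboolP; exists 0%N, 0; split => [[]//|]; rewrite mxrank0.
have Pn k : P k -> (k <= n)%N by move=> /asboolP[m [M [_ <-]]]; exact: rank_leq_col.
case: (ex_maxnP P0 Pn) => k /asboolP[m [M [hM rM]]] kmax.
exists (kermx M^T) => x.
have -> : (x <= rq (kermx M^T))%MS = (x *m (rq M)^T == 0).
  by rewrite map_kermx map_trmx sub_kermx.
split=> [h|/eqP h th Tth].
  apply/eqP; apply/rowP => i; have := congr1 (fun w : 'M[R]_1 => w 0 0) (h _ (hM i)).
  rewrite !mxE => e; rewrite -[RHS]e; by apply: eq_bigr => j _; rewrite !mxE.
have /submxP[w ->] : (th <= M)%MS.
  have : (col_mx M th <= M)%MS.
    have sub : (M <= col_mx M th)%MS by rewrite -addsmxE addsmxSl.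
    rewrite -(mxrank_leqif_sup sub).2 // eqn_leq mxrankS //= rM kmax //.
    apply/asboolP; exists (m + 1)%N, (col_mx M th); split => // i.
    case: (split_ordP i) => j -> {i}; first by rewrite rowKu.
    by rewrite rowKd row_id.
  by rewrite col_mx_sub => /andP[].
by rewrite map_mxM trmx_mul mulmxA h mul0mx.
Qed.

Definition rational_line n (g : 'rV[R]_n) := exists (c : R) r, g = c *: rq r.

(** By rational_kernel, as a rational basis of a line generates it. *)
Lemma line_rational n (Th : set 'rV[rat]_n) (g : 'rV[R]_n) : g != 0 ->
  (forall th, Th th -> g *m (rq th)^T = 0) ->
  (forall x : 'rV[R]_n, (forall th, Th th -> x *m (rq th)^T = 0) -> exists c, x = c *: g) ->
  rational_line g.
Proof.
move=> g0 hg line; have [B hB] := rational_kernel Th.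
have gB : (g <= rq B)%MS by apply/hB.
have [i Bi] : exists i, rq (row i B) != 0.
  apply/not_existsP => h; move: g0; suff -> : g = 0 by rewrite eqxx.
  apply/eqP; rewrite -submx0; apply: submx_trans gB _; apply/row_subP => i.
  by have /negP/negPn/eqP := h i; rewrite map_row => ->; exact: sub0mx.
have [|c e] := line (rq (row i B)); first by apply/hB; rewrite map_row; exact: row_sub.
have c0 : c != 0 by apply: contra Bi => /eqP c0; rewrite e c0 scale0r.
by exists c^-1, (row i B); rewrite e scalerA mulVf // scale1r.
Qed.

Lemma rq_alt x : rq (alt x) = alt (rq x).
Proof.
apply/matrixP => i j; rewrite !mxE.
by case: (val i) (val j) => [|[|[|[|?]]]] [|[|[|[|?]]]]; rewrite ?rmorphN ?rmorph0.
Qed.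

Lemma rq_star x : rq (star x) = star (rq x).
Proof.
apply/rowP => k; rewrite !mxE.
by case: (val k) => [|[|[|[|[|?]]]]]; rewrite ?rmorphN.
Qed.

Lemma rq_ev x l d : ev (rq x) l (rq d) = ratr (ev x l d).
Proof.
rewrite /ev rmorph_sum; apply: eq_bigr => j _.
by rewrite -rq_star -rq_alt rmorphM; congr (_ * _); rewrite mxE.
Qed.

Lemma rq_evmx l d : rq (evmx l d) = evmx l (rq d).
Proof.
by apply/colP => k; rewrite !mxE -rq_ev map_delta_mx.
Qed.

Lemma rq_bil x y : bil (rq x) (rq y) = ratr (bil x y).
Proof. by rewrite /bil !mxE rmorphD rmorphB !rmorphD !rmorphM. Qed.

Lemma clear_denominators n (d : 'rV[rat]_n) : exists2 N : nat, (0 < N)%N &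
  forall k, ratr (N%:R * d 0 k) \is a @Num.int R.
Proof.
exists (\prod_k absz (denq (d 0%R k)))%N.
  by rewrite prodn_gt0 // => k; rewrite absz_gt0 denq_neq0.
move=> k; rewrite (bigD1 k) //= natrM mulrAC [_ * d 0 k]mulrC.
have -> : (absz (denq (d 0 k)))%:R = (denq (d 0 k))%:~R :> rat.
  by rewrite -{2}[denq (d 0 k)]absz_denq -pmulrn.
have -> : d 0 k * (denq (d 0 k))%:~R = (numq (d 0 k))%:~R.
  by rewrite -{1}[d 0 k]divq_num_den divfK // intr_eq0 denq_neq0.
by rewrite rmorphM /= ratr_int ratr_nat rpredM ?intr_int ?natr_int.
Qed.

End Rational.

(** * The two solutions of the system of an irrational slope *)
Section TwoSolutions.
Variables (R : realType) (g : 'rV[R]_6).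
Local Notation rq := (map_mx (ratr : rat -> R)).
Implicit Types x y h : 'rV[R]_6.
Hypothesis g0 : g != 0.
Hypothesis gg : bil g g = 0.

Definition solution x := forall l (d : 'rV[rat]_4), ev g l (rq d) = 0 -> ev x l (rq d) = 0.

Hypothesis fin : exists s : seq 'rV[R]_6, forall x, solution x -> bil x x = 0 -> x != 0 ->
  exists y c, [/\ y \in s, c != 0 & x = c *: y].
Hypothesis irr : ~ rational_line g.

Definition relation_rows : set 'rV[rat]_6 :=
  [set th | exists l d, ev g l (rq d) = 0 /\ th = (evmx l d)^T].

Lemma mx11_eq0 (M : 'M[R]_1) : M 0 0 = 0 <-> M = 0.
Proof. by split=> [h|->]; [apply/matrixP => i j; rewrite !ord1 h|]; rewrite mxE. Qed.

Lemma solution_kernel x : solution x <-> forall th, relation_rows th -> x *m (rq th)^T = 0.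
Proof.
split=> [h th [l [d [gd ->]]]|h l d gd].
  by apply/mx11_eq0; rewrite map_trmx trmxK rq_evmx evmxE h.
rewrite -evmxE -rq_evmx; apply/mx11_eq0; rewrite -[evmx l d]trmxK -map_trmx.
by apply: h; exists l, d.
Qed.

Lemma bil_kernel x r : x *m (rq (star r))^T = 0 <-> bil x (rq r) = 0.
Proof. by rewrite -bilE -rq_star; split => /mx11_eq0. Qed.

Lemma solution_self : solution g. Proof. by []. Qed.

Lemma solutionD x y : solution x -> solution y -> solution (x + y).
Proof. by move=> hx hy l d gd; rewrite evDl hx // hy // addr0. Qed.

Lemma solutionZ a x : solution x -> solution (a *: x).
Proof. by move=> hx l d gd; rewrite evZl hx // mulr0. Qed.

Lemma solution_pigeonhole (ga : nat -> 'rV[R]_6) :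
  (forall n, [/\ solution (ga n), bil (ga n) (ga n) = 0 & ga n != 0]) ->
  exists n m c, n != m /\ ga n = c *: ga m.
Proof.
move=> h; have [s hs] := fin.
have /choice[y hy] : forall n, exists y, exists c, [/\ y \in s, c != 0 & ga n = c *: y].
  by move=> n; have [h1 h2 h3] := h n; exact: hs.
have [n [m [nm e]]] : exists n m, n != m /\ y n = y m.
  apply/not_notP => inj.
  have : (size (map y (iota 0 (size s).+1)) <= size s)%N.
    apply: uniq_leq_size => [|z /mapP[n _ ->]]; last by have [c []] := hy n.
    rewrite map_inj_uniq ?iota_uniq // => n m e; apply/eqP/negPn/negP => nm.
    by apply: inj; exists n, m.
  by rewrite size_map size_iota ltnn.
have [c [_ c0 e1]] := hy n; have [c' [_ c0' e2]] := hy m.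
by exists n, m, (c / c'); split => //; rewrite e1 e2 e scalerA divfK.
Qed.

(** Otherwise g would span the radical of a rational space. *)
Lemma solution_nondegenerate : exists2 h, solution h & bil g h != 0.
Proof.
apply/not_exists2P => deg; apply: irr.
have gV x : solution x -> bil g x = 0.
  by move=> Vx; have [|/negP/negPn/eqP] := deg x.
have [B hB] := rational_kernel R relation_rows.
have VB x : solution x <-> (x <= rq B)%MS by rewrite -hB; exact: solution_kernel.
have rowV i : solution (rq (row i B)) by apply/VB; rewrite map_row row_sub.
pose Th := relation_rows `|` [set star (row i B) | i in setT].
apply: (@line_rational _ _ Th) => //.
  move=> th [h|[i _ <-]]; first exact: ((solution_kernel g).1 solution_self th h).
  by apply/bil_kernel/gV.
move=> x hx.
have Vx : solution x by apply/solution_kernel => th h; apply: hx; left.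
have xV y : solution y -> bil x y = 0.
  move=> /VB/submxP[w ->]; rewrite mulmx_sum_row.
  elim/big_ind: _ => [|a b ha hb|i _].
  - by rewrite -(scale0r 0) bilZr mul0r.
  - by rewrite bilDr ha hb addr0.
  - rewrite bilZr -map_row; have -> : bil x (rq (row i B)) = 0; last by rewrite mulr0.
    by apply/bil_kernel/hx; right; exists i.
have [//|nx] := EM (exists c, x = c *: g).
have [|n [m [c [nm e]]]] := @solution_pigeonhole (fun n => g + n%:R *: x).
  move=> n; split.
  - by apply: solutionD => //; exact: solutionZ.
  - by rewrite !bilDl !bilDr !bilZl !bilZr gg gV // !xV // !mulr0 !addr0.
  - apply/eqP => e; have [n0|n0] := eqVneq (n%:R : R) 0.
      by move: e; rewrite n0 scale0r addr0; apply/eqP.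
    apply: nx; exists (- n%:R^-1); move/eqP: e; rewrite addr_eq0 => /eqP ->.
    by rewrite scalerN scaleNr opprK scalerA mulVf // scale1r.
have e' : (1 - c) *: g = (c * m%:R - n%:R) *: x.
  rewrite !scalerBl scale1r -scalerA; apply/eqP; rewrite subr_eq addrAC -subr_eq opprK.
  by rewrite e scalerDr addrC.
have [z|z] := eqVneq (c * m%:R - n%:R) 0; last first.
  exists ((c * m%:R - n%:R)^-1 * (1 - c)).
  by rewrite -scalerA e' scalerA mulVf // scale1r.
move: e'; rewrite z scale0r => /eqP; rewrite scaler_eq0 (negPf g0) orbF.
rewrite subr_eq0 => /eqP c1; move: z; rewrite -c1 mul1r => /eqP; rewrite subr_eq0 eqr_nat.
by rewrite eq_sym (negPf nm).
Qed.

(** The line from g in a direction h which is not orthogonal to g meets the quadric of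
    isotropic vectors again, possibly at infinity. *)
Lemma second_solution : exists g', [/\ solution g', bil g' g' = 0 & bil g g' != 0].
Proof.
have [h Vh gh] := solution_nondegenerate.
have [hh|hh] := eqVneq (bil h h) 0; first by exists h.
pose t := - (2 * bil g h) / bil h h.
have t0 : t != 0 by rewrite mulf_neq0 ?invr_eq0 // oppr_eq0 mulf_neq0 // pnatr_eq0.
exists (g + t *: h); split.
- by apply: solutionD => //; exact: solutionZ.
- by rewrite !bilDl !bilDr !bilZl !bilZr gg (bilC h g) /t; field.
- by rewrite bilDr gg add0r bilZr mulf_neq0.
Qed.

Section WithSecond.
Variable g' : 'rV[R]_6.
Hypotheses (Vg' : solution g') (gg' : bil g' g' = 0) (b0 : bil g g' != 0).

(** Otherwise the isotropic vectors of the space of solutions would contain a conic. *)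
Lemma solution_span x : solution x -> exists a b, x = a *: g + b *: g'.
Proof.
move=> Vx; set a := bil g' x / bil g g'; set b := bil g x / bil g g'.
exists a, b; apply/eqP; rewrite -subr_eq0; apply/negPn/negP.
set y := x - _ => y0.
have Vy : solution y.
  rewrite /y -scaleN1r; apply: solutionD => //; apply: solutionZ.
  by apply: solutionD; exact: solutionZ.
have yE : y = x + (- a) *: g + (- b) *: g' by rewrite /y opprD addrA !scaleNr.
have gy : bil g y = 0 by rewrite yE !bilDr !bilZr gg /b; field.
have g'y : bil g' y = 0 by rewrite yE !bilDr !bilZr gg' (bilC g' g) /a; field.
clearbody y.
pose c := - bil y y / (2 * bil g g').
pose ga n := n.+1%:R *: g + (c / n.+1%:R) *: g' + y.
have bga n : bil (ga n) g' = n.+1%:R * bil g g'.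
  by rewrite /ga !bilDl !bilZl gg' (bilC y) g'y mulr0 !addr0.
have n0 n : n.+1%:R != 0 :> R by rewrite pnatr_eq0.
have [|n [m [k [nm e]]]] := @solution_pigeonhole ga.
  move=> n; split.
  - by do 2 apply: solutionD => //; exact: solutionZ.
  - rewrite /ga !bilDl !bilZl !bilDr !bilZr gg gg' gy g'y (bilC y g) (bilC y g') gy g'y (bilC g' g).
    by move: (n.+1%:R : R) (n0 n) => s s0; rewrite /c; field; rewrite b0 s0.
  - apply/eqP => e; have := bga n; rewrite e -(scale0r 0) bilZl mul0r => /esym/eqP.
    by rewrite mulf_eq0 (negPf (n0 n)) (negPf b0).
have kE : n.+1%:R = k * m.+1%:R.
  by apply: (mulIf b0); rewrite -mulrA -!bga e bilZl.
have k1 : 1 - k != 0.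
  apply/eqP => /eqP; rewrite subr_eq0 => /eqP k1; move: kE; rewrite -k1 mul1r => /eqP.
  by rewrite eqr_nat eqSS (negPf nm).
have e' : (1 - k) *: y = (k * (c / m.+1%:R) - c / n.+1%:R) *: g'.
  apply/rowP => j; have := congr1 (fun w : 'rV[R]_6 => w 0 j) e; rewrite !mxE => ej.
  apply/eqP; rewrite -subr_eq0.
  rewrite (_ : _ - _ = (n.+1%:R * g 0 j + c / n.+1%:R * g' 0 j + y 0 j) -
    k * (m.+1%:R * g 0 j + c / m.+1%:R * g' 0 j + y 0 j) - (n.+1%:R - k * m.+1%:R) * g 0 j).
    by rewrite ej kE !subrr mul0r subrr.
  ring.
set la := (k * _ - _) in e'; have la0 : la = 0.
  have := congr1 (bil g) e'; rewrite !bilZr gy mulr0 => /esym/eqP.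
  by rewrite mulf_eq0 (negPf b0) orbF => /eqP.
by move/eqP: e'; rewrite la0 scale0r scaler_eq0 (negPf k1) (negPf y0).
Qed.

(** A rational form that would vanish on g1 but not on g2 would single out the line of g1
    in a rational space. *)
Lemma relation_transfer g1 g2 (th : 'rV[rat]_6) : solution g1 -> g1 != 0 -> ~ rational_line g1 ->
  (forall x, solution x -> exists a b, x = a *: g1 + b *: g2) ->
  g1 *m (rq th)^T = 0 -> g2 *m (rq th)^T = 0.
Proof.
move=> V1 g10 irr1 span h1; apply/eqP/negPn/negP => h2; apply: irr1.
apply: (@line_rational _ _ (relation_rows `|` [set th])) => //.
  by move=> ? [/((solution_kernel g1).1 V1)|->].
move=> x hx; have [|a [b xE]] := span x.
  by apply/solution_kernel => ? ?; apply: hx; left.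
exists a; have := hx th (or_intror erefl); rewrite xE mulmxDl -!scalemxAl h1 scaler0 add0r.
by move=> /eqP; rewrite scaler_eq0 (negPf h2) orbF => /eqP ->; rewrite scale0r addr0.
Qed.

(** A rational plane of solutions has a rational vector besides g'; on the line through
    it in the direction g', the other isotropic point is rational, and it is g. *)
Lemma second_irrational : ~ rational_line g'.
Proof.
move=> [c [r g'E]]; apply: irr.
have c0 : c != 0.
  by apply: contra b0 => /eqP c0; rewrite g'E c0 scale0r -(scale0r 0) bilZr mul0r.
have [B hB] := rational_kernel R relation_rows.
have VB x : solution x <-> (x <= rq B)%MS by rewrite -hB; exact: solution_kernel.
have [i hi] : exists i, bil g' (rq (row i B)) != 0.
  apply/not_existsP => h; have /VB/submxP[w gw] : solution g by [].
  suff : bil g' g = 0 by move/eqP; rewrite bilC (negPf b0).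
  rewrite gw mulmx_sum_row.
  elim/big_ind: _ => [|a b ha hb|i _].
  - by rewrite -(scale0r 0) bilZr mul0r.
  - by rewrite bilDr ha hb addr0.
  - by rewrite bilZr -map_row; have /negP/negPn/eqP -> := h i; rewrite mulr0.
set h := row i B in hi.
have [|a [b hE]] := @solution_span (rq h); first by apply/VB; rewrite map_row row_sub.
have hg' : bil g' (rq h) = a * bil g g' by rewrite hE bilDr !bilZr gg' mulr0 addr0 bilC.
have hh : bil (rq h) (rq h) = 2 * a * b * bil g g'.
  by rewrite {1}hE bilDl !bilZl hg' hE bilDr !bilZr gg; ring.
have a0 : a != 0 by apply: contra hi => /eqP a0; rewrite hg' a0 mul0r.
have rh : bil (rq r) (rq h) != 0.
  by apply: contra hi => /eqP rh; rewrite g'E bilZl rh mulr0.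
exists a^-1, (h - (bil h h / (2 * bil r h)) *: r).
have -> : rq (h - (bil h h / (2 * bil r h)) *: r) =
   rq h - (bil (rq h) (rq h) / (2 * bil (rq r) (rq h))) *: rq r.
  rewrite map_mxB map_mxZ; congr (_ - _ *: _).
  by rewrite !rq_bil fmorph_div rmorphM /= rmorph_nat.
have -> : (bil (rq h) (rq h) / (2 * bil (rq r) (rq h))) *: rq r = b *: g'.
  have e : a * bil g g' = c * bil (rq r) (rq h) by rewrite -hg' g'E bilZl.
  rewrite hh (_ : 2 * a * b * _ = 2 * b * (a * bil g g')); last by ring.
  by rewrite e g'E scalerA; congr (_ *: _); field.
by rewrite hE addrK scalerA mulVf // scale1r.
Qed.

Lemma relation_conjugate (th : 'rV[rat]_6) :
  g *m (rq th)^T = 0 <-> g' *m (rq th)^T = 0.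
Proof.
split; first exact: relation_transfer solution_span.
apply: relation_transfer => //; first by apply: contra b0 => /eqP ->; rewrite -(scale0r 0) bilZr mul0r.
  exact: second_irrational.
by move=> x /solution_span[a [b ->]]; exists b, a; rewrite addrC.
Qed.

Lemma ev_conjugate l (d : 'rV[rat]_4) : ev g l (rq d) = 0 <-> ev g' l (rq d) = 0.
Proof.
have e x : ev x l (rq d) = 0 <-> x *m (rq (evmx l d)^T)^T = 0.
  by rewrite -mx11_eq0 map_trmx trmxK rq_evmx evmxE.
by rewrite !e; exact: relation_conjugate.
Qed.

End WithSecond.
End TwoSolutions.

(** * Irrational slopes are quasi-periodic *)
Section Irrational.
Variables (R : realType) (L : 'M[R]_(2, 4)) (g g' : 'rV[R]_6).
Local Notation rq := (map_mx (ratr : rat -> R)).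
Implicit Types x : 'rV[R]_6.
Hypothesis gE : forall i j, alt g i j = grass L i j.
Hypotheses (gg : bil g g = 0) (gg' : bil g' g' = 0) (b0 : bil g g' != 0).
Hypothesis conj : forall l (d : 'rV[rat]_4), ev g l (rq d) = 0 <-> ev g' l (rq d) = 0.
Hypothesis span : forall x, solution g x -> exists a b, x = a *: g + b *: g'.

Let X := alt (star g).
Let Y := alt (star g').

Let two_neq0 : (2 : R) != 0. Proof. by rewrite pnatr_eq0. Qed.

Lemma alt_star_self x : bil x x = 0 -> alt (star x) *m alt x = 0.
Proof.
move=> h; have := alt_star_mul x x; rewrite h oppr0 -mulr2n -scaler_nat => /eqP.
by rewrite raddf0 scaler_eq0 (negPf two_neq0) => /eqP.
Qed.

Lemma mixed : X *m alt g' + Y *m alt g = (- bil g g')%:M.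
Proof. exact: alt_star_mul. Qed.

Lemma mixed' : alt g' *m X + alt g *m Y = (- bil g g')%:M.
Proof.
have := alt_star_mul (star g') (star g); rewrite !starK => ->; congr (- _)%:M.
by rewrite /bil !starE; ring.
Qed.

Lemma annihilators_meet (w : 'rV[R]_4) : w *m X = 0 -> w *m Y = 0 -> w = 0.
Proof.
move=> hX hY; have := congr1 (mulmx w) mixed.
rewrite mulmxDr !mulmxA hX hY !mul0mx addr0 mul_mx_scalar => /esym/eqP.
by rewrite scaler_eq0 oppr_eq0 (negPf b0) => /eqP.
Qed.

Lemma ev_delta x l j : ev x l (delta_mx 0 j) = alt (star x) l j.
Proof.
rewrite /ev (bigD1 j) //= big1 => [|i ij]; first by rewrite [X in _ * X]mxE !eqxx mulr1 addr0.
by rewrite [X in _ * X]mxE eqxx (negPf ij) mulr0.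
Qed.

Lemma conj_coord l j : X l j = 0 <-> Y l j = 0.
Proof. by rewrite -!ev_delta -(map_delta_mx (ratr : rat -> R)); exact: conj. Qed.

Lemma row_neq0 l : exists k, X l k != 0.
Proof.
apply/not_existsP => h; have hX k : X l k = 0 by have /negP/negPn/eqP := h k.
have : delta_mx 0 l = 0 :> 'rV[R]_4.
  by apply: annihilators_meet; rewrite -rowE; apply/rowP => k; rewrite [LHS]mxE [RHS]mxE //; apply/conj_coord.
by move/rowP/(_ l)/eqP; rewrite !mxE !eqxx oner_eq0.
Qed.

Lemma rows_not_proportional l c : ~ forall j, X l j = c * Y l j.
Proof.
move=> h; have rE : row l X = c *: row l Y by apply/rowP => j; rewrite [LHS]mxE h [RHS]mxE [row l Y 0 j]mxE.
have c0 : c != 0.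
  by have [k] := row_neq0 l; apply: contra => /eqP c0; rewrite h c0 mul0r.
have hY : row l Y *m alt g' = 0 by rewrite -row_mul (alt_star_self gg') row0.
have hX : row l X *m alt g = 0 by rewrite -row_mul (alt_star_self gg) row0.
have YE : row l Y = c^-1 *: row l X by rewrite rE scalerA mulVf // scale1r.
have hX' : row l X *m alt g' = 0 by rewrite rE -scalemxAl hY scaler0.
have hY' : row l Y *m alt g = 0 by rewrite YE -scalemxAl hX scaler0.
have := congr1 (row l) mixed; rewrite linearD /= !row_mul hX' hY' addr0 => /rowP/(_ l).
by rewrite !mxE eqxx mulr1n => /esym/eqP; rewrite oppr_eq0 (negPf b0).
Qed.

Lemma fourth (l j k : 'I_4) : uniq [:: l; j; k] -> exists m, m != l /\
  (forall P : 'I_4 -> Prop, P l -> P j -> P k -> P m -> forall p, P p) /\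
  forall f : 'I_4 -> R, \sum_i f i = f l + f j + f k + f m.
Proof.
move: l j k; apply: ord4_ind; apply: ord4_ind; apply: ord4_ind => // _.
all: first [exists 0; split=> //; split=> [P *|f]; [exact: ord4_ind|rewrite sum4; ring]
  |exists 1; split=> //; split=> [P *|f]; [exact: ord4_ind|rewrite sum4; ring]
  |exists 2; split=> //; split=> [P *|f]; [exact: ord4_ind|rewrite sum4; ring]
  |exists 3; split=> //; split=> [P *|f]; [exact: ord4_ind|rewrite sum4; ring]].
Qed.

(** Two independent relations on the same three coordinates determine a form up to a
    factor, whereas two solutions satisfy them. *)
Lemma relations_proportional l (d d' : 'rV[rat]_4) : ev g l (rq d) = 0 ->
  ev g l (rq d') = 0 -> forall j k, j != l -> k != l -> d 0 j * d' 0 k = d 0 k * d' 0 j.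
Proof.
move=> h h' j k jl kl; have [->//|jk] := eqVneq j k.
apply/eqP; rewrite -subr_eq0; apply/negPn/negP => D0.
have [|m [ml [cover sumE]]] := @fourth l j k.
  by rewrite /= !inE negb_or !(eq_sym l) jl kl jk.
have e x : alt (star x) l l = 0 by exact: alt_diag.
have hX := h; rewrite /ev sumE -/X (e g : X l l = 0) mul0r add0r in hX.
have hX' := h'; rewrite /ev sumE -/X (e g : X l l = 0) mul0r add0r in hX'.
have hY := (conj l d).1 h; rewrite /ev sumE -/Y (e g' : Y l l = 0) mul0r add0r in hY.
have hY' := (conj l d').1 h'; rewrite /ev sumE -/Y (e g' : Y l l = 0) mul0r add0r in hY'.
have D0' : rq d 0 j * rq d' 0 k - rq d 0 k * rq d' 0 j != 0.
  by rewrite !mxE -!rmorphM -rmorphB fmorph_eq0.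
move: (rq d 0 j) (rq d 0 k) (rq d 0 m) (rq d' 0 j) (rq d' 0 k) (rq d' 0 m) D0' hX hX' hY hY'.
move=> a b c a' b' c' D hX hX' hY hY'.
have sol (z : 'I_4 -> R) : z j * a + z k * b + z m * c = 0 -> z j * a' + z k * b' + z m * c' = 0 ->
   z j = z m * ((b * c' - c * b') / (a * b' - b * a')) /\ z k = z m * ((c * a' - a * c') / (a * b' - b * a')).
  move=> h1 h2; split; apply: (mulIf D); rewrite mulrA divfK // mulrBr.
    rewrite -[LHS]subr0 -(mulr0 b') -h1 -[LHS]addr0 -(mulr0 b) -h2; ring.
  rewrite -[LHS]subr0 -(mulr0 a) -h2 -[LHS]addr0 -(mulr0 a') -h1; ring.
have [Xj Xk] := sol (X l) hX hX'; have [Yj Yk] := sol (Y l) hY hY'.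
have Xm : X l m != 0.
  apply/eqP => z; have [p] := row_neq0 l; rewrite -[X l p]/((fun p => X l p) p).
  suff -> : X l p = 0 by rewrite eqxx.
  by move: p; apply: cover; rewrite ?Xj ?Xk ?z ?mul0r // (e g : X l l = 0).
have Ym : Y l m != 0 by apply: contra Xm => /eqP/conj_coord ->.
apply: (@rows_not_proportional l (X l m / Y l m)).
apply: cover; rewrite ?(e g : X l l = 0) ?(e g' : Y l l = 0) ?mulr0 //.
- by rewrite Xj Yj [RHS]mulrA divfK.
- by rewrite Xk Yk [RHS]mulrA divfK.
- by rewrite divfK.
Qed.

Lemma ev_eq0_off x l (d : 'rV[R]_4) : (forall k, k != l -> d 0 k = 0) -> ev x l d = 0.
Proof.
move=> h; rewrite /ev big1 // => k _; have [->|kl] := eqVneq k l.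
  by rewrite alt_diag mul0r.
by rewrite h // mulr0.
Qed.

(** By relations_proportional; d is zero when l has no relation at all. *)
Lemma exists_relation l : exists d : 'rV[rat]_4, ev g l (rq d) = 0 /\
  forall d', ev g l (rq d') = 0 -> exists c : R, forall x, ev x l (rq d') = c * ev x l (rq d).
Proof.
have [[d [k [kl dk gd]]]|none] := EM (exists (d : 'rV[rat]_4) k,
    [/\ k != l, d 0 k != 0 & ev g l (rq d) = 0]).
  exists d; split => // d' gd'; exists (ratr (d' 0 k / d 0 k)) => x.
  rewrite /ev big_distrr; apply: eq_bigr => j _ /=; have [->|jl] := eqVneq j l.
    by rewrite alt_diag !mul0r mulr0.
  rewrite mulrCA; congr (_ * _).
  have -> : rq d' 0 j = ratr (d' 0 j) by rewrite mxE.
  have -> : rq d 0 j = ratr (d 0 j) by rewrite mxE.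
  rewrite -rmorphM; congr ratr; apply: (mulIf dk).
  by rewrite mulrAC divfK // mulrC -(relations_proportional gd gd' jl kl) mulrC.
exists 0; split=> [|d' gd']; first by rewrite map_mx0 ev_eq0_off // => k _; rewrite mxE.
exists 0 => x; rewrite mul0r ev_eq0_off // => k kl; rewrite mxE.
have [->|dk] := eqVneq (d' 0 k) 0; first exact: rmorph0.
by case: none; exists d', k.
Qed.

(** The space of solutions has dimension two, hence three relations cannot suffice. *)
Lemma relation_needed (dd : 'I_4 -> 'rV[rat]_4) l0 :
  (forall l d', ev g l (rq d') = 0 -> exists c : R, forall x, ev x l (rq d') = c * ev x l (rq (dd l))) ->
  exists x, (forall l, l != l0 -> ev x l (rq (dd l)) = 0) /\ ev x l0 (rq (dd l0)) != 0.
Proof.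
move=> hdd.
pose Phi : 'M[R]_(6, 3) := \matrix_(k, i) evmx (lift l0 i) (rq (dd (lift l0 i))) k 0.
have [i hi] : exists i, ~~ (row i (kermx Phi) <= col_mx g g')%MS.
  apply/not_existsP => h.
  have : (kermx Phi <= col_mx g g')%MS by apply/row_subP => i; have /negP/negPn := h i.
  move/mxrankS; rewrite mxrank_ker leqNgt.
  have -> // : (\rank (col_mx g g') < 6 - \rank Phi)%N.
  have := rank_leq_row (col_mx g g'); have := rank_leq_col Phi; lia.
set x := row i _ in hi.
have xP l : l != l0 -> ev x l (rq (dd l)) = 0.
  rewrite eq_sym => /unlift_some[j -> _].
  have : x *m Phi = 0 by rewrite -row_mul mulmx_ker row0.
  move/rowP/(_ j); rewrite [RHS]mxE => <-; rewrite -evmxE !mxE.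
  by apply: eq_bigr => k _; congr (_ * _); rewrite [RHS]mxE.
exists x; split => //; apply: contra hi => /eqP x0.
have /span[a [b ->]] : solution g x.
  move=> l d gd; have [c ->] := hdd l d gd.
  by have [->|ll0] := eqVneq l l0; rewrite ?x0 ?xP ?mulr0.
rewrite addmx_sub ?scalemx_sub //; apply: submx_trans (submx_refl _) _.
  by rewrite -addsmxE addsmxSl.
by rewrite -addsmxE addsmxSr.
Qed.

(** Otherwise e_n would be a relation of m and e_m one of n, which are the same equation,
    so that the relations of the l other than n would suffice. *)
Lemma coord_neq0 m n : m != n -> X m n != 0.
Proof.
move=> mn; apply/eqP => Xmn.
have [dd hdd] := choice exists_relation.
have hdd2 l := (hdd l).2.
have [x [x0 xn]] := relation_needed n hdd2.
have e1 : ev g n (rq (delta_mx 0 m)) = 0.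
  by rewrite map_delta_mx ev_delta alt_anti -/X Xmn oppr0.
have e2 : ev g m (rq (delta_mx 0 n)) = 0 by rewrite map_delta_mx ev_delta.
have [c hc] := hdd2 n _ e1; have [c' hc'] := hdd2 m _ e2.
have c0 : c = 0.
  apply: (mulIf xn); rewrite mul0r -hc map_delta_mx ev_delta alt_anti -ev_delta.
  by rewrite -(map_delta_mx (ratr : rat -> R)) hc' x0 // mulr0 oppr0.
have [i j|i|y hy] := @alt_surj R (delta_mx n m - delta_mx m n).
- by rewrite !mxE opprB andbC [(j == m) && _]andbC.
- by rewrite !mxE andbC subrr.
have := hc (star y); rewrite c0 mul0r map_delta_mx ev_delta starK hy !mxE !eqxx (negPf mn) /=.
by rewrite andbF subr0 => /eqP; rewrite oner_eq0.
Qed.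

Lemma coord_neq0' m n : m != n -> Y m n != 0.
Proof. by move=> /coord_neq0; apply: contra => /eqP/conj_coord/eqP. Qed.

Lemma grass_star : L *m X = 0.
Proof.
apply/matrixP => r j; rewrite [RHS]mxE mxE sum4 /X.
have E := (altE g, gE); have h (i k : 'I_4) := gE i k.
move: (h 0 1) (h 0 2) (h 0 3) (h 1 2) (h 1 3) (h 2 3); rewrite !altE => a b c d e f.
move: j; apply: ord4_ind; rewrite !altE !starE ?a ?b ?c ?d ?e ?f /grass;
  by case: (ord2P r) => ->; ring.
Qed.

(** The entry X 2 3 = G_01 is nonzero, so two coordinates determine u. *)
Lemma star_ker (w : 'rV[R]_4) : w *m X = 0 -> exists u, w = u *m L.
Proof.
move=> wX; have h : grass L 0 1 = X 2 3 by rewrite -gE /X !altE starE.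
have D : grass L 0 1 != 0 by rewrite h coord_neq0.
pose a := (w 0 0 * L 1 1 - w 0 1 * L 1 0) / grass L 0 1.
pose b := (w 0 1 * L 0 0 - w 0 0 * L 0 1) / grass L 0 1.
pose u : 'rV[R]_2 := \row_k (if k == 0 then a else b).
have uL k : (u *m L) 0 k = a * L 0 k + b * L 1 k by rewrite mulL_E !mxE.
exists u; apply/eqP; rewrite -subr_eq0; set y := w - _.
have yE k : y 0 k = w 0 k - (a * L 0 k + b * L 1 k) by rewrite /y -uL !mxE.
have yX : y *m X = 0 by rewrite /y mulmxBl wX -mulmxA grass_star mulmx0 subrr.
have y0 : y 0 0 = 0 by rewrite yE /a /b; move: D; rewrite /grass => D; field.
have y1 : y 0 1 = 0 by rewrite yE /a /b; move: D; rewrite /grass => D; field.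
clearbody y.
have y2 : y 0 2 = 0.
  have := congr1 (fun z : 'rV[R]_4 => z 0 3) yX; rewrite mxE [RHS]mxE sum4 y0 y1 {2}/X alt_diag.
  rewrite !mul0r mulr0 !add0r addr0 => /eqP; rewrite mulf_eq0 (negPf (@coord_neq0 2 3 isT)) orbF.
  by move/eqP.
have y3 : y 0 3 = 0.
  have := congr1 (fun z : 'rV[R]_4 => z 0 2) yX; rewrite mxE [RHS]mxE sum4 y0 y1 y2.
  rewrite !mul0r !add0r => /eqP; rewrite mulf_eq0 (negPf (@coord_neq0 3 2 isT)) orbF.
  by move/eqP.
by apply/eqP/rowP; apply: ord4_ind; rewrite [RHS]mxE.
Qed.

Lemma mul_plucker x (w : 'rV[R]_4) j l m : bil x x = 0 ->
  (w *m alt x) 0 j * alt x l m = (w *m alt x) 0 l * alt x j m - (w *m alt x) 0 m * alt x j l.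
Proof.
move=> h; rewrite ![(w *m _) 0 _]mxE !big_distrl -sumrB; apply: eq_bigr => i _ /=.
by rewrite -!mulrA -mulrBr (alt_plucker h two_neq0 i j l m) mulrBr.
Qed.

Lemma bil_star x y : bil (star x) (star y) = bil x y.
Proof. by rewrite /bil !starE; ring. Qed.

Let XX : bil (star g) (star g) = 0. Proof. by rewrite bil_star. Qed.
Let YY : bil (star g') (star g') = 0. Proof. by rewrite bil_star. Qed.

(** The vector p = d + a e_l is in E for a suitable a by the Pluecker relation, and
    it is multiplied by a common denominator of d. If a form Y_m vanished on p, then p
    would belong to E', which meets E at 0 only. *)
Lemma exists_step l : exists q : 'rV[R]_2,
  [/\ forall k, k != l -> (q *m L) 0 k \is a Num.int, (q *m L *m Y) 0 l = 0 &
      forall m, l != m -> (q *m L *m Y) 0 m != 0].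
Proof.
have [dd hdd] := choice exists_relation.
have [x [_ xl]] := @relation_needed dd l (fun l => (hdd l).2).
have gd := (hdd l).1; set d := dd l in xl gd.
have [k kl dk] : exists2 k, k != l & d 0 k != 0.
  apply/not_exists2P => h; move: xl; rewrite ev_eq0_off ?eqxx // => k kl.
  by rewrite mxE; have [//|/negP/negPn/eqP ->] := h k; rewrite rmorph0.
have [N N0 hN] := clear_denominators R d.
have N0' : N%:R != 0 :> R by rewrite pnatr_eq0 -lt0n.
have lk : l != k by rewrite eq_sym.
pose a := - (rq d *m X) 0 k / X l k.
pose p := rq d + a *: delta_mx 0 l.
have pM (M : 'M[R]_4) j : (p *m M) 0 j = (rq d *m M) 0 j + a * M l j.
  rewrite /p mulmxDl -scalemxAl -rowE; move: (rq d *m M) => w.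
  by rewrite !mxE.
have dX : (rq d *m X) 0 l = 0 by have := evE g l (rq d); rewrite gd => /esym/eqP; rewrite oppr_eq0 => /eqP.
have dY : (rq d *m Y) 0 l = 0.
  by have := evE g' l (rq d); rewrite (conj l d).1 // => /esym/eqP; rewrite oppr_eq0 => /eqP.
have pX : p *m X = 0.
  apply/rowP => j; rewrite pM [RHS]mxE; apply: (mulIf (coord_neq0 lk)).
  rewrite mulrDl (mul_plucker (rq d) j l k XX) -/X dX mul0r sub0r mul0r (alt_anti _ l j) -/X.
  by rewrite /a; field; exact: coord_neq0.
have pY : (p *m Y) 0 l = 0 by rewrite pM dY alt_diag mulr0 addr0.
have [u pu] := star_ker pX.
have qL : (N%:R *: u) *m L = N%:R *: p by rewrite -scalemxAl pu.
exists (N%:R *: u); rewrite qL -!scalemxAl; split.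
- move=> j jl; rewrite (_ : (N%:R *: p) 0 j = ratr (N%:R * d 0 j)) //.
  by rewrite !mxE eqxx (negPf jl) mulr0 addr0 rmorphM /= ratr_nat.
- by move: (p *m Y) pY => w h; rewrite mxE h mulr0.
- move=> m lm.
  have -> : (N%:R *: (p *m Y)) 0 m = N%:R * (p *m Y) 0 m by move: (p *m Y) => w; rewrite mxE.
  rewrite mulf_neq0 //; apply/eqP => pm.
  have : p = 0.
    apply: annihilators_meet => //; apply/rowP => j; rewrite [RHS]mxE.
    apply: (mulIf (coord_neq0' lm)).
    by rewrite (mul_plucker p j l m YY) -/Y pY pm !mul0r subrr.
  move/rowP/(_ k); rewrite /p !mxE eqxx (negPf kl) mulr0 addr0 => /eqP.
  by rewrite fmorph_eq0 (negPf dk).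
Qed.

Lemma column_comb x k i : bil (star x) (star x) = 0 -> alt (star x) 0 1 != 0 ->
  alt (star x) i k = alt (star x) k 1 / alt (star x) 0 1 * alt (star x) i 0 +
    (- alt (star x) k 0 / alt (star x) 0 1) * alt (star x) i 1.
Proof.
move=> h n0; apply: (mulIf n0); rewrite (alt_plucker h two_neq0 i k 0 1); field.
exact: n0.
Qed.

(** If the cross-ratios were equal, then for suitable h and h' the alternating form
    K = h (Y_0 /\ X_1) + h' (Y_1 /\ X_0) would satisfy all the relations, without
    being a combination of X and Y: on a pair (u, w) with u in E and w in E', the latter
    vanish, whereas K does not if Y_0 (u) = 0. *)
Lemma ratio_neq1 : Y 2 0 * Y 3 1 * X 3 0 * X 2 1 != Y 3 0 * Y 2 1 * X 3 1 * X 2 0.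
Proof.
apply/eqP => e.
have nX m n : m != n -> X m n != 0 := @coord_neq0 m n.
have nY m n : m != n -> Y m n != 0 := @coord_neq0' m n.
pose h := - (Y 2 1 * X 2 0); pose h' := Y 2 0 * X 2 1.
pose K : 'M[R]_4 := \matrix_(i, j) (h * (Y i 0 * X j 1 - X i 1 * Y j 0) +
  h' * (Y i 1 * X j 0 - X i 0 * Y j 1)).
have KE i j : K i j = h * (Y i 0 * X j 1 - X i 1 * Y j 0) +
  h' * (Y i 1 * X j 0 - X i 0 * Y j 1) by rewrite mxE.
have [i j|i|k hk] := @alt_surj R K; [by rewrite !KE; ring|by rewrite KE; ring|].
have evK l d : ev (star k) l d = h * (Y l 0 * (d *m X) 0 1 - X l 1 * (d *m Y) 0 0) +
    h' * (Y l 1 * (d *m X) 0 0 - X l 0 * (d *m Y) 0 1).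
  rewrite /ev starK hk ![(d *m _) 0 _]mxE !mulrBr !mulrA !big_distrr -!sumrB -big_split.
  by apply: eq_bigr => j _ /=; rewrite KE; ring.
have sol : solution g (star k).
  move=> l d gd; rewrite evK.
  have dX : (rq d *m X) 0 l = 0.
    by have := evE g l (rq d); rewrite gd => /esym/eqP; rewrite oppr_eq0 => /eqP.
  have dY : (rq d *m Y) 0 l = 0.
    by have := evE g' l (rq d); rewrite (conj l d).1 // => /esym/eqP; rewrite oppr_eq0 => /eqP.
  have pX := mul_plucker (rq d) l 0 1 XX; have pY := mul_plucker (rq d) l 0 1 YY.
  rewrite -/X -/Y dX dY !mul0r in pX pY.
  move: (rq d *m X) (rq d *m Y) dX dY pX pY => z y.
  have [zX zY] : (forall i, X i i = 0) /\ (forall i, Y i i = 0) by split => i; exact: alt_diag.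
  clear -e nX nY zX zY; move: l; apply: ord4_ind => z0 y0 pX pY.
  - by rewrite zX zY z0 y0; ring.
  - by rewrite zX zY z0 y0; ring.
  - have e1 := subr0_eq (esym pX); have e2 := subr0_eq (esym pY).
    rewrite /h /h'.
    transitivity (Y 2 1 * Y 2 0 * (z 0 0 * X 2 1 - z 0 1 * X 2 0) +
      X 2 1 * X 2 0 * (y 0 0 * Y 2 1 - y 0 1 * Y 2 0)); first by ring.
    by rewrite e1 e2 !subrr !mulr0 addr0.
  - have e1 := subr0_eq (esym pX); have e2 := subr0_eq (esym pY).
    have z1 : z 0 1 = z 0 0 * X 3 1 / X 3 0 by rewrite e1 mulfK // nX.
    have y1 : y 0 1 = y 0 0 * Y 3 1 / Y 3 0 by rewrite e2 mulfK // nY.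
    rewrite z1 y1 /h /h'.
    transitivity ((z 0 0 / X 3 0 - y 0 0 / Y 3 0) *
      (Y 2 0 * Y 3 1 * X 3 0 * X 2 1 - Y 3 0 * Y 2 1 * X 3 1 * X 2 0)).
      by field; rewrite nX // nY.
    by rewrite e subrr mulr0.
have [a [b kE]] := span sol.
have Kab i j : K i j = a * X i j + b * Y i j.
  by rewrite -hk -[k]starK kE alt_starD !alt_starZ.
have [q [_ uY0 uY1]] := exists_step 0; have {}uY1 := uY1 1 isT.
set u := q *m L in uY0 uY1; have uX : u *m X = 0 by rewrite /u -mulmxA grass_star mulmx0.
have gY : alt g' *m Y = 0 by have := alt_star_self YY; rewrite starK.
have [j wX] : exists j, (alt g' *m X) j 0 != 0.
  apply/not_existsP => w0; have w0' j : (alt g' *m X) j 0 = 0 by have /negP/negPn/eqP := w0 j.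
  have Xg : X *m alt g = 0 by exact: alt_star_self.
  have := congr1 (fun M => (X *m M) 1 0) mixed'.
  rewrite mulmxDr [X *m (alt g *m Y)]mulmxA Xg mul0mx addr0 mul_mx_scalar mxE.
  rewrite big1 => [|i _]; last by rewrite w0' mulr0.
  by rewrite mxE => /esym/eqP; rewrite mulf_eq0 oppr_eq0 (negPf b0) (negPf (nX 1 0 isT)).
pose w := row j (alt g').
have wY : w *m Y = 0 by rewrite /w -row_mul gY row0.
have w0 : (w *m X) 0 0 != 0 by rewrite /w -row_mul mxE.
have uK : u *m K *m w^T = 0.
  have -> : K = a *: X + b *: Y by apply/matrixP => i l; rewrite Kab; move: (X) (Y) => A B; rewrite !mxE.
  rewrite mulmxDr -!scalemxAr uX scaler0 add0r -scalemxAl.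
  have -> : Y = - Y^T by apply/matrixP => i l; rewrite [RHS]mxE [_^T _ _]mxE -alt_anti.
  by rewrite mulmxN mulNmx -mulmxA -trmx_mul wY trmx0 mulmx0 oppr0 scaler0.
have : (u *m K *m w^T) 0 0 = h' * (u *m Y) 0 1 * (w *m X) 0 0.
  have uKj l : (u *m K) 0 l = h' * (u *m Y) 0 1 * X l 0.
    have uX0 c : (u *m X) 0 c = 0 by rewrite uX mxE.
    have -> : (u *m K) 0 l = h * ((u *m Y) 0 0 * X l 1 - (u *m X) 0 1 * Y l 0) +
        h' * ((u *m Y) 0 1 * X l 0 - (u *m X) 0 0 * Y l 1).
      rewrite ![(u *m _) 0 _]mxE !mulrBr !mulrA !big_distrr !big_distrl -!sumrB -big_split.
      by apply: eq_bigr => i _ /=; rewrite KE; ring.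
    by rewrite uY0 !uX0; ring.
  rewrite mxE [(w *m X) 0 0]mxE big_distrr; apply: eq_bigr => l _ /=.
  by rewrite uKj [w^T _ _]mxE; ring.
rewrite uK mxE => /esym/eqP; rewrite !mulf_eq0 (negPf w0) (negPf uY1) !orbF.
by rewrite (negPf (nY 2 0 isT)) (negPf (nX 2 1 isT)).
Qed.

Lemma irrational_quasi_periodic : exists q al be ga de al' be' ga' de',
  quasi_periodic L X Y q al be ga de al' be' ga' de'.
Proof.
have [q hq] := choice exists_step.
have X01 : X 0 1 != 0 by exact: coord_neq0.
have Y01 : Y 0 1 != 0 by exact: coord_neq0'.
exists q, (Y 2 1 / Y 0 1), (- Y 2 0 / Y 0 1), (Y 3 1 / Y 0 1), (- Y 3 0 / Y 0 1).
exists (X 2 1 / X 0 1), (- X 2 0 / X 0 1), (X 3 1 / X 0 1), (- X 3 0 / X 0 1).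
have nX m n : m != n -> X m n != 0 := @coord_neq0 m n.
have nY m n : m != n -> Y m n != 0 := @coord_neq0' m n.
split.
- by move=> l k; have [h _ _] := hq l; exact: h.
- exact: grass_star.
- exact: star_ker.
- by move=> l; exact: alt_diag.
- by move=> l; exact: alt_diag.
- by move=> l; have [_ h _] := hq l.
- by move=> l; have [_ _ h] := hq l.
- by split; rewrite mulf_neq0 ?invr_eq0 ?oppr_eq0 ?nY.
- by split; rewrite mulf_neq0 ?invr_eq0 ?oppr_eq0 ?nX.
- by move=> i; exact: column_comb.
- by move=> i; exact: column_comb.
- by move=> i; exact: column_comb.
- by move=> i; exact: column_comb.
- apply: contra ratio_neq1 => /eqP e; apply/eqP.
  have den : Y 3 0 * Y 2 1 * X 3 1 * X 2 0 != 0 by rewrite !mulf_neq0 // ?nX ?nY.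
  rewrite -[RHS]mul1r -e; field.
  by rewrite nX // nX // nX // nY // nY // nY.
Qed.

End Irrational.

(** * The slopes of tilings with a finite system *)
Section Dichotomy.
Variables (R : realType) (v : 'I_4 -> 'rV[R]_2) (T : set (tile R 4)) (L : 'M[R]_(2, 4)).
Hypothesis hT : rhombus_tiling v T.
Hypothesis LA : L *m dirmx v = 1%:M.
Hypothesis hL : forall f, is_lift v T f -> exists C, near_linear v T f L C.
Local Notation rq := (map_mx (ratr : rat -> R)).

(** A period d of a shadow can be iterated, whereas the linear form of its relation,
    which vanishes on the slope, is bounded on the shadow. *)
Lemma subperiod_grass (i j k : 'I_4) (d : 'rV[int]_3) : subperiods v T i j k d ->
  (d 0 0)%:~R * grass L j k - (d 0 1)%:~R * grass L i k + (d 0 2)%:~R * grass L i j = 0.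
Proof.
move=> [S [[f [hf SE]] [[_ perS] _]]].
have [C hC] := hL hf.
pose la (x : 'rV[R]_4) := x 0 i * grass L j k - x 0 j * grass L i k + x 0 k * grass L i j.
pose mu (x : 'rV[R]_3) := x 0 0 * grass L j k - x 0 1 * grass L i k + x 0 2 * grass L i j.
pose G := `|grass L j k| + `|grass L i k| + `|grass L i j|.
have G0 : 0 <= G by rewrite !addr_ge0.
have laL (y : 'rV[R]_2) : la (y *m L) = 0 by rewrite /la !mulL_E /grass; ring.
have la_le x : `|la x| <= G * `|x|.
  rewrite /la (le_trans (ler_normD _ _)) // /G mulrDl lerD //.
    rewrite (le_trans (ler_normB _ _)) // mulrDl !normrM.
    by rewrite lerD // mulrC ler_wpM2l // mxnorm_coord.
  by rewrite normrM mulrC ler_wpM2l // mxnorm_coord.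
have S_le x : S x -> `|mu x| <= G * (C + 2).
  rewrite SE => -[z hz <-]; have -> : mu (proj3 i j k z) = la z by rewrite /mu !mxE.
  have [y vy zy] := surface_vtx v hz.
  have -> : la z = la (z - y *m L).
    have := laL y; move: (y *m L) => w h.
    by rewrite -[LHS]subr0 -h /la !mxE; ring.
  rewrite (le_trans (la_le _)) // ler_wpM2l //.
  have -> : z - y *m L = (f y - y *m L) + (z - f y) by rewrite [RHS]addrC addrA subrK.
  by rewrite (le_trans (ler_normD _ _)) // lerD //; exact: hC.
have [a Ta _] := tiling_at 0 hT.
pose x0 := proj3 i j k (f (tile_pos a)).
have Sx0 : S x0.
  rewrite SE; exists (f (tile_pos a)) => //; exists a; split => //; exists 0, 0.
  by rewrite !scale0r !addr0 lexx ler01.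
pose dr : 'rV[R]_3 := map_mx intr d.
have Sn (n : nat) : S (x0 + n%:R *: dr).
  elim: n => [|n IH]; first by rewrite scale0r addr0.
  by rewrite -perS; exists (x0 + n%:R *: dr) => //; rewrite -natr1 scalerDl scale1r addrA.
have -> : (d 0 0)%:~R * grass L j k - (d 0 1)%:~R * grass L i k + (d 0 2)%:~R * grass L i j = mu dr.
  by rewrite /mu !mxE.
apply: (@le_scale_eq0 _ _ (2 * (G * (C + 2)))) => n.
have -> : n%:R * `|mu dr| = `|mu (x0 + n%:R *: dr) - mu x0|.
  have -> : mu (x0 + n%:R *: dr) - mu x0 = n%:R * mu dr by rewrite /mu !mxE; ring.
  by rewrite normrM [`|n%:R|]ger0_norm.
rewrite (le_trans (ler_normB _ _)) // mulr_natl mulr2n lerD //; exact: S_le.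
Qed.

(** The omitted index l determines the sign s and the coordinates of e. *)
Lemma relation_ev (i j k : 'I_4) (d : 'rV[int]_3) : (i < j)%N -> (j < k)%N ->
  exists l (e : 'rV[rat]_4) (s : R), s != 0 /\ forall x : 'rV[R]_6, ev x l (rq e) =
   s * ((d 0 0)%:~R * alt x j k - (d 0 1)%:~R * alt x i k + (d 0 2)%:~R * alt x i j).
Proof.
pose p : rat := (d 0 0)%:~R; pose q : rat := (d 0 1)%:~R; pose r : rat := (d 0 2)%:~R.
move: i j k; apply: ord4_ind; apply: ord4_ind; apply: ord4_ind => // _ _.
- exists 3, (\row_m (match val m with 0%N => p | 1%N => q | 2%N => r | _ => 0 end)), (-1).
  split=> [|x]; first by rewrite oppr_eq0 oner_eq0.
  by rewrite /ev sum4 !altE !starE ![rq _ _ _]mxE ![(\row_m _) _ _]mxE /= !ratr_int; ring.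
- exists 2, (\row_m (match val m with 0%N => p | 1%N => q | 3%N => r | _ => 0 end)), 1.
  split=> [|x]; first by rewrite oner_eq0.
  by rewrite /ev sum4 !altE !starE ![rq _ _ _]mxE ![(\row_m _) _ _]mxE /= !ratr_int; ring.
- exists 1, (\row_m (match val m with 0%N => p | 2%N => q | 3%N => r | _ => 0 end)), (-1).
  split=> [|x]; first by rewrite oppr_eq0 oner_eq0.
  by rewrite /ev sum4 !altE !starE ![rq _ _ _]mxE ![(\row_m _) _ _]mxE /= !ratr_int; ring.
- exists 0, (\row_m (match val m with 1%N => p | 2%N => q | 3%N => r | _ => 0 end)), 1.
  split=> [|x]; first by rewrite oner_eq0.
  by rewrite /ev sum4 !altE !starE ![rq _ _ _]mxE ![(\row_m _) _ _]mxE /= !ratr_int; ring.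
Qed.

Hypothesis hfin : characterize_finitely_many_slopes R (subperiods v T).

(** If the Grassmann coordinates are proportional to rational numbers, then the rows of
    their matrix give integer vectors of the slope. *)
Lemma slope_dichotomy :
  (exists u0 u1 : 'rV[R]_2, cross u0 u1 != 0 /\
     forall u k, u \in [:: u0; u1] -> (u *m L) 0 k \is a Num.int) \/
  (exists X Y q al be ga de al' be' ga' de',
     quasi_periodic L X Y q al be ga de al' be' ga' de').
Proof.
have [g gE] : exists g, forall i j, alt g i j = grass L i j.
  have [i j|i|g hg] := @alt_surj R (\matrix_(i, j) grass L i j).
  - by rewrite !mxE grassC.
  - by rewrite mxE /grass subrr.
  - by exists g => i j; rewrite hg mxE.
have [i0 [j0 [_ g0]]] := grass_neq0 LA.
have gn0 : g != 0.
  by apply: contra g0 => /eqP z; rewrite -gE z linear0 mxE.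
have gg : bil g g = 0.
  have := grass_plucker L 0 1 2 3; rewrite -!gE !altE => e.
  rewrite /bil (_ : _ + _ = 2 * (g 0 0 * g 0 5) - 2 * (g 0 1 * g 0 4 - g 0 2 * g 0 3)); last by ring.
  by rewrite e subrr.
have [[c [r gr]]|irr] := EM (rational_line g); [left|right].
  have c0 : c != 0 by apply: contra gn0 => /eqP c0; rewrite gr c0 scale0r.
  have [N N0 hN] := clear_denominators R r.
  have N0' : N%:R != 0 :> R by rewrite pnatr_eq0 -lt0n.
  pose u i : 'rV[R]_2 := (N%:R / c) *: \row_k (if k == 0 then - L 1 i else L 0 i).
  have uL i k : (u i *m L) 0 k = N%:R / c * grass L i k.
    by rewrite mulL_E !mxE /= /grass; ring.
  have ui i k : (u i *m L) 0 k \is a Num.int.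
    have gik : alt g i k = c * ratr (alt r i k).
      have -> : alt g = c *: rq (alt r) by rewrite rq_alt gr; exact: linearZ.
      by move: (alt r) => M; rewrite !mxE.
    rewrite uL -gE gik mulrA divfK // -[N%:R](ratr_nat R) -rmorphM /= mxE.
    case: (val i) (val k) => [|[|[|[|?]]]] [|[|[|[|?]]]];
      by rewrite ?mulr0 ?mulrN ?rmorphN ?rmorph0 ?rpredN ?rpred0 ?hN.
  exists (u i0), (u j0); split; last by move=> w k; rewrite !inE => /orP[] /eqP ->.
  rewrite /u crossZl crossZr !mulf_neq0 ?invr_eq0 //.
  rewrite /cross !mxE /=; apply: contra g0 => /eqP e; rewrite /grass -e; apply/eqP; ring.
have fin : exists s : seq 'rV[R]_6, forall x, solution g x -> bil x x = 0 -> x != 0 ->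
    exists y c, [/\ y \in s, c != 0 & x = c *: y].
  have [s hs] := hfin.
  pose vec (M : 'M[R]_4) : 'rV[R]_6 := \row_k match val k with
    | 0%N => M 0 1 | 1%N => M 0 2 | 2%N => M 0 3 | 3%N => M 1 2 | 4%N => M 1 3 | _ => M 2 3 end.
  have vecE x : vec (alt x) = x.
    apply/rowP => k; rewrite mxE.
    by case: k => [[|[|[|[|[|[|//]]]]]] hk] /=; rewrite altE; congr (x 0 _); apply: val_inj.
  exists (map vec s) => x solx xx x0.
  have [|M [c [Ms c0 hM]]] := hs (alt x).
    split.
    - apply/not_existsP => h; move: x0; rewrite -(vecE x) => /negP; apply.
      have {}h (i j : 'I_4) : (i < j)%N -> alt x i j = 0.
        move=> ij; apply/eqP/negPn/negP => nz; apply: (h i); by exists j.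
      by apply/eqP/rowP => k; rewrite [LHS]mxE [RHS]mxE; case: (val k) => [|[|[|[|[|?]]]]]; exact: h.
    - by move=> i j k l _ _ _; apply: alt_plucker => //; rewrite pnatr_eq0.
    - move=> i j k d ij jk hd; rewrite /subperiod_relation.
      have [l [e [t [t0 he]]]] := relation_ev d ij jk.
      have : ev x l (rq e) = 0.
        by apply: solx; rewrite he !gE (subperiod_grass hd) mulr0.
      by rewrite he => /eqP; rewrite mulf_eq0 (negPf t0) => /eqP.
  exists (vec M), c; split => //; first exact: map_f.
  rewrite -{1}(vecE x); apply/rowP => k; rewrite [LHS]mxE [RHS]mxE [vec M 0 k]mxE.
  by case: (val k) => [|[|[|[|[|?]]]]]; exact: hM.
have [g' [Vg' gg' b0]] := second_solution gn0 gg fin irr.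
have cj l (d : 'rV[rat]_4) : ev g l (rq d) = 0 <-> ev g' l (rq d) = 0.
  exact: (ev_conjugate gn0 gg fin irr Vg' gg' b0).
have sp x : solution g x -> exists a b, x = a *: g + b *: g'.
  exact: (solution_span gg fin Vg' gg' b0).
exists (alt (star g)), (alt (star g')).
exact: (irrational_quasi_periodic gE gg gg' b0 cj sp).
Qed.

End Dichotomy.

(** * Local rules *)
Section LocalRules.
Variables (R : realType) (v : 'I_4 -> 'rV[R]_2) (L : 'M[R]_(2, 4)) (c : 'I_4 -> R).
Hypothesis vcross : forall i j, i != j -> cross (v i) (v j) != 0.
Hypothesis LA : L *m dirmx v = 1%:M.
Hypothesis sgn : forall i j, 0 <= cross (v i) (v j) * grass L i j.
Hypothesis gen1 : forall x i, level L c x i \is a Num.int -> exists u, lf L u i != 0.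
Hypothesis gen2 : forall x i j, i != j -> level L c x i \is a Num.int ->
  level L c x j \is a Num.int -> grass L i j != 0.
Hypothesis gen3 : forall x i j k, uniq [:: i; j; k] -> level L c x i \is a Num.int ->
  level L c x j \is a Num.int -> level L c x k \isn't a Num.int.
Variable D : {vspace 'rV[R]_4}.
Hypothesis hD : row_of L D.
Local Notation A := (dirmx v).
Local Notation e_ k := (basis_vec R k : 'rV[R]_4).
Local Notation T := (cut_tiling v L c).

Lemma sign_int (ep : R) : `|ep| = 1 -> ep \is a Num.int.
Proof.
case: (ger0P ep) => _ e; first by rewrite e rpred1.
by rewrite -[ep]opprK e rpredN1.
Qed.

(** The deviation from the slope is bounded uniformly in U: the displacements between
    the vertices of the cut tiling that the structure of the slope provides are
    short, hence exist in every tiling with the same local patterns. *)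
Lemma local_deviation :
  (exists u0 u1 : 'rV[R]_2, cross u0 u1 != 0 /\
     forall u k, u \in [:: u0; u1] -> (u *m L) 0 k \is a Num.int) \/
  (exists X Y q al be ga de al' be' ga' de',
     quasi_periodic L X Y q al be ga de al' be' ga' de') ->
  exists rho B, 0 < rho /\ forall U, rhombus_tiling v U ->
    atlas v U rho `<=` atlas v T rho ->
    exists2 f, is_lift v U f & forall y z, vtx v U y -> vtx v U z ->
      `|f z - f y - (z - y) *m L| <= B.
Proof.
move=> str.
have hT : rhombus_tiling v T by exact: cut_tiling_rhombus.
have [a0 Ta0 _] := tiling_at 0 hT.
pose h := cut_height vcross LA sgn gen1 gen2 gen3.
pose F := cut_lift vcross LA sgn gen1 gen2 gen3 (tile_pos a0).
have hF : is_lift v T F by exact: cut_liftP.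
have FE y z : F z - F y = h z - h y by rewrite /F /cut_lift opprB addrA subrK.
have [C hC] : exists C, near_linear v T F L C.
  have [L' [L'A hD' hn]] := planar_linear vcross hT (cut_lifts_into vcross LA sgn gen1 gen2 gen3 hD).
  have LE : L' = L.
    apply/row_matrixP => i; rewrite !rowE.
    have [x e] := (hD _).1 ((hD' (delta_mx 0 i *m L')).2 (ex_intro _ _ erefl)).
    rewrite e; congr (_ *m _); have := congr1 (mulmx^~ A) e.
    by rewrite -!mulmxA L'A LA !mulmx1.
  by rewrite LE in hn; exact: hn.
have V0 := vsum_ge0 v.
pose common rho := 16 * vsum v + 1 <= rho.
have planarU rho U f : common rho -> rhombus_tiling v U -> is_lift v U f ->
    (forall y z, vtx v U y -> vtx v U z -> `|z - y| <= rho / 2 ->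
      `|f z - f y - (z - y) *m L| <= 2 * C) ->
    locally_planar v L (2 * C) rho (vtx v U) f.
  move=> hrho hU hf hl; split => //.
  - move=> y z vy vz; rewrite mulmxBl.
    have := lift_dir vcross hU hf vz vy => /eqP; rewrite subr_eq => /eqP ->.
    by move: (f y *m A) => w; apply/rowP => k; rewrite !mxE; ring.
  - move=> p; have [y vy py] := vtx_near p hU; exists y => //; move: hrho; rewrite /common; lra.
case: str => [[u0 [u1 [cu ui]]]|[X [Y [q [al [be [ga [de [al' [be' [ga' [de' qp]]]]]]]]]]]].
  pose rho := 16 * vsum v + 1 + 2 * (`|u0| + `|u1|).
  have u0n := normr_ge0 u0; have u1n := normr_ge0 u1.
  have rc : common rho by rewrite /common /rho; lra.
  exists (4 * rho), (2 * C); split=> [|U hU hat]; first by rewrite /rho; lra.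
  have rV : 4 * vsum v + 1 <= rho by rewrite /rho; lra.
  have [f [hf hl hQ]] := transfer vcross hT hF hC hU rV hat.
  exists f => //; apply: (bounded_rational LA (planarU _ _ _ rc hU hf hl) cu).
    by rewrite /rho; lra.
  move=> u ep y hu hep vy.
  have [|y' vy'|z vz e] := hQ (fun d => d = (ep *: u) *m L) _ _ y vy.
  - move=> d ->; rewrite -mulmxA LA mulmx1 normrZ hep mul1r.
    by move: hu; rewrite !inE => /orP[] /eqP ->; rewrite /rho; lra.
  - have [|z [vz e]] := cut_period_int vcross LA sgn gen1 gen2 gen3 vy' (u := ep *: u).
      by move=> k; rewrite lfZ; apply: rpredM; [exact: sign_int|exact: ui].
    by exists z => //; rewrite FE /h e addrAC subrr add0r.
  - by exists z => //; rewrite -e addrC subrK.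
have [N [rho1 hN]] := quasi_periodic_bounded LA qp (2 * C).
pose S := N%:R * \sum_l `|q l|.
have S0 : 0 <= S by rewrite mulr_ge0 // sumr_ge0.
have Sl l : N%:R * `|q l| <= S.
  by rewrite ler_wpM2l // (bigD1 l) //= lerDl sumr_ge0.
pose rho := `|rho1| + 16 * vsum v + 1 + 2 * S.
have r1 := normr_ge0 rho1; have r1' := ler_norm rho1.
have rc : common rho by rewrite /common /rho; lra.
have [|B hB] := hN rho; first by rewrite /rho; lra.
exists (4 * rho), B; split=> [|U hU hat]; first by rewrite /rho; lra.
have rV : 4 * vsum v + 1 <= rho by rewrite /rho; lra.
have [f [hf hl hQ]] := transfer vcross hT hF hC hU rV hat.
exists f => //; apply: (hB _ _ (planarU _ _ _ rc hU hf hl)) => l ep y hep vy.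
have [|y' vy'|z vz [tau [ht e]]] := hQ (fun d => exists tau : R, `|tau| <= 1 /\
    d = (ep * N%:R) *: (q l *m L) + tau *: e_ l) _ _ y vy.
- move=> d [tau [ht ->]]; rewrite mulmxDl -!scalemxAl -mulmxA LA mulmx1 basis_dir.
  have e1 : `|ep * N%:R| = N%:R by rewrite normrM hep mul1r ger0_norm.
  have e2 : `|(ep * N%:R) *: q l| = N%:R * `|q l| by rewrite normrZ e1.
  have e3 : `|tau *: v l| = `|tau| * `|v l| by rewrite normrZ.
  apply: le_trans (ler_normD _ _) _; rewrite e2 e3.
  have := ler_wpM2r (normr_ge0 (v l)) ht; have := le_vsum v l; have := Sl l.
  by rewrite /rho; lra.
- have [|z [tau [vz ht e]]] := cut_period vcross LA sgn gen1 gen2 gen3 vy'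
      (u := (ep * N%:R) *: q l) (l := l).
    move=> k kl; rewrite lfZ; apply: rpredM; last exact: (qp_int qp).
    by apply: rpredM; [exact: sign_int|exact: natr_int].
  exists z => //; exists tau; split => //; rewrite FE /h e -scalemxAl.
  by rewrite addrAC [_ + _ - _]addrAC subrr add0r.
- exists z, tau; split => //; rewrite -addrA -e addrC subrK //.
Qed.

(** The lift is normalised to vanish at a vertex near 0, to make the constant uniform. *)
Lemma row_of_local_rules : forall rho B, 0 < rho ->
  (forall U, rhombus_tiling v U -> atlas v U rho `<=` atlas v T rho ->
    exists2 f, is_lift v U f & forall y z, vtx v U y -> vtx v U z ->
      `|f z - f y - (z - y) *m L| <= B) ->
  exists t, local_rules v T D rho t.
Proof.
move=> rho B rho0 h; have [K K0 hK] := mulmx_norm 0 L.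
have V0 := vsum_ge0 v.
pose C := `|B| + K * (2 * vsum v).
have C0 : 0 <= C by rewrite addr_ge0 // !mulr_ge0.
exists (2 * C + 2) => U hU hat; have [f [[a [y0 [Ua ay0 _]]] hf] hB] := h U hU hat.
have [y1 vy1 hy1] := vtx_near 0 hU.
pose f1 y := f y - f y1.
have hf1 : is_lift v U f1.
  split; first by have [a1 Ua1 ay1] := vy1; exists a1, y1; rewrite /f1 subrr.
  by move=> a1 y k Ua1 ak; rewrite /f1 (hf _ _ _ Ua1 ak) addrAC.
have near : near_linear v U f1 L C.
  move=> y vy; have -> : f1 y - y *m L = (f y - f y1 - (y - y1) *m L) - y1 *m L.
    rewrite /f1 mulmxBl; move: (y *m L) (y1 *m L) => w w1.
    by apply/rowP => k; rewrite !mxE; ring.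
  rewrite (le_trans (ler_normB _ _)) // lerD //.
    by rewrite (le_trans (hB _ _ vy1 vy)) // ler_norm.
  by rewrite (le_trans (hK _)) // ler_wpM2l // -normrN -[- y1]add0r.
have [t [ht hl tC]] := thickness_attained vcross hU hf1 LA hD near C0.
by split; [exists t|exists t].
Qed.

End LocalRules.

Unset Implicit Arguments.

Theorem corollary1 (R : realType) (v : 'I_4 -> 'rV[R]_2)
    (hunit : forall i, enorm (v i) = 1)
    (hnoncol : forall i j, i != j -> free [:: v i; v j])
    (T : set (tile R 4)) (hT : rhombus_tiling v T) (hplanar : planar v T)
    (hfin : characterize_finitely_many_slopes R (subperiods v T)) :
  exists E : {vspace 'rV[R]_4},
    is_slope v T E /\ slope_admits_local_rules v E.
Proof.
have vcross i j : i != j -> cross (v i) (v j) != 0 by move=> /hnoncol/free_cross.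
have [t0 [D [_ hlift]]] := hplanar; have [_ [f [_ [hf _]]]] := hlift.
have [L [LA hD hL]] := planar_linear vcross hT hlift.
have [C hn] := hL f hf.
have hn' : near_linear v T f L `|C| by move=> y /hn h; exact: le_trans h (ler_norm _).
have sgn := grass_ge0 vcross hT hf LA hn.
exists D; split.
  by have [t [ht hl _]] := thickness_attained vcross hT hf LA hD hn' (normr_ge0 _); exists t.
have [c [gen1 gen2 gen3]] := exists_generic L.
have str := slope_dichotomy hT LA hL hfin.
have [rho [B [rho0 hB]]] := local_deviation vcross LA sgn gen1 gen2 gen3 hD str.
have [t ht] := row_of_local_rules vcross LA hD rho0 hB.
exists (cut_tiling v L c); split.
- exact: cut_tiling_rhombus.
- exact: cut_strongly_planar hD.
- exact: cut_slope hD.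
- by exists rho, t.
Qed.
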